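(* Let $a\ge 0$ and $\lambda>0$, let $w=w_\lambda(\cdot;a)$ be the symmetric Pollaczek weight on $[-1,1]$, and let $p_n$ be the corresponding orthonormal polynomials. Put $$G_n(w)=\int_{-1}^1\log(w(x))\,p_n^2(x)w(x)\,dx .$$ Then $$G_n(w)=-2a\log(n)+2a+\log\left(\frac{\Gamma(\lambda+a)\,\Gamma(\lambda+a+1)}{\pi\,\Gamma(2\lambda)}\right)+o(1),\qquad n\to\infty .$$
   Context: For real parameters $\lambda>0$, $a\ge 0$, the symmetric Pollaczek weight is the (unit mass) weight on $[-1,1]$ $$w_\lambda(x;a)=\frac{2^{2\lambda}(\lambda+a)}{2\pi\,\Gamma(2\lambda)}(1-x^2)^{\lambda-1/2}\,e^{(2\arccos x-\pi)\frac{ax}{\sqrt{1-x^2}}}\left|\Gamma\left(\lambda+i\frac{ax}{\sqrt{1-x^2}}\right)\right|^2 .$$ The corresponding orthonormal polynomials $p_n=p_n^\lambda(\cdot;a)$ ($\deg p_n=n$, positive leading coefficient, $\int_{-1}^1 p_np_mw\,dx=\delta_{nm}$) satisfy $xp_n(x)=a_{n+1}p_{n+1}(x)+a_np_{n-1}(x)$, $p_{-1}=0$, $p_0=1$, with $a_n=\frac12\sqrt{\frac{n(n+2\lambda-1)}{(n+\lambda+a)(n+\lambda+a-1)}}$. *)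

(* Defs.v *)
From mathcomp Require Import all_boot all_order all_algebra.
From mathcomp Require Import complex.
From mathcomp Require Import all_classical all_reals all_analysis.

Set Implicit Arguments.
Unset Strict Implicit.
Unset Printing Implicit Defensive.

Import Order.TTheory GRing.Theory Num.Theory.
Import numFieldNormedType.Exports.

Local Open Scope classical_set_scope.
Local Open Scope ring_scope.
Local Open Scope complex_scope.

Section Pollaczek.
Context {R : realType}.

Local Notation mu := (@lebesgue_measure R).

(* Euler's integral, correct for Re z > 0 only: the integrand is
   t ^ (z - 1) * exp (- t), split into its real and imaginary parts. *)
Definition cGamma (z : R[i]) : R[i] :=
  let: x +i* y := z in
  (\int[mu]_(t in `]0, +oo[) (t `^ (x - 1) * cos (y * ln t) * expR (- t)))%R +i*
  (\int[mu]_(t in `]0, +oo[) (t `^ (x - 1) * sin (y * ln t) * expR (- t)))%R.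

Definition Gamma (x : R) : R :=
  (\int[mu]_(t in `]0, +oo[) (t `^ (x - 1) * expR (- t)))%R.

(* At x = 1 and x = -1 this has an arbitrary value: division by 0 gives 0. *)
Definition pollaczek_weight (lambda a x : R) : R :=
  let y := a * x / Num.sqrt (1 - x ^+ 2) in
  2 `^ (2 * lambda) * (lambda + a) / (2 * pi * Gamma (2 * lambda))
  * (1 - x ^+ 2) `^ (lambda - 2^-1)
  * expR ((2 * acos x - pi) * y)
  * ComplexField.Normc.normc (cGamma (lambda +i* y)) ^+ 2.

Definition orthonormal_polynomials (w : R -> R) (p : nat -> {poly R}) : Prop :=
  [/\ forall n, size (p n) = n.+1,
      forall n, 0 < lead_coef (p n)
    & forall n m,
        (\int[mu]_(x in `[-1, 1]) ((p n).[x] * (p m).[x] * w x))%R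
        = (n == m)%:R].

Definition log_integral (w : R -> R) (p : nat -> {poly R}) (n : nat) : R :=
  (\int[mu]_(x in `[-1, 1]) (ln (w x) * (p n).[x] ^+ 2 * w x))%R.

End Pollaczek.

(* Main.v *)
(* With [x = t / sqrt (1 + t^2)] the logarithm of the weight is a constant plus
   [- (l - 1/2) ln (1 + t^2) - 2 a t atan t + ln |Gamma (l + i a t)|^2], and by Weierstrass' product
   the last term is a constant minus [sum_k ln (1 + q_k^2 t^2)], [q_k = a / (l + k)].  Write [<f>]
   for the mean of [f] with respect to [p_n^2 w] and [r_q = 2 q^2 t^2 / (1 + q^2 t^2)].
   Integrating the derivative of [t p_n^2 w] gives the exact value
   [<2 a t atan t + sum_k r_(q_k)> = 2 a sum_(j < n) 1 / (l + a + j) + a / (l + a + n)],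
   which carries the divergence [2 a ln n].  The remaining terms converge: the Chebyshev moments
   of [p_n^2 w] tend to those of the arcsine law because [a_n -> 1/2], so [<r_q> -> 2 q / (1 + q)],
   and integrating in [q], [<ln (1 + q^2 t^2)> -> 2 ln (1 + q)].  Limit and sum over [k] are
   exchanged with the bound [<r_q> <= C q] uniform in [n], obtained from
   [<1 / (1 + s^2 - x)> <= K / s]; the latter is a Nash inequality for the Jacobi matrix, whose
   ground state [p_k(1)] is nondecreasing.
   The recurrence for [p_n] is obtained from the Stieltjes transform of [w]: a Fourier
   representation of [|Gamma|^2] turns it into the hypergeometric integral
   [int_0^oo e^(- (l + kappa a) h) (1 - r^2 e^(-h))^(-2 l) dh], [z = (r + 1/r) / 2], which starts a
   three-term recurrence of functions of the second kind. *)
Require Import Defs.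
From mathcomp Require Import all_boot all_order all_algebra.
From mathcomp Require Import complex.
From mathcomp Require Import all_classical all_reals all_analysis.
From mathcomp Require Import measurable_realfun ring lra.

Set Implicit Arguments.
Unset Strict Implicit.
Unset Printing Implicit Defensive.

Import Order.TTheory GRing.Theory Num.Theory.
Import numFieldNormedType.Exports.

Local Open Scope classical_set_scope.
Local Open Scope ring_scope.

(** * Derivatives and integrals on the real line *)

Section RealLine.
Context {R : realType}.
Implicit Types (f g F : R -> R) (x y a b c d : R).

Local Notation mu := (@lebesgue_measure R).

(** Convergence to the arcsine law says nothing about [ln w]: [2 a t atan t] and the Gamma factor
    are both of size [pi a |t|], and [|t| = |x| / sqrt (1 - x^2)] has infinite arcsine mean.
    Integration by parts dictates the splitting: it makes the mean of [2 a t atan t] plus the sum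
    [RS] of the [r_(q_k)] exact, and subtracting [RS] from the logarithm of Weierstrass' product
    cancels the linear growth there. The remaining series is cut at [k < n], with the [n] of [p_n].
    The sum of its limits then contains the harmonic sum of the exact mean with the opposite sign,
    and both cancel before any limit is taken, so that no digamma function or Euler constant
    appears. What survives is [- 2 sum_(k < n) ln (1 + q_k)], given by a quotient of Gamma values at
    [l + a + n] and [l + n], which yields [- 2 a ln n], and [2 (l + n) ln (1 + q_n)], which tends to
    [2 a]. All integrals are real: the complex Gamma function enters through its squared modulus
    only, and its asymptotics come from elementary inequalities under the integral sign, not from
    Stirling's formula. *)

Lemma is_derive_add f g x a b : is_derive x 1 f a -> is_derive x 1 g b ->
  is_derive x 1 (fun t => f t + g t) (a + b).
Proof. by move=> *; exact: is_deriveD. Qed.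

Lemma is_derive_sub f g x a b : is_derive x 1 f a -> is_derive x 1 g b ->
  is_derive x 1 (fun t => f t - g t) (a - b).
Proof. by move=> *; exact: is_deriveB. Qed.

Lemma is_derive_opp f x a : is_derive x 1 f a ->
  is_derive x 1 (fun t => - f t) (- a).
Proof. by move=> *; exact: is_deriveN. Qed.

Lemma is_derive_mul f g x a b : is_derive x 1 f a -> is_derive x 1 g b ->
  is_derive x 1 (fun t => f t * g t) (a * g x + f x * b).
Proof.
move=> fa gb; have -> : a * g x + f x * b = f x *: b + g x *: a.
  by rewrite addrC /GRing.scale/= (mulrC a).
exact: is_deriveM.
Qed.

Lemma is_derive_const c x : is_derive x 1 (fun=> c) 0.
Proof. exact: (@is_derive_cst R R R^o c x 1). Qed.

Lemma is_derive_var x : is_derive x 1 (fun t : R => t) 1.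
Proof. exact: (@is_derive_id R R^o x 1). Qed.

Lemma is_derive_chain f g x a b : is_derive (g x) 1 f a -> is_derive x 1 g b ->
  is_derive x 1 (fun t => f (g t)) (a * b).
Proof. by move=> ? ?; exact: is_derive1_comp. Qed.

Lemma is_derive_exp f x a : is_derive x 1 f a ->
  is_derive x 1 (fun t => expR (f t)) (expR (f x) * a).
Proof. by move=> ?; apply: is_derive_chain. Qed.

Lemma is_derive_sine f x a : is_derive x 1 f a ->
  is_derive x 1 (fun t => sin (f t)) (cos (f x) * a).
Proof. by move=> ?; apply: is_derive_chain. Qed.

Lemma is_derive_cosine f x a : is_derive x 1 f a ->
  is_derive x 1 (fun t => cos (f t)) (- sin (f x) * a).
Proof. by move=> ?; apply: is_derive_chain. Qed.

Lemma is_derive_arctan f x a : is_derive x 1 f a ->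
  is_derive x 1 (fun t => atan (f t)) ((1 + f x ^+ 2)^-1 * a).
Proof. by move=> ?; apply: is_derive_chain. Qed.

Lemma is_derive_log f x a : 0 < f x -> is_derive x 1 f a ->
  is_derive x 1 (fun t => ln (f t)) ((f x)^-1 * a).
Proof. by move=> f0 ?; apply: is_derive_chain; exact: is_derive1_ln. Qed.

Lemma is_derive_pow f x a p : 0 < f x -> is_derive x 1 f a ->
  is_derive x 1 (fun t => f t `^ p) (p * f x `^ (p - 1) * a).
Proof. by move=> f0 ?; apply: (@is_derive_chain (fun t => t `^ p)); exact: is_derive1_powR. Qed.

Lemma is_derive_expn f x a n : is_derive x 1 f a ->
  is_derive x 1 (fun t => f t ^+ n) (n%:R * f x ^+ n.-1 * a).
Proof.
move=> fa; elim: n => [|n IH]; first by rewrite !mul0r; exact: is_derive_const.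
rewrite (_ : (fun t => _) = (fun t => f t * f t ^+ n)); last first.
  by apply/funext => t; rewrite exprS.
eapply is_derive_eq; [exact: is_derive_mul fa IH|case: n {IH} => [|n] /=].
  by rewrite !expr0 mul0r mul0r mulr0 addr0 mulr1 mul1r mul1r.
by rewrite -[n.+2%:R]natr1 exprS; ring.
Qed.

Lemma is_derive_inv f x a : f x != 0 -> is_derive x 1 f a ->
  is_derive x 1 (fun t => (f t)^-1) (- (f x) ^- 2 * a).
Proof. by move=> f0 fa; exact: (@is_deriveV R f x a 1 f0 fa). Qed.

Lemma is_derive_root f x a : 0 < f x -> is_derive x 1 f a ->
  is_derive x 1 (fun t => Num.sqrt (f t)) ((2 * Num.sqrt (f x))^-1 * a).
Proof. by move=> f0 ?; apply: is_derive_chain; exact: is_derive1_sqrt. Qed.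

Lemma is_derive_continuous f x a : is_derive x 1 f a -> {for x, continuous f}.
Proof.
by move=> fa; apply/differentiable_continuous/derivable1_diffP/(@ex_derive _ _ _ _ _ _ _ fa).
Qed.

Lemma derive1_is_derive f (f' : R -> R) :
  (forall x, is_derive x 1 f (f' x)) -> derive1 f = f'.
Proof.
by move=> df; apply/funext => x; rewrite derive1E; apply: (@derive_val _ _ _ _ _ _ _ (df x)).
Qed.

End RealLine.

(** The value of the derivative is an existential variable, filled in while the term is traversed;
    [notypeclasses refine] keeps instance search from choosing it. Side conditions such as
    positivity, and functions without a rule, are left as goals. The rules for [*%R c], [+%R c] and
    [-%R] serve eta-reduced functions. *)
Ltac der1 :=
  lazymatch goal with
  | |- is_derive ?x _ (fun _ => ?c) _ => notypeclasses refine (is_derive_const c x)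
  | |- is_derive ?x _ (fun t => t) _ => notypeclasses refine (is_derive_var x)
  | |- is_derive ?x _ ( *%R ?c) _ => notypeclasses refine (is_derive_mul (is_derive_const c x) (is_derive_var x))
  | |- is_derive ?x _ -%R _ => notypeclasses refine (is_derive_opp (is_derive_var x))
  | |- is_derive ?x _ ( +%R ?c) _ => notypeclasses refine (is_derive_add (is_derive_const c x) (is_derive_var x))
  | |- is_derive ?x _ (@ln _) _ => notypeclasses refine (is_derive_log _ (is_derive_var x))
  | |- is_derive ?x _ expR _ => notypeclasses refine (is_derive_expR x)
  | |- is_derive ?x _ sin _ => notypeclasses refine (is_derive_sin x)
  | |- is_derive ?x _ cos _ => notypeclasses refine (is_derive_cos x)
  | |- is_derive ?x _ atan _ => notypeclasses refine (is_derive1_atan x)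
  | |- is_derive _ _ (fun t => _ + - _) _ => notypeclasses refine (is_derive_sub _ _)
  | |- is_derive _ _ (fun t => _ + _) _ => notypeclasses refine (is_derive_add _ _)
  | |- is_derive _ _ (fun t => _ * _) _ => notypeclasses refine (is_derive_mul _ _)
  | |- is_derive _ _ (fun t => - _) _ => notypeclasses refine (is_derive_opp _)
  | |- is_derive _ _ (fun t => _ ^+ ?n) _ => notypeclasses refine (is_derive_expn n _)
  | |- is_derive _ _ (fun t => expR _) _ => notypeclasses refine (is_derive_exp _)
  | |- is_derive _ _ (fun t => sin _) _ => notypeclasses refine (is_derive_sine _)
  | |- is_derive _ _ (fun t => cos _) _ => notypeclasses refine (is_derive_cosine _)
  | |- is_derive _ _ (fun t => atan _) _ => notypeclasses refine (is_derive_arctan _)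
  | |- is_derive _ _ (fun t => ln _) _ => notypeclasses refine (is_derive_log _ _)
  | |- is_derive _ _ (fun t => _ `^ ?p) _ => notypeclasses refine (is_derive_pow p _ _)
  | |- is_derive _ _ (fun t => _ ^-1) _ => notypeclasses refine (is_derive_inv _ _)
  | |- is_derive _ _ (fun t => Num.sqrt _) _ => notypeclasses refine (is_derive_root _ _)
  end; cbv beta.
Ltac der := repeat der1.
Ltac derc := eapply is_derive_eq; [der | cbv beta].

Ltac contd := let x := fresh "x" in move=> x; eapply is_derive_continuous; der.

(** * Integration over the whole line *)

Section Integrals.
Context {R : realType}.
Implicit Types (f g F : R -> R) (x y a b c d : R).

Local Notation mu := (@lebesgue_measure R).

(** Integrals are taken over the whole line and a domain becomes an indicator factor, so that
    linearity, comparison and limits need one version each. *)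
Definition itg f : Prop := mu.-integrable setT (EFin \o f).
Definition RInt f : R := (\int[mu]_x f x)%R.

Lemma itg_measurable f : itg f -> measurable_fun setT f.
Proof. by move=> /measurable_int /measurable_EFinP. Qed.

Lemma itg_le f g : measurable_fun setT f -> (forall x, `|f x| <= g x) ->
  itg g -> itg f.
Proof.
move=> mf fg ig; apply: le_integrable ig => //; first exact/measurable_EFinP.
move=> x _ /=; rewrite lee_fin (le_trans (fg x))// ler_norm//.
Qed.

Lemma itgD f g : itg f -> itg g -> itg (fun x => f x + g x).
Proof. by move=> jf jg; exact: (integrableD measurableT jf jg). Qed.

Lemma itgB f g : itg f -> itg g -> itg (fun x => f x - g x).
Proof. by move=> jf jg; exact: (integrableB measurableT jf jg). Qed.

Lemma itgN f : itg f -> itg (fun x => - f x).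
Proof. by move=> jf; exact: (integrableN jf). Qed.

Lemma itgZ c f : itg f -> itg (fun x => c * f x).
Proof. by move=> jf; exact: (integrableZl measurableT _ jf). Qed.

Lemma itgZr c f : itg f -> itg (fun x => f x * c).
Proof.
move=> jf; rewrite (_ : (fun x => _) = (fun x => c * f x)); first exact: itgZ.
by apply/funext => x; rewrite mulrC.
Qed.

Lemma itg0 : itg (fun=> 0).
Proof. exact: integrable0. Qed.

Lemma itg_norm f : itg f -> itg (fun x => `|f x|).
Proof. by move=> /integrable_abse. Qed.

Lemma itg_sum (J : Type) (r : seq J) (P : pred J) (h : J -> R -> R) :
  (forall i, itg (h i)) -> itg (fun x => \sum_(i <- r | P i) h i x).
Proof.
move=> ih; elim: r => [|i r IH].
  by rewrite (_ : (fun _ => _) = fun=> 0)//; [exact: itg0|apply/funext => x; rewrite big_nil].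
case: (boolP (P i)) => Pi; last first.
  by rewrite (_ : (fun _ => _) = (fun x => \sum_(i <- r | P i) h i x))//;
    apply/funext => x; rewrite big_cons (negbTE Pi).
rewrite (_ : (fun _ => _) = (fun x => h i x + \sum_(i <- r | P i) h i x)).
  exact: itgD.
by apply/funext => x; rewrite big_cons Pi.
Qed.

Lemma intD f g : itg f -> itg g -> RInt (fun x => f x + g x) = RInt f + RInt g.
Proof. by move=> jf jg; exact: (RintegralD measurableT jf jg). Qed.

Lemma intB f g : itg f -> itg g -> RInt (fun x => f x - g x) = RInt f - RInt g.
Proof. by move=> jf jg; exact: (RintegralB measurableT jf jg). Qed.

Lemma intZ c f : itg f -> RInt (fun x => c * f x) = c * RInt f.
Proof. by move=> jf; exact: (RintegralZl _ measurableT jf). Qed.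

Lemma intN f : itg f -> RInt (fun x => - f x) = - RInt f.
Proof.
move=> jf; have := intZ (-1) jf; rewrite mulN1r => <-.
by congr RInt; apply/funext => x; rewrite mulN1r.
Qed.

Lemma int0 : RInt (fun=> 0) = 0.
Proof. by rewrite /RInt /Rintegral integral0. Qed.

Lemma int_sum (J : Type) (r : seq J) (P : pred J) (h : J -> R -> R) :
  (forall i, itg (h i)) ->
  RInt (fun x => \sum_(i <- r | P i) h i x) = \sum_(i <- r | P i) RInt (h i).
Proof.
move=> ih; elim: r => [|i r IH].
  by rewrite big_nil -[RHS]int0; congr RInt; apply/funext => x; rewrite big_nil.
rewrite big_cons; case: ifPn => Pi; last first.
  by rewrite -IH; congr RInt; apply/funext => x; rewrite big_cons (negbTE Pi).
rewrite -IH -intD//; last exact: itg_sum.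
by congr RInt; apply/funext => x; rewrite big_cons Pi.
Qed.

Lemma int_le f g : itg f -> itg g -> (forall x, f x <= g x) -> RInt f <= RInt g.
Proof. by move=> jf jg fg; apply: le_Rintegral. Qed.

Lemma int_ge0 f : (forall x, 0 <= f x) -> 0 <= RInt f.
Proof. by move=> f0; apply: Rintegral_ge0. Qed.

Lemma int_norm_le f g : itg f -> itg g -> (forall x, `|f x| <= g x) ->
  `|RInt f| <= RInt g.
Proof.
move=> jf jg fg; apply: le_trans (le_normr_Rintegral _ jf) _ => //.
by apply: int_le => //; exact: itg_norm.
Qed.

Lemma int_dct (h : nat -> R -> R) f g :
  (forall n, measurable_fun setT (h n)) -> itg g ->
  (forall n x, `|h n x| <= g x) -> (forall x, h n x @[n --> \oo] --> f x) ->
  itg f /\ RInt (h n) @[n --> \oo] --> RInt f.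
Proof.
move=> mh ig hg hf.
have mf : measurable_fun setT f.
  by apply: (measurable_fun_cvg mh) => x _; exact: hf.
have [| | | |  |jf _ cf] := @dominated_convergence _ _ R mu setT measurableT
  (fun n => EFin \o h n) (EFin \o f) (EFin \o g).
- by move=> n; apply/measurable_EFinP; exact: mh.
- by apply/measurable_EFinP.
- by apply: aeW => x _; apply: cvg_EFin; [exact: nearW|exact: hf].
- by [].
- by apply: aeW => x n _ /=; rewrite lee_fin; exact: hg.
split=> //; rewrite /RInt /Rintegral.
have fI : (\int[mu]_x (f x)%:E)%E \is a fin_num by exact: integrable_fin_num.
by apply: fine_cvg; rewrite fineK//; exact: cf.
Qed.

Lemma I_mkcond (A : set R) f :
  (\int[mu]_(x in A) f x)%R = RInt (fun x => \1_A x * f x).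
Proof.
rewrite Rintegral_mkcond; congr Rintegral; apply/funext => x.
by rewrite patchE indicE; case: ifP => _; rewrite ?mul1r ?mul0r.
Qed.

Lemma itg_indic (A : set R) f : measurable A -> itg f -> itg (fun x => \1_A x * f x).
Proof.
move=> mA jf; apply: itg_le (itg_norm jf).
  by apply: measurable_funM; [exact: measurable_indic|exact: itg_measurable].
move=> x; rewrite normrM indicE; case: (x \in A); rewrite ?normr1 ?mul1r//.
by rewrite normr0 mul0r.
Qed.

Lemma int_derive_segment F f a b : a < b ->
  (forall x, a <= x <= b -> is_derive x 1 F (f x)) ->
  (forall x, a <= x <= b -> {for x, continuous f}) ->
  RInt (fun x => \1_`[a, b] x * f x) = F b - F a.
Proof.
move=> ab dF cf; rewrite -I_mkcond /Rintegral (@continuous_FTC2 _ f F)//.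
- apply: continuous_in_subspaceT => x; rewrite inE/= in_itv/= => xab; exact: cf.
- have cF x : a <= x <= b -> {for x, continuous F}.
    by move=> /dF; exact: is_derive_continuous.
  split.
  + move=> x; rewrite in_itv/= => /andP[ax xb].
    by have [] := dF x; rewrite ?(ltW ax) ?(ltW xb).
  + by apply: cvg_at_right_filter; apply: cF; rewrite lexx ltW.
  + by apply: cvg_at_left_filter; apply: cF; rewrite lexx ltW.
- move=> x; rewrite in_itv/= => /andP[ax xb]; rewrite derive1E.
  by apply: (@derive_val _ _ _ _ _ _ _ (dF _ _)); rewrite ?(ltW ax) ?(ltW xb).
Qed.

Lemma int_expand (A : nat -> set R) f : itg f -> (forall n, measurable (A n)) ->
  (forall x, \forall n \near \oo, A n x) ->
  RInt (fun x => \1_(A n) x * f x) @[n --> \oo] --> RInt f.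
Proof.
move=> jf mA hA; apply: (proj2 (@int_dct _ _ (fun x => `|f x|) _ _ _ _)).
- by move=> n; apply: itg_measurable; exact: itg_indic.
- exact: itg_norm.
- move=> n x; rewrite normrM indicE; case: (x \in A n); rewrite ?normr1 ?mul1r//.
  by rewrite normr0 mul0r.
- move=> x; apply: cvg_near_cst; near=> n.
  by rewrite indicE mem_set ?mul1r//; near: n; exact: hA.
Unshelve. all: by end_near. Qed.

Lemma near_natr_ge x : \forall n \near \oo, x <= n%:R.
Proof.
near=> n; apply: le_trans (_ : (Num.trunc `|x|).+1%:R <= _).
  by rewrite (le_trans (ler_norm _))// ltW// truncnS_gt.
by rewrite ler_nat; near: n; exists (Num.trunc `|x|).+1.
Unshelve. all: by end_near. Qed.

(** Limits along the integers suffice because [f] is assumed integrable: the integrals over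
    [[-n, n]] then converge by domination. *)
Lemma int_derive F f a b : (forall x, is_derive x 1 F (f x)) ->
  continuous f -> itg f -> F n%:R @[n --> \oo] --> b ->
  F (- n%:R) @[n --> \oo] --> a -> RInt f = b - a.
Proof.
move=> dF cf jf Fb Fa.
have h1 : RInt (fun x => \1_`[- n%:R, n%:R] x * f x) @[n --> \oo] --> RInt f.
  apply: (@int_expand (fun n => `[- n%:R, n%:R]%classic)) => // x.
  near=> n; rewrite /= in_itv/= -ler_norml; near: n; exact: near_natr_ge.
have h2 : RInt (fun x => \1_`[- n%:R, n%:R] x * f x) @[n --> \oo] --> b - a.
  apply: cvg_trans (cvgB Fb Fa); apply: near_eq_cvg; near=> n.
  have n0 : (0 < n)%N by near: n; exists 1%N.
  have n0' : 0 < n%:R :> R by rewrite ltr0n.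
  by apply/esym/int_derive_segment => // [|x _]; [lra|exact: cf].
exact: (cvg_unique _ h1 h2).
Unshelve. all: by end_near. Qed.

(** Hypotheses are made for [x >= 0] only, since the half-line integrands met later are singular at
    some negative point. *)
Lemma int_derive_pos F f l : (forall x, 0 <= x -> is_derive x 1 F (f x)) ->
  (forall x, 0 <= x -> {for x, continuous f}) ->
  itg (fun x => \1_`]0, +oo[ x * f x) -> F n%:R @[n --> \oo] --> l ->
  RInt (fun x => \1_`]0, +oo[ x * f x) = l - F 0.
Proof.
move=> dF cf jf Fl.
have h1 : RInt (fun x => \1_`]-oo, n%:R] x * (\1_`]0, +oo[ x * f x)) @[n --> \oo]
    --> RInt (fun x => \1_`]0, +oo[ x * f x).
  apply: (@int_expand (fun n => `]-oo, n%:R]%classic)) => // x.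
  near=> n; rewrite /= in_itv/=; near: n; exact: near_natr_ge.
have h2 : RInt (fun x => \1_`]-oo, n%:R] x * (\1_`]0, +oo[ x * f x)) @[n --> \oo]
    --> l - F 0.
  apply: cvg_trans (cvgB Fl (cvg_cst (F 0))); apply: near_eq_cvg; near=> n.
  have n0 : (0 < n)%N by near: n; exists 1%N.
  have n0' : 0 < n%:R :> R by rewrite ltr0n.
  apply/esym; rewrite -[RHS](@int_derive_segment F f)//; last 2 first.
    by move=> x /andP[x0 _]; exact: dF.
    by move=> x /andP[x0 _]; exact: cf.
  rewrite -(I_mkcond `[0, n%:R] f) -(Rintegral_itv_obnd_cbnd (r := 0)).
    rewrite I_mkcond; congr RInt; apply/funext => x.
    rewrite !indicE !mem_setE !in_itv/= andbT mulrA; congr (_ * _).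
    by case: (0 < x); case: (x <= _); rewrite ?mulr0 ?mulr1.
  apply: (@integrableS _ _ _ mu `[0, n%:R]) => //.
    by move=> x /=; rewrite !in_itv/= => /andP[/ltW -> ->].
  apply: continuous_compact_integrable; first exact: segment_compact.
  apply: continuous_in_subspaceT => x; rewrite inE/= in_itv/= => /andP[x0 _].
  exact: cf.
exact: (cvg_unique _ h1 h2).
Unshelve. all: by end_near. Qed.

End Integrals.

(** * Change of variables and Fubini's theorem *)

Section Substitution.
Context {R : realType}.
Implicit Types (f g F G : R -> R) (x y a b c d : R).

Local Notation mu := (@lebesgue_measure R).

Section FromNonnegative.
Variables (F f : R -> R) (D : set R).
Hypothesis cF : continuous F.
Hypothesis cf : continuous f.
Hypothesis f0 : forall x, 0 < f x.
Hypothesis DFx : forall x, D (F x).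
Hypothesis mD : forall G, (forall y, D y -> {for y, continuous G}) ->
  measurable_fun D G.
Hypothesis ge0_subst : forall G, (forall y, D y -> 0 <= G y) ->
  (forall y, D y -> {for y, continuous G}) ->
  (\int[mu]_(y in D) (G y)%:E = \int[mu]_x (G (F x) * f x)%:E)%E.

(** Positive and negative parts are transported separately; positivity of the Jacobian [f] lets it
    pass through the maximum with 0. *)
Lemma change_of_variable_Rint G : (forall y, D y -> {for y, continuous G}) ->
  (\int[mu]_(y in D) G y)%R = RInt (fun x => G (F x) * f x).
Proof.
move=> cG; rewrite /RInt /Rintegral [in LHS]integralE [in RHS]integralE; congr (fine (_ - _)).
  transitivity (\int[mu]_(y in D) (Num.max (G y) 0)%:E)%E.
    by apply: eq_integral => y _; rewrite funeposE EFin_max.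
  rewrite ge0_subst.
  - apply: eq_integral => y _; rewrite funeposE /= -EFin_max; congr EFin.
    by rewrite maxr_pMl ?mul0r// ltW.
  - by move=> y _; rewrite le_max lexx orbT.
  - by move=> y Dy; apply: continuous_max; [exact: cG|exact: cst_continuous].
transitivity (\int[mu]_(y in D) (Num.max (- G y) 0)%:E)%E.
  by apply: eq_integral => y _; rewrite funenegE /= EFin_max.
rewrite ge0_subst.
- apply: eq_integral => y _; rewrite funenegE /= -?EFinN -EFin_max; congr EFin.
  by rewrite maxr_pMl ?mul0r ?mulNr// ltW.
- by move=> y _; rewrite le_max lexx orbT.
- move=> y Dy; apply: continuous_max; last exact: cst_continuous.
  by apply: continuousN; exact: cG.
Qed.

Lemma change_of_variable_itg G : (forall y, D y -> {for y, continuous G}) ->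
  mu.-integrable D (EFin \o G) <-> itg (fun x => G (F x) * f x).
Proof.
move=> cG; have e : (\int[mu]_(y in D) `|(G y)%:E| = \int[mu]_x `|(G (F x) * f x)%:E|)%E.
  transitivity (\int[mu]_(y in D) (`|G y|)%:E)%E; first exact: eq_integral.
  rewrite ge0_subst//.
    by apply: eq_integral => x _ /=; rewrite normrM (gtr0_norm (f0 x)).
  by move=> y Dy; apply: continuous_comp; [exact: cG|exact: norm_continuous].
split=> /integrableP[mG].
  rewrite e => h; apply/integrableP; split=> //; apply/measurable_EFinP.
  apply: continuous_measurable_fun => x; apply: (@continuousM R R); last exact: cf.
  by apply: continuous_comp; [exact: cF|exact: cG].
rewrite -e => h; apply/integrableP; split=> //; apply/measurable_EFinP.
exact: mD.
Qed.

End FromNonnegative.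

Section Range.
Variables (F f : R -> R) (D : set R).
Hypothesis dF : forall x, is_derive x 1 F (f x).
Hypothesis cf : continuous f.
Hypothesis f0 : forall x, 0 < f x.
Hypothesis DF : D = range F.

Let cF : continuous F.
Proof. by move=> x; exact: is_derive_continuous (dF x). Qed.

Lemma derive_gt0_increasing x y : x < y -> F x < F y.
Proof.
move=> xy; have [z _] := @MVT R F f x y xy (fun z _ => dF z)
  (continuous_subspaceT cF).
by move=> e; rewrite -subr_gt0 e mulr_gt0// subr_gt0.
Qed.

Let Fle x y : x <= y -> F x <= F y.
Proof.
by rewrite le_eqVlt => /predU1P[->//|/derive_gt0_increasing/ltW].
Qed.

Let A (n : nat) : set R := `[F (- n%:R), F n%:R]%classic.
Let B (n : nat) : set R := `[- n%:R, n%:R]%classic.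

Let UA : D = \bigcup_n A n.
Proof.
rewrite DF; apply/seteqP; split=> [_ [x _ <-]|y [n _]].
  have [n _ /(_ n (leqnn n)) nx] := near_natr_ge `|x|.
  by exists n => //; rewrite /A /= in_itv/= !Fle//; move: nx; rewrite ler_norml => /andP[].
rewrite /A /= in_itv/= => yn.
have nn : - n%:R <= n%:R :> R by rewrite ge0_cp.
have [||x _ <-] := @IVT R F _ _ y nn; [exact: continuous_subspaceT| |by exists x].
by rewrite (min_idPl (Fle nn)) (max_idPr (Fle nn)).
Qed.

Let UB : setT = \bigcup_n B n.
Proof.
apply/seteqP; split=> // x _; have [n _ /(_ n (leqnn n)) nx] := near_natr_ge `|x|.
by exists n => //; rewrite /B /= in_itv/= -ler_norml.
Qed.

Let mA n : measurable (A n). Proof. exact: measurable_itv. Qed.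

Lemma range_measurable : measurable D.
Proof. by rewrite UA; exact: bigcupT_measurable. Qed.

Lemma continuous_range_measurable G :
  (forall y, D y -> {for y, continuous G}) -> measurable_fun D G.
Proof.
move=> cG; rewrite UA; apply/measurable_fun_bigcup => // n.
apply: subspace_continuous_measurable_fun => //.
apply: continuous_in_subspaceT => y; rewrite inE => Ay; apply: cG.
by rewrite UA; exists n.
Qed.

(** Both sides are monotone limits along the exhaustions [A n] of the range and [B n] of the line;
    on these segments the substitution rule for increasing functions applies. *)
Lemma subst_ge0 G : (forall y, D y -> 0 <= G y) ->
  (forall y, D y -> {for y, continuous G}) ->
  (\int[mu]_(y in D) (G y)%:E = \int[mu]_x (G (F x) * f x)%:E)%E.
Proof.
move=> G0 cG.
have DFx x : D (F x) by rewrite DF; exists x.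
have cGF : continuous (fun x => G (F x) * f x).
  move=> x; apply: (@continuousM R R); last exact: cf.
  by apply: continuous_comp; [exact: cF|exact: cG].
have mD := continuous_range_measurable cG.
have subA n : A n `<=` D by move=> y Ay; rewrite UA; exists n.
have cvA : (\int[mu]_(y in A n) (G y)%:E)%E @[n --> \oo] -->
    (\int[mu]_(y in D) (G y)%:E)%E.
  rewrite UA; apply: ge0_nondecreasing_set_cvg_integral => //.
  - apply/nondecreasing_seqP => n; rewrite subsetEset => y; rewrite /A/= !in_itv/=.
    move=> /andP[yl yr]; rewrite (le_trans _ yl) ?(le_trans yr)// Fle//.
      by rewrite ler_nat.
    by rewrite lerN2 ler_nat.
  - by move=> n; apply/measurable_EFinP; apply: measurable_funS mD => //; exact: range_measurable.
  - by move=> n y Ay; rewrite lee_fin G0//; exact: subA Ay.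
have cvB : (\int[mu]_(y in B n) (G (F y) * f y)%:E)%E @[n --> \oo] -->
    (\int[mu]_x (G (F x) * f x)%:E)%E.
  rewrite UB; apply: ge0_nondecreasing_set_cvg_integral => //.
  - apply/nondecreasing_seqP => n; rewrite subsetEset => y; rewrite /B/= !in_itv/=.
    move=> /andP[yl yr]; rewrite (le_trans _ yl) ?(le_trans yr)//.
      by rewrite ler_nat.
    by rewrite lerN2 ler_nat.
  - by move=> n; exact: measurable_itv.
  - move=> n; apply/measurable_EFinP; apply: measurable_funTS.
    exact: continuous_measurable_fun.
  - by move=> n y _; rewrite lee_fin mulr_ge0// ?G0// ltW.
suff e n : (\int[mu]_(y in A n) (G y)%:E = \int[mu]_(y in B n) (G (F y) * f y)%:E)%E.
  by rewrite (eq_cvg _ _ e) in cvA; apply: (cvg_unique _ cvA cvB).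
rewrite /B /A (@integration_by_substitution_increasing R F G); first last.
- apply: continuous_in_subspaceT => y; rewrite inE => Ay; apply: cG.
  by rewrite UA; exists n.
- split.
  + by move=> x _; have [] := dF x.
  + by apply: cvg_at_right_filter; exact: cF.
  + by apply: cvg_at_left_filter; exact: cF.
- rewrite (derive1_is_derive dF); apply/cvg_ex; exists (f n%:R).
  by apply: cvg_at_left_filter; exact: cf.
- rewrite (derive1_is_derive dF); apply/cvg_ex; exists (f (- n%:R)).
  by apply: cvg_at_right_filter; exact: cf.
- by rewrite (derive1_is_derive dF) => x _; exact: cf.
- by move=> x y _ _; exact: derive_gt0_increasing.
- by rewrite ge0_cp.
by apply: eq_integral => x _; rewrite (derive1_is_derive dF).
Qed.

Let DFx x : D (F x). Proof. by rewrite DF; exists x. Qed.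

Lemma subst_Rint G : (forall y, D y -> {for y, continuous G}) ->
  (\int[mu]_(y in D) G y)%R = RInt (fun x => G (F x) * f x).
Proof. by move=> cG; apply: change_of_variable_Rint => //; exact: subst_ge0. Qed.

Lemma subst_itg G : (forall y, D y -> {for y, continuous G}) ->
  mu.-integrable D (EFin \o G) <-> itg (fun x => G (F x) * f x).
Proof.
move=> cG; apply: change_of_variable_itg => //.
  exact: continuous_range_measurable.
exact: subst_ge0.
Qed.

End Range.

Lemma scale_shift_range b c : 0 < b -> [set: R] = range (fun x : R => b * x + c).
Proof.
move=> b0; apply/seteqP; split=> // y _; exists ((y - c) / b) => //.
by rewrite mulrC divfK ?gt_eqF// subrK.
Qed.

Lemma scale_shift_itg b c G : 0 < b -> continuous G ->
  itg G <-> itg (fun x => b * G (b * x + c)).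
Proof.
move=> b0 cG.
rewrite (_ : (fun x => _) = fun x => G (b * x + c) * b); last first.
  by apply/funext => x; rewrite mulrC.
have dF x : is_derive x 1 (fun x => b * x + c) b.
  by derc; rewrite mul0r add0r mulr1 addr0.
have cb : continuous (fun _ : R => b) by move=> x; exact: cst_continuous.
exact: (subst_itg dF cb (fun=> b0) (scale_shift_range c b0) (fun y _ => cG y)).
Qed.

Lemma scale_shift_int b c G : 0 < b -> continuous G ->
  RInt G = RInt (fun x => b * G (b * x + c)).
Proof.
move=> b0 cG.
rewrite (_ : (fun x => _) = fun x => G (b * x + c) * b); last first.
  by apply/funext => x; rewrite mulrC.
have dF x : is_derive x 1 (fun x => b * x + c) b.
  by derc; rewrite mul0r add0r mulr1 addr0.
have cb : continuous (fun _ : R => b) by move=> x; exact: cst_continuous.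
exact: (subst_Rint dF cb (fun=> b0) (scale_shift_range c b0) (fun y _ => cG y)).
Qed.

Lemma shift_itg c G : continuous G -> itg G -> itg (fun x => G (x + c)).
Proof.
move=> cG /(scale_shift_itg c ltr01 cG).
by rewrite (_ : (fun x => 1 * _) = fun x => G (x + c))//; apply/funext => x; rewrite !mul1r.
Qed.

Lemma shift_int c G : continuous G -> RInt (fun x => G (x + c)) = RInt G.
Proof.
move=> cG; rewrite [RHS](scale_shift_int c ltr01 cG).
by congr RInt; apply/funext => x; rewrite !mul1r.
Qed.

(** The reflection is decreasing, hence not an instance of the preceding rule; the exhaustion
    argument is repeated with symmetric segments. *)
Lemma opp_ge0 G : (forall y, setT y -> 0 <= G y) ->
  (forall y, setT y -> {for y, continuous G}) ->
  (\int[mu]_y (G y)%:E = \int[mu]_x (G (- x) * 1)%:E)%E.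
Proof.
move=> G0 cG'; have cG : continuous G by move=> x; exact: cG'.
pose B (n : nat) : set R := `[- n%:R, n%:R]%classic.
have UB : setT = \bigcup_n B n.
  apply/seteqP; split=> // x _; have [n _ /(_ n (leqnn n)) nx] := near_natr_ge `|x|.
  by exists n => //; rewrite /B /= in_itv/= -ler_norml.
have cv (H : R -> R) : continuous H -> (forall x, 0 <= H x) ->
    (\int[mu]_(y in B n) (H y)%:E)%E @[n --> \oo] --> (\int[mu]_x (H x)%:E)%E.
  move=> cH H0; rewrite UB; apply: ge0_nondecreasing_set_cvg_integral => //.
  - apply/nondecreasing_seqP => n; rewrite subsetEset => y; rewrite /B/= !in_itv/=.
    move=> /andP[yl yr]; rewrite (le_trans _ yl) ?(le_trans yr)//.
      by rewrite ler_nat.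
    by rewrite lerN2 ler_nat.
  - by move=> n; exact: measurable_itv.
  - move=> n; apply/measurable_EFinP; apply: measurable_funTS.
    exact: continuous_measurable_fun.
  - by move=> n y _; rewrite lee_fin.
have cGN : continuous (fun x => G (- x) * 1).
  move=> x; apply: (@continuousM R R); last exact: cst_continuous.
  by apply: continuous_comp; [exact: (@oppr_continuous R R)|exact: cG].
have c1 := cv _ cG (fun y => G0 y I).
have c2 := cv _ cGN (fun y => mulr_ge0 (G0 (- y) I) ler01).
suff e n : (\int[mu]_(y in B n) (G y)%:E = \int[mu]_(y in B n) (G (- y) * 1)%:E)%E.
  by rewrite (eq_cvg _ _ e) in c1; apply: (cvg_unique _ c1 c2).
rewrite /B -{1}[n%:R in X in BRight X]opprK integration_by_substitution_oppr.
- by apply: eq_integral => x _; rewrite mulr1.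
- by rewrite ge0_cp.
- exact: continuous_subspaceT.
Qed.

Lemma opp_int G : continuous G -> RInt (fun x => G (- x)) = RInt G.
Proof.
move=> cG; have -> : (fun x => G (- x)) = (fun x => G (- x) * 1).
  by apply/funext => x; rewrite mulr1.
exact/esym/(change_of_variable_Rint (fun=> ltr01) opp_ge0 (fun y _ => cG y)).
Qed.

Lemma opp_itg G : continuous G -> itg G -> itg (fun x => G (- x)).
Proof.
move=> cG; have -> : (fun x => G (- x)) = (fun x => G (- x) * 1).
  by apply/funext => x; rewrite mulr1.
have cN : continuous (-%R : R -> R) by exact: oppr_continuous.
have c1 : continuous (fun _ : R => 1 : R) by move=> x; exact: cst_continuous.
have mT (H : R -> R) : (forall y, setT y -> {for y, continuous H}) -> measurable_fun setT H.
  by move=> cH; apply: continuous_measurable_fun => x; exact: cH.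
exact: (proj1 (change_of_variable_itg cN c1 (fun=> ltr01) (fun=> Logic.I) mT opp_ge0 (fun y _ => cG y))).
Qed.

Lemma int_odd G : continuous G -> (forall x, G (- x) = - G x) -> itg G -> RInt G = 0.
Proof.
move=> cG oG iG; have := opp_int cG; rewrite (_ : (fun x => _) = fun x => - G x).
  by rewrite intN// => /eqP; rewrite eq_sym -addr_eq0 -mulr2n mulrn_eq0/= => /eqP.
by apply/funext => x; rewrite oG.
Qed.

Lemma fubini (f : R -> R -> R) :
  measurable_fun setT (fun z : R * R => f z.1 z.2) ->
  (forall x, itg (f x)) -> (forall y, itg (fun x => f x y)) ->
  itg (fun x => RInt (fun y => `|f x y|)) ->
  [/\ itg (fun x => RInt (f x)), itg (fun y => RInt (fun x => f x y)) &
  RInt (fun x => RInt (f x)) = RInt (fun y => RInt (fun x => f x y))].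
Proof.
move=> mf fx fy fn.
pose g := fun z : R * R => (f z.1 z.2)%:E.
have mg : measurable_fun setT g by apply/measurable_EFinP.
have gi : (mu \x mu)%E.-integrable setT g.
  apply: (proj2 (@integrable12ltyP _ _ _ _ R mu mu g mg)); rewrite /g /=.
  rewrite (_ : (\int[mu]_x _)%E = (\int[mu]_x (RInt (fun y => `|f x y|))%:E)%E); last first.
    apply: eq_integral => x _; rewrite /RInt /Rintegral fineK//.
    by apply: integrable_fin_num => //; exact: itg_norm (fx x).
  by rewrite ltey_eq integrable_fin_num.
have e1 x : (\int[mu]_y g (x, y))%E = (RInt (f x))%:E.
  by rewrite /RInt /Rintegral fineK//; apply: integrable_fin_num => //; exact: fx.
have e2 y : (\int[mu]_x g (x, y))%E = (RInt (f^~ y))%:E.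
  by rewrite /RInt /Rintegral fineK//; apply: integrable_fin_num => //; exact: fy.
split.
- have := integrable_fubini_F gi; apply: eq_integrable => // x _.
  exact: e1.
- have mg' : measurable_fun setT (g \o (fun z : R * R => (z.2, z.1))).
    by apply: measurableT_comp => //; exact: measurable_swap.
  have gi' : (mu \x mu)%E.-integrable setT (g \o (fun z : R * R => (z.2, z.1))).
    apply: (proj2 (@integrable12ltyP _ _ _ _ R mu mu _ mg')) => /=.
    exact: (proj1 (@integrable21ltyP _ _ _ _ R mu mu _ mg)).
  have := integrable_fubini_F gi'; apply: eq_integrable => // x _.
  exact: e2.
- have a1 : (\int[mu]_x \int[mu]_y g (x, y) = \int[mu]_x (RInt (f x))%:E)%E.
    by apply: eq_integral => x _; exact: e1.
  have a2 : (\int[mu]_y \int[mu]_x g (x, y) = \int[mu]_y (RInt (f^~ y))%:E)%E.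
    by apply: eq_integral => y _; exact: e2.
  exact: (congr1 fine (etrans (esym a1) (etrans (Fubini gi) a2))).
Qed.

Lemma fubini_product (f : R -> R -> R) g h :
  measurable_fun setT (fun z : R * R => f z.1 z.2) ->
  (forall x, measurable_fun setT (f x)) -> (forall y, measurable_fun setT (f^~ y)) ->
  (forall x y, `|f x y| <= g x * h y) -> itg g -> itg h ->
  [/\ itg (fun x => RInt (f x)), itg (fun y => RInt (fun x => f x y)) &
  RInt (fun x => RInt (f x)) = RInt (fun y => RInt (fun x => f x y))].
Proof.
move=> mf mfx mfy fgh ig ih.
have fx x : itg (f x) by apply: itg_le (itgZ (g x) ih) => //; exact: mfx.
have fy y : itg (f^~ y).
  by apply: itg_le (itgZ (h y) ig) => // x; rewrite mulrC.
apply: fubini => //.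
have mn : measurable_fun setT (fun z : R * R => `|f z.1 z.2|).
  exact: measurableT_comp.
apply: (@itg_le _ _ (fun x => RInt h * g x)).
- have := @measurable_fun_fubini_tonelli_F _ _ _ _ R mu (fun z => (`|f z.1 z.2|)%:E).
  rewrite /fubini_F /= => H.
  rewrite /RInt /Rintegral; apply: measurableT_comp => //.
  by apply: H; [apply/measurable_EFinP|move=> z; rewrite lee_fin].
- move=> x; rewrite ger0_norm ?int_ge0// mulrC -intZ//.
  by apply: int_le => [||y]; [exact: itg_norm|exact: itgZ|exact: fgh].
- exact: itgZ.
Qed.

End Substitution.

(** * The Gamma function on vertical lines *)

Section GammaIntegrals.
Context {R : realType}.
Implicit Types (f g F : R -> R) (x y a b c d l u : R).

Local Notation mu := (@lebesgue_measure R).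

(** Monotone convergence: the integral over [[-n, n]] is a difference of two values of [F], at most
    [2 M]. *)
Lemma itg_bounded_primitive F f M : (forall x, is_derive x 1 F (f x)) ->
  continuous f -> (forall x, 0 <= f x) -> (forall x, `|F x| <= M) -> itg f.
Proof.
move=> dF cf f0 FM.
pose A (n : nat) : set R := `[- n%:R, n%:R]%classic.
have UA : setT = \bigcup_n A n.
  apply/seteqP; split=> // x _; have [n _ /(_ n (leqnn n)) nx] := near_natr_ge `|x|.
  by exists n => //; rewrite /A /= in_itv/= -ler_norml.
have mf : measurable_fun setT f by exact: continuous_measurable_fun.
have cv : (\int[mu]_(y in A n) (f y)%:E)%E @[n --> \oo] --> (\int[mu]_x (f x)%:E)%E.
  rewrite UA; apply: ge0_nondecreasing_set_cvg_integral => //.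
  - apply/nondecreasing_seqP => n; rewrite subsetEset => y; rewrite /A/= !in_itv/=.
    move=> /andP[yl yr]; rewrite (le_trans _ yl) ?(le_trans yr)//.
      by rewrite ler_nat.
    by rewrite lerN2 ler_nat.
  - by move=> n; exact: measurable_itv.
  - by move=> n; apply/measurable_EFinP; exact: measurable_funTS.
  - by move=> n y _; rewrite lee_fin.
have bd n : (\int[mu]_(y in A n) (f y)%:E <= (2 * M)%:E)%E.
  case: n => [|n].
    rewrite /A oppr0 set_itv1 integral_set1 lee_fin.
    by have := FM 0; have := normr_ge0 (F 0); lra.
  have n0 : 0 < n.+1%:R :> R by rewrite ltr0n.
  rewrite /A (@continuous_FTC2 R f F)//.
  - rewrite -EFinB lee_fin; have := FM n.+1%:R; have := FM (- n.+1%:R).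
    by rewrite !ler_norml => /andP[? ?] /andP[? ?]; lra.
  - lra.
  - exact: continuous_subspaceT.
  - have cF x : {for x, continuous F} by exact: is_derive_continuous (dF x).
    split; first by move=> x _; have [] := dF x.
      by apply: cvg_at_right_filter; exact: cF.
    by apply: cvg_at_left_filter; exact: cF.
  - by move=> x _; rewrite (derive1_is_derive dF).
apply/integrableP; split; first exact/measurable_EFinP.
rewrite (_ : (fun x => `|_|)%E = (fun x => (f x)%:E)); last first.
  by apply/funext => x /=; rewrite ger0_norm.
apply: (@le_lt_trans _ _ (2 * M)%:E); last exact: ltry.
by apply: (cvge_le _ cv); exact: nearW.
Qed.

(** The right side minus [l u] is convex in [u] and vanishes with its derivative at
    [u = ln (l / c)]: the line is the tangent of slope [l]. *)
Lemma expR_ge_linear c l u : 0 < c -> 0 < l ->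
  l * u <= c * expR u + l * (ln (l / c) - 1).
Proof.
move=> c0 l0; have lc0 : 0 < l / c by rewrite divr_gt0.
have := expR_ge1Dx (u - ln (l / c)); rewrite expRB lnK ?posrE// => h.
have : l * (1 + (u - ln (l / c))) <= l * (expR u / (l / c)) by rewrite ler_pM2l.
by rewrite (_ : l * (_ / _) = c * expR u); [lra|field; rewrite ?gt_eqF].
Qed.

(** Euler's integrand after [t = e^u]: the form [t^(l - 1) e^(-t) dt] becomes [gkernel l u du].
    Shifting [l] is then multiplication by an exponential. *)
Definition gkernel l u : R := expR (l * u - expR u).

Lemma gkernel_continuous l : continuous (gkernel l).
Proof. by rewrite /gkernel; contd. Qed.

Lemma gkernel_gt0 l u : 0 < gkernel l u. Proof. exact: expR_gt0. Qed.

Lemma gkernelD l c u : gkernel (l + c) u = expR (c * u) * gkernel l u.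
Proof. by rewrite /gkernel -expRD; congr expR; ring. Qed.

(** The density of a logistic law: a majorant with exponential decay on both sides and an explicit
    bounded primitive. *)
Lemma logistic_itg l : 0 < l ->
  itg (fun u => expR (l * u) / (1 + expR (l * u)) ^+ 2 * l).
Proof.
move=> l0.
pose F u := - (1 + expR (l * u))^-1.
have p0 u : 0 < 1 + expR (l * u) by rewrite addr_gt0// expR_gt0.
apply: (@itg_bounded_primitive F _ 1).
- move=> u; rewrite /F; derc; first by rewrite gt_eqF.
  by field; rewrite gt_eqF.
- by contd; rewrite expf_neq0// gt_eqF.
- by move=> u; rewrite mulr_ge0 ?(ltW l0)// divr_ge0 ?sqr_ge0 ?expR_ge0.
- move=> u; rewrite normrN gtr0_norm ?invr_gt0// invf_le1//.
  by rewrite lerDl expR_ge0.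
Qed.

Lemma gkernel_itg l : 0 < l -> itg (gkernel l).
Proof.
move=> l0.
pose f u := expR (l * u) / (1 + expR (l * u)) ^+ 2 * l.
have p0 u : 0 < 1 + expR (l * u) by rewrite addr_gt0// expR_gt0.
have if_ : itg f by exact: logistic_itg.
(* The tangent bound is used with coefficient [1/4], so that its square costs [e^(e^u / 2)] up to a
   constant, which [e^(e^u)] absorbs. *)
pose c0 := l * (ln (l / 4^-1) - 1).
pose K := (1 + expR c0) ^+ 2 / l.
apply: itg_le (itgZ K if_); first by apply: continuous_measurable_fun; exact: gkernel_continuous.
move=> u; rewrite gtr0_norm ?gkernel_gt0// /gkernel expRB.
have h1 : expR (l * u) <= expR (4^-1 * expR u) * expR c0.
  by rewrite -expRD ler_expR; apply: expR_ge_linear => //; lra.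
have h2 : 1 + expR (l * u) <= (1 + expR c0) * expR (4^-1 * expR u).
  rewrite mulrDl mul1r lerD//; last by rewrite [leRHS]mulrC.
  by rewrite -expR0 ler_expR mulr_ge0 ?expR_ge0.
have h3 : (1 + expR (l * u)) ^+ 2 <= (1 + expR c0) ^+ 2 * expR (expR u).
  apply: (@le_trans _ _ (((1 + expR c0) * expR (4^-1 * expR u)) ^+ 2)).
    by rewrite lerXn2r ?nnegrE// ltW// mulr_gt0 ?expR_gt0// addr_gt0 ?expR_gt0.
  rewrite exprMn ler_wpM2l ?sqr_ge0// -expRM_natl ler_expR.
  by have := expR_ge0 u; lra.
rewrite /K /f.
have -> : (1 + expR c0) ^+ 2 / l * (expR (l * u) / (1 + expR (l * u)) ^+ 2 * l) =
   expR (l * u) * ((1 + expR c0) ^+ 2 / (1 + expR (l * u)) ^+ 2).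
  by field; rewrite ?gt_eqF.
rewrite ler_wpM2l ?expR_ge0// ler_pdivlMr ?exprn_gt0// mulrC.
by rewrite ler_pdivrMr ?expR_gt0.
Qed.

(** Real part, with [gsin] as imaginary part, of the integral of
    [t^(l + i y - 1) e^(- (1 - i b) t)], [t = e^u]. At [b = 0] this is Gamma at [l + i y]; the
    weight at [t] needs [y = a t], [b = t]. *)
Definition gcos l y b : R := RInt (fun u => gkernel l u * cos (y * u + b * expR u)).
Definition gsin l y b : R := RInt (fun u => gkernel l u * sin (y * u + b * expR u)).

Lemma gcos_continuous l y b :
  continuous (fun u => gkernel l u * cos (y * u + b * expR u)).
Proof. by rewrite /gkernel; contd. Qed.

Lemma gsin_continuous l y b :
  continuous (fun u => gkernel l u * sin (y * u + b * expR u)).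
Proof. by rewrite /gkernel; contd. Qed.

Lemma gcos_itg l y b : 0 < l -> itg (fun u => gkernel l u * cos (y * u + b * expR u)).
Proof.
move=> l0; apply: itg_le (gkernel_itg l0).
  by apply: continuous_measurable_fun; exact: gcos_continuous.
move=> u; rewrite normrM (gtr0_norm (gkernel_gt0 l u)) ler_piMr ?(ltW (gkernel_gt0 l u))//.
by rewrite ler_norml cos_geN1 cos_le1.
Qed.

Lemma gsin_itg l y b : 0 < l -> itg (fun u => gkernel l u * sin (y * u + b * expR u)).
Proof.
move=> l0; apply: itg_le (gkernel_itg l0).
  by apply: continuous_measurable_fun; exact: gsin_continuous.
move=> u; rewrite normrM (gtr0_norm (gkernel_gt0 l u)) ler_piMr ?(ltW (gkernel_gt0 l u))//.
by rewrite ler_norml sin_geN1 sin_le1.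
Qed.

Lemma gkernel_cvg l : 0 < l ->
  (gkernel l n%:R @[n --> \oo] --> (0 : R)) * (gkernel l (- n%:R) @[n --> \oo] --> (0 : R)).
Proof.
move=> l0.
have e1 : expR (- (l * n%:R)) @[n --> \oo] --> (0 : R).
  have q0 : `|expR (- l)| < 1 by rewrite gtr0_norm ?expR_gt0// -expR0 ltr_expR; lra.
  have := cvg_expr q0; apply: cvg_trans; apply: near_eq_cvg; apply: nearW => n.
  by rewrite -expRM_natl; congr expR; ring.
have e2 c : expR c * expR (- (l * n%:R)) @[n --> \oo] --> (0 : R).
  by rewrite -[X in _ --> X](mulr0 (expR c)); apply: cvgMr.
split; [apply: squeeze_cvgr (e2 ((2 * l) * (ln ((2 * l) / 1) - 1))); last exact: cvg_cst|apply: squeeze_cvgr (e2 0); last exact: cvg_cst].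
- apply: nearW => n; rewrite ltW ?gkernel_gt0//= /gkernel -expRD ler_expR.
  by have := @expR_ge_linear 1 (2 * l) n%:R ltr01 (mulr_gt0 (ltr0Sn _ _) l0); lra.
- apply: nearW => n; rewrite ltW ?gkernel_gt0//= /gkernel -expRD ler_expR.
  by have := expR_ge0 (- n%:R : R); lra.
Qed.

Lemma int_derive_param (f f' : R -> R -> R) g a :
  (forall x, itg (f x)) -> (forall x y, is_derive x 1 (f^~ y) (f' x y)) ->
  (forall x y, `|f' x y| <= g y) -> itg g ->
  is_derive a 1 (fun x => RInt (f x)) (RInt (f' a)).
Proof.
move=> fi df fg gi.
have g0 y : 0 <= g y by exact: le_trans (fg a y).
have ai : `]a - 1, a + 1[%classic a by rewrite /= in_itv/=; apply/andP; split; lra.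
have e x y : partial1of2 f x y = f' x y.
  by rewrite partial1of2E; apply: (@derive_val _ _ _ _ _ _ _ (df x y)).
have d1 x y : `]a - 1, a + 1[%classic x -> setT y -> derivable (f^~ y) x 1.
  by move=> _ _; have [] := df x y.
have d2 x y : `]a - 1, a + 1[%classic x -> setT y -> `|partial1of2 f x y| <= g y.
  by move=> _ _; rewrite e.
have fi' x : `]a - 1, a + 1[%classic x -> mu.-integrable setT (EFin \o f x) by move=> _; exact: fi.
split; first exact: (derivable_under_integral measurableT ai fi' d1 g0 gi d2).
rewrite -derive1E.
rewrite (differentiation_under_integral measurableT ai fi' d1 g0 gi d2).
by apply: eq_Rintegral => y _; rewrite e.
Qed.

Section Parts.
Variables (l y : R).
Hypothesis l0 : 0 < l.

Let l10 : 0 < l + 1. Proof. exact: addr_gt0. Qed.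

Lemma gkernelS u : gkernel (l + 1) u = expR u * gkernel l u.
Proof. by rewrite gkernelD mul1r. Qed.

Let cvg_bounded (h : R -> R) (v : nat -> R) : (forall u, `|h u| <= 1) ->
  gkernel l (v n) @[n --> \oo] --> (0 : R) ->
  gkernel l (v n) * h (v n) @[n --> \oo] --> (0 : R).
Proof.
move=> h1 kv; apply: norm_cvg0; apply: squeeze_cvgr kv; last exact: cvg_cst.
apply: nearW => n; rewrite normr_ge0/= normrM (gtr0_norm (gkernel_gt0 _ _)).
by rewrite ler_piMr// ltW// gkernel_gt0.
Qed.

Let cos_le1 (u : R) : `|cos u| <= 1. Proof. by rewrite ler_norml cos_geN1 cos_le1. Qed.
Let sin_le1 (u : R) : `|sin u| <= 1. Proof. by rewrite ler_norml sin_geN1 sin_le1. Qed.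

(** The derivative of the integrand of [gcos l y b] has integral 0. Together with [gsin_parts] this
    is the real form of [(l + i y) I(l) = (1 - i b) I(l + 1)], where [I = gcos + i gsin]; at [b = 0]
    it is the functional equation of Gamma. *)
Lemma gcos_parts b :
  l * gcos l y b - y * gsin l y b - gcos (l + 1) y b - b * gsin (l + 1) y b = 0.
Proof.
have iC := gcos_itg y b l0; have iS := gsin_itg y b l0.
have iC1 := gcos_itg y b l10; have iS1 := gsin_itg y b l10.
rewrite /gcos /gsin -!intZ// -intB; [|exact: itgZ|exact: itgZ].
rewrite -intB//; last by apply: itgB; exact: itgZ.
rewrite -intB; [|by apply: itgB => //; apply: itgB; exact: itgZ|exact: itgZ].
rewrite -[RHS](subrr 0).
apply: (@int_derive _ (fun u => gkernel l u * cos (y * u + b * expR u))).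
- by move=> u; rewrite gkernelS /gkernel; derc; ring.
- move=> u; rewrite /gkernel; move: u; contd.
- by apply: itgB; [apply: itgB; [apply: itgB|]|]; try exact: itgZ.
- exact: (@cvg_bounded (fun u => cos (y * u + b * expR u))) (gkernel_cvg l0).1.
- exact: (@cvg_bounded (fun u => cos (y * u + b * expR u))) (gkernel_cvg l0).2.
Qed.

Lemma gsin_parts b :
  l * gsin l y b + y * gcos l y b - gsin (l + 1) y b + b * gcos (l + 1) y b = 0.
Proof.
have iC := gcos_itg y b l0; have iS := gsin_itg y b l0.
have iC1 := gcos_itg y b l10; have iS1 := gsin_itg y b l10.
rewrite /gcos /gsin -!intZ// -intD; [|exact: itgZ|exact: itgZ].
rewrite -intB//; last by apply: itgD; exact: itgZ.
rewrite -intD; [|by apply: itgB => //; apply: itgD; exact: itgZ|exact: itgZ].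
rewrite -[RHS](subrr 0).
apply: (@int_derive _ (fun u => gkernel l u * sin (y * u + b * expR u))).
- by move=> u; rewrite gkernelS /gkernel; derc; ring.
- move=> u; rewrite /gkernel; move: u; contd.
- by apply: itgD; [apply: itgB; [apply: itgD|]|]; try exact: itgZ.
- exact: (@cvg_bounded (fun u => sin (y * u + b * expR u))) (gkernel_cvg l0).1.
- exact: (@cvg_bounded (fun u => sin (y * u + b * expR u))) (gkernel_cvg l0).2.
Qed.

Lemma gcos_derive b : is_derive b 1 (gcos l y) (- gsin (l + 1) y b).
Proof.
have iS1 := gsin_itg y b l10.
rewrite /gsin -intN//.
apply: (@int_derive_param (fun b u => gkernel l u * cos (y * u + b * expR u))
  (fun b u => - (gkernel (l + 1) u * sin (y * u + b * expR u))) (gkernel (l + 1))).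
- by move=> x; exact: gcos_itg.
- by move=> x u; derc; rewrite gkernelS; ring.
- move=> x u; rewrite normrN normrM (gtr0_norm (gkernel_gt0 _ _)).
  by rewrite ler_piMr// ltW// gkernel_gt0.
- exact: gkernel_itg.
Qed.

Lemma gsin_derive b : is_derive b 1 (gsin l y) (gcos (l + 1) y b).
Proof.
apply: (@int_derive_param (fun b u => gkernel l u * sin (y * u + b * expR u))
  (fun b u => gkernel (l + 1) u * cos (y * u + b * expR u)) (gkernel (l + 1))).
- by move=> x; exact: gsin_itg.
- by move=> x u; derc; rewrite gkernelS; ring.
- move=> x u; rewrite normrM (gtr0_norm (gkernel_gt0 _ _)).
  by rewrite ler_piMr// ltW// gkernel_gt0.
- exact: gkernel_itg.
Qed.

Definition gnorm2 b : R := gcos l y b ^+ 2 + gsin l y b ^+ 2.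

(* Gamma(l + iy) (1 - ib)^(-l-iy) is the integral with phase y u + b e^u; its modulus is found from the logarithmic derivative in b. *)
Lemma gnorm2E b :
  gnorm2 b = gnorm2 0 * (1 + b ^+ 2) `^ (- l) * expR (- (2 * y * atan b)).
Proof.
pose M b := gnorm2 b * (1 + b ^+ 2) `^ l * expR (2 * y * atan b).
have p0 x : 0 < 1 + x ^+ 2 :> R by rewrite ltr_pwDl// sqr_ge0.
have dM x : is_derive x 1 M 0.
  have dC := gcos_derive x; have dS := gsin_derive x.
  have eC := gcos_parts x; have eS := gsin_parts x.
  rewrite /M /gnorm2; eapply is_derive_eq.
    by der; [exact: dC|exact: dS|exact: p0].
  cbv beta; have -> : (1 + x ^+ 2) `^ (l - 1) = (1 + x ^+ 2) `^ l / (1 + x ^+ 2).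
    by rewrite powRD ?powR_inv1 ?(ltW (p0 x))// (gt_eqF (p0 x)) implybT.
  set X := gcos l y x in eC eS *; set Y := gsin l y x in eC eS *.
  set X1 := gcos _ y x in eC eS *; set Y1 := gsin _ y x in eC eS *.
  have hX1 : X1 = ((l * X - y * Y) - x * (l * Y + y * X)) / (1 + x ^+ 2).
    apply: (mulIf (lt0r_neq0 (p0 x))); rewrite divfK ?gt_eqF//.
    by have := congr1 ( *%R x) eS; lra.
  have hY1 : Y1 = ((l * Y + y * X) + x * (l * X - y * Y)) / (1 + x ^+ 2).
    apply: (mulIf (lt0r_neq0 (p0 x))); rewrite divfK ?gt_eqF//.
    by have := congr1 ( *%R x) eC; lra.
  rewrite hX1 hY1; field; rewrite gt_eqF//.
have -> : gnorm2 0 = M 0.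
  by rewrite /M atan0 mulr0 expR0 expr0n addr0 powR1 !mulr1.
rewrite -(@is_derive_0_is_cst _ M b 0 dM) /M powRN expRN.
by field; rewrite !gt_eqF ?expR_gt0 ?powR_gt0.
Qed.

End Parts.

End GammaIntegrals.

Ltac itg := repeat first [assumption | apply: itgB | apply: itgD | apply: itgN
  | apply: itgZ | apply: itgZr].

(** * Bounds for Gamma and for its squared modulus *)

Section GammaFunction.
Context {R : realType}.
Implicit Types (f g F : R -> R) (x y a b c d l m u v : R).

Local Notation mu := (@lebesgue_measure R).

Definition gint l : R := RInt (gkernel l).

Lemma gcos00 l : gcos l 0 0 = gint l.
Proof.
by congr RInt; apply/funext => u; rewrite !mul0r addr0 cos0 mulr1.
Qed.

Lemma gintS l : 0 < l -> gint (l + 1) = l * gint l.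
Proof.
move=> l0; have := gcos_parts 0 l0 0; rewrite !gcos00 !mul0r.
by move: (gint _) (gint _) => p q; lra.
Qed.

Lemma gint_gt0 l : 0 < l -> 0 < gint l.
Proof.
move=> l0; apply: (@lt_le_trans _ _ (expR (- expR 1))); first exact: expR_gt0.
have c0 : RInt (fun x => \1_`[0, 1] x * expR (- expR 1)) = expR (- expR 1).
  have := @int_derive_segment R (fun x => expR (- expR 1) * x) (fun=> expR (- expR 1)) 0 1 ltr01.
  rewrite mulr1 mulr0 subr0; apply.
  - by move=> x _; derc; rewrite mul0r add0r mulr1.
  - by move=> x _; exact: cst_continuous.
rewrite -{1}c0; apply: int_le; last 2 first.
- exact: gkernel_itg.
- move=> x; rewrite indicE mem_setE in_itv/=; have [/andP[x0 x1]|_] := boolP (0 <= x <= 1).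
    rewrite mul1r /gkernel ler_expR.
    have : expR x <= expR 1 by rewrite ler_expR.
    by have := mulr_ge0 (ltW l0) x0; lra.
  by rewrite mul0r ltW// gkernel_gt0.
apply: itg_le (itgZ (expR l * expR (expR 1)) (gkernel_itg l0)).
  by apply: measurable_funM => //; exact: measurable_indic.
move=> x; rewrite indicE mem_setE in_itv/= normrM.
rewrite (ger0_norm (expR_ge0 _)); have [/andP[x0 x1]|_] := boolP (0 <= x <= 1); last first.
  by rewrite normr0 mul0r !mulr_ge0 ?expR_ge0.
rewrite normr1 mul1r /gkernel -!expRD ler_expR.
have : expR x <= expR 1 by rewrite ler_expR.
by have := mulr_ge0 (ltW l0) x0; have := @expR_ge0 R 1; lra.
Qed.

Lemma gnorm2S l y : 0 < l -> gnorm2 (l + 1) y 0 = (l ^+ 2 + y ^+ 2) * gnorm2 l y 0.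
Proof.
move=> l0; have := gcos_parts y l0 0; have := gsin_parts y l0 0.
rewrite /gnorm2 !mul0r addr0 !subr0 => e1 e2.
move: (gcos (l + 1) _ _) (gsin (l + 1) _ _) (gcos l _ _) (gsin l _ _) e1 e2.
move=> p q r s e1 e2; have -> : p = l * r - y * s by lra.
have -> : q = l * s + y * r by lra.
ring.
Qed.

Lemma gnorm2_ge0 l y b : 0 <= gnorm2 l y b.
Proof. by rewrite addr_ge0 ?sqr_ge0. Qed.

Lemma gint_prod l N : 0 < l -> gint (l + N%:R) = gint l * \prod_(k < N) (l + k%:R).
Proof.
move=> l0; elim: N => [|N IH]; first by rewrite big_ord0 addr0 mulr1.
by rewrite -natr1 addrA gintS ?ltr_wpDr// IH big_ord_recr/=; ring.
Qed.

Lemma gnorm2_prod l y N : 0 < l ->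
  gnorm2 (l + N%:R) y 0 = gnorm2 l y 0 * \prod_(k < N) ((l + k%:R) ^+ 2 + y ^+ 2).
Proof.
move=> l0; elim: N => [|N IH]; first by rewrite big_ord0 addr0 mulr1.
by rewrite -natr1 addrA gnorm2S ?ltr_wpDr// IH big_ord_recr/=; ring.
Qed.

Lemma linear_combination_le x y c s : x * c + y * s <= 
  Num.sqrt (x ^+ 2 + y ^+ 2) * Num.sqrt (c ^+ 2 + s ^+ 2).
Proof.
rewrite -sqrtrM ?addr_ge0 ?sqr_ge0//; apply: le_trans (ler_norm _) _.
by rewrite -sqrtr_sqr ler_wsqrtr//; have := sqr_ge0 (x * s - y * c); nra.
Qed.

(** Triangle inequality for a plane-valued integral: it is paired with the fixed vector
    [(gcos, gsin)], and the pairing is estimated pointwise by Cauchy-Schwarz. *)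
Lemma gnorm2_le l y : 0 < l -> gnorm2 l y 0 <= gint l ^+ 2.
Proof.
move=> l0; have iC := gcos_itg y 0 l0; have iS := gsin_itg y 0 l0.
have i0 := gkernel_itg l0.
pose s := Num.sqrt (gnorm2 l y 0).
have s2 : s ^+ 2 = gnorm2 l y 0 by rewrite sqr_sqrtr// gnorm2_ge0.
have s0 : 0 <= s by exact: sqrtr_ge0.
have gen X Y : X * gcos l y 0 + Y * gsin l y 0 <= Num.sqrt (X ^+ 2 + Y ^+ 2) * gint l.
  rewrite -!intZ// -intD; [|exact: itgZ|exact: itgZ].
  apply: int_le; [by itg|by itg|] => u.
  have := linear_combination_le X Y (cos (y * u + 0 * expR u)) (sin (y * u + 0 * expR u)).
  rewrite cos2Dsin2 sqrtr1 mulr1 => h.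
  have := ler_wpM2r (ltW (gkernel_gt0 l u)) h.
  by move: (gkernel l u) (cos _) (sin _) (Num.sqrt _) => k p q r; lra.
have h : gnorm2 l y 0 <= s * gint l.
  by have := gen (gcos l y 0) (gsin l y 0); rewrite -!expr2.
rewrite -s2 lerXn2r ?nnegrE ?(ltW (gint_gt0 l0))//.
have [->|sn0] := eqVneq s 0; first exact/ltW/gint_gt0.
by move: h; rewrite -s2 expr2 ler_pM2l// lt_neqAle eq_sym sn0.
Qed.

Lemma normr_sin_le x : `|sin x| <= `|x|.
Proof.
wlog x0 : x / 0 < x => [hw|].
  have [x0|x0|->] := ltgtP x 0; last by rewrite sin0.
    by rewrite -(normrN x) -(normrN (sin x)) -sinN hw// oppr_gt0.
  exact: hw.
have cs : {within `[0, x], continuous (@sin R)}.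
  by apply: continuous_subspaceT; exact: continuous_sin.
have [c _ ] := @MVT R sin cos 0 x x0 (fun z _ => is_derive_sin z) cs.
rewrite sin0 !subr0 => ->; rewrite normrM ler_piMl// ler_norml.
by rewrite cos_geN1 cos_le1.
Qed.

Lemma cos_ge x : 1 - x ^+ 2 <= cos x.
Proof.
have -> : cos x = 1 - 2 * sin (x / 2) ^+ 2.
  by rewrite {1}(splitr x) -mulr2n cos_mulr2n cos2sin2; ring.
have : `|sin (x / 2)| ^+ 2 <= `|x / 2| ^+ 2 by rewrite lerXn2r ?nnegrE// normr_sin_le.
by rewrite !real_normK ?num_real//; nra.
Qed.

(** For [v >= 0] and [t = v / 2] the bracket is [(e^t - e^(-t))^2], and [e^t - e^(-t) >= t] because
    [e^t >= 1 + t] and [e^(-t) <= 1]. *)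
Lemma sqr_le_cosh v : v ^+ 2 <= 4 * (expR v + expR (- v) - 2).
Proof.
wlog v0 : v / 0 <= v => [hw|].
  have [v0|/ltW v0] := leP 0 v; first exact: hw.
  by have := hw (- v); rewrite opprK sqrrN oppr_ge0 (addrC (expR (- v))); exact.
pose t := v / 2; have t0 : 0 <= t by rewrite divr_ge0.
have e1 : expR v = expR t ^+ 2 by rewrite -expRM_natl; congr expR; rewrite /t; field.
have e2 : expR (- v) = expR (- t) ^+ 2 by rewrite -expRM_natl; congr expR; rewrite /t; field.
have e3 : expR t * expR (- t) = 1 by rewrite -expRD subrr expR0.
have h1 := expR_ge1Dx t.
have h2 : t <= expR t - expR (- t).
  have : expR (- t) <= 1 / (1 + t).
    rewrite ler_pdivlMr; last by rewrite ltr_pwDl.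
    by have := ler_wpM2l (expR_ge0 (- t)) h1; rewrite (mulrC _ (expR t)) e3.
  have : 1 / (1 + t) <= 1 by rewrite ler_pdivrMr ?ltr_pwDl//; lra.
  lra.
have h3 : t ^+ 2 <= (expR t - expR (- t)) ^+ 2.
  by rewrite lerXn2r ?nnegrE//; exact: le_trans h2.
rewrite e1 e2; have -> : v = 2 * t by rewrite /t; field.
by move: (expR t) (expR (- t)) e3 h3 => p q e3 h3; nra.
Qed.

(** The modulus is at least the real part after rotation by the phase [y ln c], where [c] should lie
    near the maximum of [t^l e^(-t)]. With [v = u - ln c] one has [cos (y v) >= 1 - 4 y^2 (e^v +
    e^(-v) - 2)], and against the kernel [e^v] and [e^(-v)] integrate to [Gamma(l + 1) / c] and
    [c Gamma(l - 1)]. *)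
Lemma gnorm2_ge l y c : 1 < l -> 0 < c ->
  gint l * (1 - 4 * y ^+ 2 * (l / c + c / (l - 1) - 2)) <= Num.sqrt (gnorm2 l y 0).
Proof.
move=> l1 c0; have l0 : 0 < l by lra.
pose a := y * ln c.
have iC := gcos_itg y 0 l0; have iS := gsin_itg y 0 l0.
apply: (@le_trans _ _ (gcos l y 0 * cos a + gsin l y 0 * sin a)); last first.
  have := linear_combination_le (gcos l y 0) (gsin l y 0) (cos a) (sin a).
  by rewrite cos2Dsin2 sqrtr1 mulr1.
rewrite (mulrC (gcos _ _ _)) (mulrC (gsin _ _ _)) -(intZ (cos a) iC) -(intZ (sin a) iS).
rewrite -intD; [|exact: itgZ|exact: itgZ].
have i0 := gkernel_itg l0.
have i1 : itg (gkernel (l + 1)) by apply: gkernel_itg; lra.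
have im : itg (gkernel (l - 1)) by apply: gkernel_itg; lra.
pose f u := gkernel l u - 4 * y ^+ 2 * (gkernel (l + 1) u / c + c * gkernel (l - 1) u - 2 * gkernel l u).
have if_ : itg f.
  by rewrite /f; itg.
have -> : gint l * (1 - 4 * y ^+ 2 * (l / c + c / (l - 1) - 2)) = RInt f.
  have e0 : gint l = (l - 1) * gint (l - 1) by rewrite -gintS ?subrK//; lra.
  have e1 : gint (l + 1) = l * gint l by rewrite gintS.
  have ec : (fun x => gkernel (l + 1) x / c) = (fun x => c^-1 * gkernel (l + 1) x).
    by apply/funext => u; rewrite mulrC.
  rewrite /f intB// ?intZ// ?intB// ?intD// ?ec ?intZ//; try itg.
  rewrite -/(gint _) -/(gint _) -/(gint _) e1 e0; field; rewrite gt_eqF ?gt_eqF//; lra.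
apply: int_le => //; first by apply: itgD; exact: itgZ.
move=> u; rewrite /f; pose v := u - ln c.
have -> : cos a * (gkernel l u * cos (y * u + 0 * expR u)) +
   sin a * (gkernel l u * sin (y * u + 0 * expR u)) = gkernel l u * cos (y * v).
  by rewrite /v mulrBr cosB -/a mul0r addr0; ring.
have -> : gkernel (l + 1) u / c = gkernel l u * expR v.
  by rewrite gkernelD mul1r /v expRB lnK ?posrE//; ring.
have -> : c * gkernel (l - 1) u = gkernel l u * expR (- v).
  by rewrite gkernelD mulN1r /v opprB expRB lnK ?posrE// expRN; ring.
move: (gkernel l u) (gkernel_gt0 l u) => k k0.
have := cos_ge (y * v); have := sqr_le_cosh v; rewrite exprMn => h1 h2.
have h3 : y ^+ 2 * v ^+ 2 <= y ^+ 2 * (4 * (expR v + expR (- v) - 2)) by rewrite ler_wpM2l ?sqr_ge0.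
have : k * (1 - y ^+ 2 * (4 * (expR v + expR (- v) - 2))) <= k * cos (y * v).
  by rewrite ler_pM2l//; lra.
by move: (expR v) (expR (- v)) (cos _) => p q r; lra.
Qed.

End GammaFunction.

(** * Ratios of Gamma values and Weierstrass' product *)

Section GammaAsymptotics.
Context {R : realType}.
Implicit Types (f g F : R -> R) (x y a b c d l m u v : R).

Local Notation mu := (@lebesgue_measure R).

Lemma cvg_invn c : (n%:R + c)^-1 @[n --> \oo] --> (0 : R).
Proof.
apply/cvgrPdist_lt => e e0; near=> n.
have h : e^-1 + 1 - c <= n%:R by near: n; exact: near_natr_ge.
have e1 : 0 < e^-1 by rewrite invr_gt0.
have h0 : 0 < n%:R + c by lra.
rewrite sub0r normrN gtr0_norm ?invr_gt0// -[e]invrK ltf_pV2 ?posrE//; lra.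
Unshelve. all: by end_near. Qed.

Lemma cvg_ratio c d : (n%:R + c) / (n%:R + d) @[n --> \oo] --> (1 : R).
Proof.
have h : 1 + (c - d) * (n%:R + d)^-1 @[n --> \oo] --> (1 : R).
  rewrite -[X in _ --> X]addr0; apply: cvgD; first exact: cvg_cst.
  by rewrite -[X in _ --> X](mulr0 (c - d)); apply: cvgMr; exact: cvg_invn.
apply: cvg_trans h; apply: near_eq_cvg; near=> n.
have h0 : - d + 1 <= n%:R by near: n; exact: near_natr_ge.
by field; apply/eqP; move: h0; move: n%:R => q; lra.
Unshelve. all: by end_near. Qed.

Section Ratio.
Variables (l a : R).
Hypotheses (l0 : 0 < l) (a0 : 0 <= a).

(** With [v = u - ln c]: [e^(a v) >= 1 + a v >= 1 + a (1 - e^(-v))], and [e^(-v)] integrates against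
    the kernel to [c Gamma(m - 1)]. *)
Lemma gint_shift_ge m c : 1 < m -> 0 < c ->
  gint m * (1 + a - a * (c / (m - 1))) * expR (a * ln c) <= gint (m + a).
Proof.
move=> m1 c0; have m0 : 0 < m by lra.
have i0 := gkernel_itg m0.
have im : itg (gkernel (m - 1)) by apply: gkernel_itg; lra.
have ia : itg (gkernel (m + a)) by apply: gkernel_itg; rewrite ltr_wpDr.
have e0 : gint m = (m - 1) * gint (m - 1) by rewrite -gintS ?subrK//; lra.
have -> : gint m * (1 + a - a * (c / (m - 1))) * expR (a * ln c) =
    RInt (fun u => expR (a * ln c) * ((1 + a) * gkernel m u - (a * c) * gkernel (m - 1) u)).
  rewrite intZ; last by itg.
  rewrite intB ?intZ//; try itg.
  by rewrite -/(gint _) -/(gint _) e0; field; rewrite gt_eqF//; lra.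
apply: int_le => [|//|u]; first by itg.
have -> : gkernel (m - 1) u = expR (- u) * gkernel m u by rewrite gkernelD mulN1r.
have -> : gkernel (m + a) u = expR (a * ln c) * (expR (a * (u - ln c)) * gkernel m u).
  by rewrite gkernelD mulrBr expRB; field; rewrite gt_eqF ?expR_gt0.
rewrite ler_wpM2l ?expR_ge0//.
have h1 := expR_ge1Dx (a * (u - ln c)).
have h2 := expR_ge1Dx (- (u - ln c)).
have h3 : c * expR (- u) = expR (- (u - ln c)) by rewrite opprB expRB lnK ?posrE// expRN.
rewrite -mulrA (mulrA c) h3 mulrA -mulrBl ler_wpM2r ?(ltW (gkernel_gt0 _ _))//.
apply: le_trans h1.
have := ler_wpM2l a0 h2; move: (expR (- (u - ln c))) => p; lra.
Qed.

(** The same estimate read from [m + a] back to [m]: [e^(-a v) >= 1 - a v >= 1 - a (e^v - 1)]. *)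
Lemma gint_shift_le m c : 0 < m -> 0 < c ->
  gint (m + a) * (1 + a - a * ((m + a) / c)) <= expR (a * ln c) * gint m.
Proof.
move=> m0 c0; have ma0 : 0 < m + a by rewrite ltr_wpDr.
have i0 := gkernel_itg m0.
have i1 : itg (gkernel (m + a + 1)) by apply: gkernel_itg; lra.
have ia := gkernel_itg ma0.
have e0 := gintS ma0.
have -> : gint (m + a) * (1 + a - a * ((m + a) / c)) =
    RInt (fun u => ((1 + a) * gkernel (m + a) u - (a / c) * gkernel (m + a + 1) u)).
  rewrite intB ?intZ//; try itg.
  by rewrite -/(gint _) -/(gint _) e0; field; rewrite gt_eqF//; lra.
rewrite -intZ//; apply: int_le => [||u]; [by itg|by itg|].
have -> : gkernel (m + a + 1) u = expR u * gkernel (m + a) u by rewrite gkernelD mul1r.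
have -> : expR (a * ln c) * gkernel m u = expR (- (a * (u - ln c))) * gkernel (m + a) u.
  by rewrite gkernelD mulrA -expRD; congr (expR _ * _); ring.
have h1 := expR_ge1Dx (- (a * (u - ln c))).
have h2 := expR_ge1Dx (u - ln c).
have h3 : c^-1 * expR u = expR (u - ln c) by rewrite expRB lnK ?posrE// mulrC.
rewrite -[a / c * _]mulrA (mulrA c^-1) h3 mulrA -mulrBl ler_wpM2r ?(ltW (gkernel_gt0 _ _))//.
apply: le_trans h1.
have := ler_wpM2l a0 h2; move: (expR (u - ln c)) => p; lra.
Qed.

(** Both shift bounds with [c = n]. Only this ratio is ever needed, not the growth of Gamma
    itself. *)
Lemma gint_ratio_cvg :
  gint (l + n%:R + a) / (gint (l + n%:R) * expR (a * ln n%:R)) @[n --> \oo] --> (1 : R).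
Proof.
have c1 : 1 + a - a * ((n%:R + 0) / (n%:R + (l - 1))) @[n --> \oo] --> (1 : R).
  rewrite -[X in _ --> X](_ : 1 + a - a * 1 = 1); last by ring.
  apply: cvgB; first exact: cvg_cst.
  by apply: cvgMr; exact: cvg_ratio.
have c2 : (1 + a - a * ((n%:R + (l + a)) / (n%:R + 0)))^-1 @[n --> \oo] --> (1 : R).
  rewrite -[X in _ --> X](_ : (1 + a - a * 1)^-1 = 1); last by rewrite mulr1 addrK invr1.
  apply: cvgV; first by rewrite mulr1 addrK oner_eq0.
  apply: cvgB; first exact: cvg_cst.
  by apply: cvgMr; exact: cvg_ratio.
apply: squeeze_cvgr c1 c2.
near=> n.
have n1 : 2 <= n%:R :> R by near: n; exact: near_natr_ge.
have n2 : a * (l + a) + 1 <= n%:R by near: n; exact: near_natr_ge.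
have n0 : 0 < n%:R :> R by lra.
have ln0 : 0 < l + n%:R by rewrite addr_gt0.
have lan0 : 0 < l + n%:R + a by rewrite ltr_wpDr.
have g0 := gint_gt0 ln0; have ga0 := gint_gt0 lan0.
have e0 := expR_gt0 (a * ln n%:R : R).
apply/andP; split.
  rewrite ler_pdivlMr ?mulr_gt0//.
  have l1 : 1 < l + n%:R by have := l0; lra.
  have -> : n%:R + (l - 1) = l + n%:R - 1 by ring.
  by rewrite addr0 mulrA (mulrC _ (gint _)); exact: gint_shift_ge.
have p : 0 < 1 + a - a * ((n%:R + (l + a)) / (n%:R + 0)).
  rewrite addr0 mulrDl divff ?gt_eqF// mulrDr mulr1 mulrA.
  have : a * (l + a) / n%:R < 1 by rewrite ltr_pdivrMr//; lra.
  by move: (_ / _) => q; lra.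
rewrite ler_pdivrMr ?mulr_gt0// ler_pdivlMl//.
have -> : n%:R + (l + a) = l + n%:R + a by ring.
by rewrite addr0 mulrC (mulrC (gint (l + n%:R))); exact: gint_shift_le.
Unshelve. all: by end_near. Qed.

End Ratio.

Lemma gnorm2_ratio_cvg l y : 0 < l ->
  gnorm2 (l + n%:R) y 0 / gint (l + n%:R) ^+ 2 @[n --> \oo] --> (1 : R).
Proof.
move=> l0.
pose e n : R := 1 - 4 * y ^+ 2 * ((n%:R + l) / (n%:R + 0) + (n%:R + 0) / (n%:R + (l - 1)) - 2).
have e1 : e n @[n --> \oo] --> (1 : R).
  rewrite -[X in _ --> X](_ : 1 - 4 * y ^+ 2 * (1 + 1 - 2) = 1); last by ring.
  apply: cvgB; first exact: cvg_cst.
  apply: cvgMr; apply: cvgB; last exact: cvg_cst.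
  by apply: cvgD; exact: cvg_ratio.
have s1 : Num.sqrt (gnorm2 (l + n%:R) y 0) / gint (l + n%:R) @[n --> \oo] --> (1 : R).
  have c1 : (fun _ : nat => 1 : R) n @[n --> \oo] --> (1 : R) by exact: cvg_cst.
  apply: squeeze_cvgr e1 c1; near=> n.
  have n1 : 2 <= n%:R :> R by near: n; exact: near_natr_ge.
  have n0 : 0 < n%:R :> R by lra.
  have ln1 : 1 < l + n%:R by lra.
  have ln0 : 0 < l + n%:R by lra.
  have g0 := gint_gt0 ln0.
  apply/andP; split.
    rewrite ler_pdivlMr// mulrC.
    by have := gnorm2_ge y ln1 n0; rewrite /e addr0 addrA (addrC l).
  rewrite ler_pdivrMr// mul1r -[leRHS](ger0_norm (ltW g0)) -sqrtr_sqr ler_wsqrtr//.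
  exact: gnorm2_le.
pose s n := Num.sqrt (gnorm2 (l + n%:R) y 0) / gint (l + n%:R).
have h : s n * s n @[n --> \oo] --> (1 * 1 : R) by exact: cvgM.
rewrite mulr1 in h; apply: cvg_trans h; apply: near_eq_cvg.
near=> n => /=.
have ln0 : 0 < l + n%:R by rewrite ltr_wpDr.
rewrite /s -[in RHS](sqr_sqrtr (gnorm2_ge0 (l + n%:R) y 0)).
by move: (gt_eqF (gint_gt0 ln0)) => g0; field; rewrite g0.
Unshelve. all: by end_near. Qed.

(** The limit of [|Gamma(l + n + i y)| / Gamma(l + n)] is 1; the recurrences bring both values down
    from [l + n] to [l], at the price of this product. *)
Lemma gnorm2_weierstrass l y : 0 < l ->
  gnorm2 l y 0 / gint l ^+ 2 * \prod_(k < n) (1 + (y / (l + k%:R)) ^+ 2)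
    @[n --> \oo] --> (1 : R).
Proof.
move=> l0; have := gnorm2_ratio_cvg y l0; apply: cvg_trans; apply: near_eq_cvg.
near=> n; rewrite gnorm2_prod// gint_prod//.
have -> : \prod_(k < n) ((l + k%:R) ^+ 2 + y ^+ 2) =
   (\prod_(k < n) (l + k%:R)) ^+ 2 * \prod_(k < n) (1 + (y / (l + k%:R)) ^+ 2).
  rewrite -prodrXl -big_split/=; apply: eq_bigr => k _.
  by field; rewrite gt_eqF// ltr_wpDr.
have p0 : \prod_(k < n) (l + k%:R) != 0.
  by rewrite gt_eqF// prodr_gt0// => k _; rewrite ltr_wpDr.
have := gt_eqF (gint_gt0 l0); move: (gint l) (gnorm2 l y 0) (\prod_(k < n) (l + k%:R)) p0.
by move=> g h p p0 g0; field; rewrite g0 p0.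
Unshelve. all: by end_near. Qed.

(** Gamma has no zero here: otherwise the preceding sequence would be constantly 0 and yet tend to
    1. *)
Lemma gnorm2_gt0 l y : 0 < l -> 0 < gnorm2 l y 0.
Proof.
move=> l0; rewrite lt_neqAle gnorm2_ge0 andbT eq_sym; apply/eqP => h0.
have := gnorm2_weierstrass y l0; rewrite h0.
under eq_fun do rewrite !mul0r.
move=> /(cvg_unique _ (cvg_cst 0)) => h.
by have := h (@norm_hausdorff R R); move/eqP; rewrite eq_sym oner_eq0.
Qed.

Lemma gnorm2_ln_series l y : 0 < l ->
  \sum_(k < n) ln (1 + (y / (l + k%:R)) ^+ 2) @[n --> \oo] -->
    2 * ln (gint l) - ln (gnorm2 l y 0).
Proof.
move=> l0; have g0 := gint_gt0 l0; have n0 := gnorm2_gt0 y l0.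
have h := gnorm2_weierstrass y l0.
have p1 k : 0 < 1 + (y / (l + k%:R)) ^+ 2 by rewrite ltr_pwDl// sqr_ge0.
have hl : ln (gnorm2 l y 0 / gint l ^+ 2 * \prod_(k < n) (1 + (y / (l + k%:R)) ^+ 2))
    @[n --> \oo] --> (0 : R).
  by rewrite -[X in _ --> X]ln1; apply: (continuous_cvg _ (continuous_ln ltr01) h).
set L := _ - ln _.
have h2 : L + ln (gnorm2 l y 0 / gint l ^+ 2 * \prod_(k < n) (1 + (y / (l + k%:R)) ^+ 2))
    @[n --> \oo] --> L + 0 by apply: cvgD => //; exact: cvg_cst.
rewrite addr0 in h2; apply: cvg_trans h2; apply: near_eq_cvg; near=> n => /=.
rewrite lnM ?posrE ?prodr_gt0 ?divr_gt0 ?exprn_gt0//.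
rewrite ln_div ?posrE ?exprn_gt0// lnXn//.
rewrite (_ : ln (\prod_(k < n) _) = \sum_(k < n) ln (1 + (y / (l + k%:R)) ^+ 2)).
  by rewrite /L; ring.
elim: (n) => [|k IH]; first by rewrite !big_ord0 ln1.
by rewrite !big_ord_recr/= lnM ?posrE ?prodr_gt0// IH.
Unshelve. all: by end_near. Qed.

End GammaAsymptotics.

(** * Fourier transform of the Cauchy density *)

Section FourierTransform.
Context {R : realType}.
Implicit Types (f g F : R -> R) (x y a b c d p q t k : R).

Local Notation mu := (@lebesgue_measure R).

Lemma sqrD1_gt0 t : 0 < 1 + t ^+ 2 :> R.
Proof. by rewrite ltr_pwDl// sqr_ge0. Qed.

Lemma sqrD1_neq0 t : 1 + t ^+ 2 != 0 :> R.
Proof. by rewrite gt_eqF// sqrD1_gt0. Qed.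

Definition cauchy t : R := (1 + t ^+ 2)^-1.

Lemma cauchy_gt0 t : 0 < cauchy t.
Proof. by rewrite invr_gt0 sqrD1_gt0. Qed.

Lemma cauchy_le1 t : cauchy t <= 1.
Proof. by rewrite invf_le1 ?sqrD1_gt0// lerDl sqr_ge0. Qed.

Lemma cauchy_continuous : continuous cauchy.
Proof. by rewrite /cauchy; contd; exact: sqrD1_neq0. Qed.

Lemma atan_norm_le t : `|atan t| <= pi / 2.
Proof.
by rewrite ler_norml (ltW (atan_ltpi2 t)) (ltW (atan_gtNpi2 t)).
Qed.

Lemma cauchy_itg : itg cauchy.
Proof.
apply: (@itg_bounded_primitive _ atan _ (pi / 2)).
- exact: cauchy_continuous.
- by move=> x; exact/ltW/cauchy_gt0.
- exact: atan_norm_le.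
Qed.

Lemma cvg_atan_natr : atan n%:R @[n --> \oo] --> (pi / 2 : R).
Proof. exact: (cvg_comp _ _ (@cvgr_idn R) (@cvgy_atan R)). Qed.

Lemma cvg_atan_oppnatr : atan (- n%:R) @[n --> \oo] --> - (pi / 2 : R).
Proof.
by under eq_fun do rewrite atanN; apply: cvgN; exact: cvg_atan_natr.
Qed.

Lemma cauchy_int : RInt cauchy = pi.
Proof.
rewrite (@int_derive _ atan _ (- (pi / 2)) (pi / 2)).
- by field.
- exact: cauchy_continuous.
- exact: cauchy_itg.
- exact: cvg_atan_natr.
- exact: cvg_atan_oppnatr.
Qed.

Lemma itg_cauchy_mul f : continuous f -> (forall t, `|f t| <= 1) ->
  itg (fun t => f t * cauchy t).
Proof.
move=> cf f1; apply: itg_le cauchy_itg.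
  apply: continuous_measurable_fun => t; apply: (@continuousM R R); first exact: cf.
  exact: cauchy_continuous.
move=> t; rewrite normrM (gtr0_norm (cauchy_gt0 t)) ler_piMl//.
exact/ltW/cauchy_gt0.
Qed.

Lemma eq_on_pos f p q : 0 < p -> 0 < q ->
  (forall x, 0 < x -> is_derive x 1 f 0) -> f p = f q.
Proof.
move=> p0 q0 df; wlog pq : p q p0 q0 / p < q => [hw|].
  have [pq|pq|->//] := ltgtP p q; first exact: hw.
  by apply/esym; exact: hw.
have pos x : p <= x -> 0 < x by exact: lt_le_trans.
have dfz z : z \in `]p, q[ -> is_derive z 1 f 0.
  by rewrite in_itv/= => /andP[/ltW pz _]; exact/df/pos.
have cc : {within `[p, q], continuous f}.
  apply: continuous_in_subspaceT => x; rewrite inE/= in_itv/= => /andP[px _].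
  by apply: is_derive_continuous (df x _); exact: pos.
have [c _] := MVT pq dfz cc.
by rewrite mul0r => /eqP; rewrite subr_eq0 => /eqP.
Qed.

(** [J] cannot be differentiated under the integral sign, [t / (1 + t^2)] not being integrable. The
    transforms [J2] and [S], with the squared density, can: [J2' = - S] and [S' = J - J2], and an
    integration by parts closes the system with [p J = 2 S]. *)
Let J p : R := RInt (fun t => cos (p * t) * cauchy t).
Let J2 p : R := RInt (fun t => cos (p * t) * cauchy t ^+ 2).
Let S p : R := RInt (fun t => t * sin (p * t) * cauchy t ^+ 2).

Let cos1 t : `|cos t| <= 1 :> R. Proof. by rewrite ler_norml cos_geN1 cos_le1. Qed.
Let sin1 t : `|sin t| <= 1 :> R. Proof. by rewrite ler_norml sin_geN1 sin_le1. Qed.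

Let ccos p : continuous (fun t => cos (p * t)). Proof. by contd. Qed.

Let Jitg p : itg (fun t => cos (p * t) * cauchy t).
Proof. by apply: itg_cauchy_mul. Qed.

Let ct_le1 t : `|t| * cauchy t <= 1.
Proof.
rewrite ler_pdivrMr ?sqrD1_gt0// mul1r.
by have := sqr_ge0 (`|t| - 1); rewrite -(@real_normK _ t) ?num_real//; nra.
Qed.

Let ct2_le1 t : t ^+ 2 * cauchy t <= 1.
Proof. by rewrite ler_pdivrMr ?sqrD1_gt0// mul1r lerDr. Qed.

Let norm_cauchy t : `|cauchy t| = cauchy t. Proof. by rewrite gtr0_norm ?cauchy_gt0. Qed.

Let J2itg p : itg (fun t => cos (p * t) * cauchy t ^+ 2).
Proof.
rewrite (_ : (fun t => _) = (fun t => (cos (p * t) * cauchy t) * cauchy t)); last first.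
  by apply/funext => t; ring.
apply: itg_cauchy_mul => [t|t].
  by apply: (@continuousM R R); [exact: ccos|exact: cauchy_continuous].
by rewrite normrM norm_cauchy mulr_ile1 ?cauchy_le1 ?(ltW (cauchy_gt0 _)).
Qed.

Let Sitg p : itg (fun t => t * sin (p * t) * cauchy t ^+ 2).
Proof.
rewrite (_ : (fun t => _) = (fun t => (t * sin (p * t) * cauchy t) * cauchy t)); last first.
  by apply/funext => t; ring.
apply: itg_cauchy_mul => [t|t].
  by rewrite /cauchy; move: t; contd; exact: sqrD1_neq0.
rewrite mulrAC normrM mulr_ile1//; last by rewrite normrM norm_cauchy.
Qed.

Let dJ2 p : is_derive p 1 J2 (- S p).
Proof.
rewrite /S -intN//.
apply: (@int_derive_param _ (fun p t => cos (p * t) * cauchy t ^+ 2)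
  (fun p t => - (t * sin (p * t) * cauchy t ^+ 2)) cauchy) => //.
- by move=> x t; derc; ring.
- move=> x t; rewrite normrN (_ : _ * _ = (sin (x * t) * (t * cauchy t)) * cauchy t); last by ring.
  rewrite normrM norm_cauchy ler_piMl ?(ltW (cauchy_gt0 _))// normrM mulr_ile1//.
  by rewrite normrM norm_cauchy.
- exact: cauchy_itg.
Qed.

Let dS p : is_derive p 1 S (J p - J2 p).
Proof.
rewrite /J /J2 -intB//.
rewrite (_ : (fun x => _ - _) = (fun t => t ^+ 2 * cos (p * t) * cauchy t ^+ 2)); last first.
  by apply/funext => t; rewrite /cauchy; field; exact: sqrD1_neq0.
apply: (@int_derive_param _ (fun p t => t * sin (p * t) * cauchy t ^+ 2)
  (fun p t => t ^+ 2 * cos (p * t) * cauchy t ^+ 2) cauchy) => //.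
- by move=> x t; derc; ring.
- move=> x t; rewrite (_ : _ * _ = (cos (x * t) * (t ^+ 2 * cauchy t)) * cauchy t); last by ring.
  rewrite normrM norm_cauchy ler_piMl ?(ltW (cauchy_gt0 _))// normrM mulr_ile1//.
  by rewrite ger0_norm// mulr_ge0 ?sqr_ge0 ?(ltW (cauchy_gt0 _)).
- exact: cauchy_itg.
Qed.

Let JS p : p * J p = 2 * S p.
Proof.
have cv (u : nat -> R) : (forall n, `|u n| = n%:R) ->
    - (sin (p * u n) * cauchy (u n)) @[n --> \oo] --> (0 : R).
  move=> un; have h : cauchy (u n) @[n --> \oo] --> (0 : R).
    apply: squeeze_cvgr (cvg_invn 0); last exact: cvg_cst.
    near=> n; have n1 : 1 <= n%:R :> R by near: n; exact: near_natr_ge.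
    rewrite (ltW (cauchy_gt0 _))/= /cauchy -real_normK ?num_real// un addr0.
    rewrite lef_pV2 ?posrE; first by nra.
      by rewrite ltr_pwDl// sqr_ge0.
    by apply: lt_le_trans n1.
  rewrite -[X in _ --> X]oppr0; apply: cvgN; apply: norm_cvg0.
  apply: squeeze_cvgr h; last exact: cvg_cst.
  apply: nearW => n; rewrite normr_ge0/= normrM norm_cauchy.
  by rewrite ler_piMl// (ltW (cauchy_gt0 _)).
apply/eqP; rewrite -subr_eq0 -oppr_eq0 opprB /J /S -!intZ// -intB; [|exact: itgZ|exact: itgZ].
apply/eqP; rewrite -[RHS](subrr 0).
notypeclasses refine (@int_derive _ (fun t => - (sin (p * t) * cauchy t)) _ _ _ _ _ _ _ _).
- move=> t; rewrite /cauchy; derc; first exact: sqrD1_neq0.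
  by field; exact: sqrD1_neq0.
- by rewrite /cauchy; contd; exact: sqrD1_neq0.
- by apply: itgB; exact: itgZ.
- by apply: cv => n; rewrite ger0_norm.
- by apply: cv => n; rewrite normrN ger0_norm.
Unshelve. all: by end_near. Qed.

Let J_le p : `|J p| <= pi.
Proof.
rewrite -cauchy_int; apply: int_norm_le => //; first exact: cauchy_itg.
move=> t; rewrite normrM norm_cauchy ler_piMl// (ltW (cauchy_gt0 _))//.
Qed.

Let J2_le p : `|J2 p| <= pi.
Proof.
rewrite -cauchy_int; apply: int_norm_le => //; first exact: cauchy_itg.
move=> t; rewrite normrM expr2 normrM norm_cauchy mulrA ler_piMl ?(ltW (cauchy_gt0 _))//.
by rewrite mulr_ile1 ?(ltW (cauchy_gt0 _))// cauchy_le1.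
Qed.

Let J0 : J 0 = pi.
Proof.
by rewrite -cauchy_int; congr RInt; apply/funext => t; rewrite mul0r cos0 mul1r.
Qed.

Let J20 : J2 0 = pi / 2.
Proof.
have -> : J2 0 = RInt (fun t => cauchy t ^+ 2).
  by congr RInt; apply/funext => t; rewrite mul0r cos0 mul1r.
have h (u : nat -> R) : (forall n, `|u n| = n%:R) -> u n * cauchy (u n) @[n --> \oo] --> (0 : R).
  move=> un; apply: norm_cvg0; apply: squeeze_cvgr (cvg_invn 0); last exact: cvg_cst.
  near=> n; have n1 : 1 <= n%:R :> R by near: n; exact: near_natr_ge.
  rewrite normr_ge0/= normrM norm_cauchy un addr0 /cauchy -real_normK ?num_real// un.
  rewrite ler_pdivrMr ?sqrD1_gt0// mulrDr mulr1 expr2 mulrA mulVf ?mul1r.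
    by rewrite lerDr invr_ge0.
  by rewrite gt_eqF//; apply: lt_le_trans n1.
have -> : pi / 2 = 2^-1 * (0 + pi / 2) - 2^-1 * (0 - pi / 2) :> R by field.
notypeclasses refine (@int_derive _ (fun t => 2^-1 * (t * cauchy t + atan t)) _ _ _ _ _ _ _ _).
- move=> t; rewrite /cauchy; derc; first exact: sqrD1_neq0.
  by field; exact: sqrD1_neq0.
- by rewrite /cauchy; contd; exact: sqrD1_neq0.
- by have := J2itg 0; congr itg; apply/funext => t; rewrite mul0r cos0 mul1r.
- apply: cvgMr; apply: cvgD; last exact: cvg_atan_natr.
  by apply: h => n; rewrite ger0_norm.
- apply: cvgMr; apply: cvgD; last exact: cvg_atan_oppnatr.
  by apply: h => n; rewrite normrN ger0_norm.
Unshelve. all: by end_near. Qed.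

(** The decaying solution [J2 = (1 + p) e^(-p)], [S = p e^(-p)] of the system has [E = 0], and for
    every solution [E] is a multiple of [p^2 e^p]. As [J2] is bounded and [S] grows at most
    linearly, the multiple is 0. *)
Let E p : R := p * J2 p - (p + 1) * S p.

Let dE p : 0 < p -> is_derive p 1 (fun p => E p / p ^+ 2 * expR (- p)) 0.
Proof.
move=> p0; have d1 := dJ2 p; have d2 := dS p; have js := JS p.
have pn : p != 0 by rewrite gt_eqF.
rewrite /E; eapply is_derive_eq.
  by der; [exact: d1|exact: d2|rewrite expf_neq0].
cbv beta; have -> : S p = p * J p / 2 by rewrite js; field.
by move: (J p) (J2 p) (expR _) => u v w; field.
Qed.

Let E_eq0 p : 0 < p -> E p = 0.
Proof.
move=> p0; pose f q := E q / q ^+ 2 * expR (- q).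
have fc n : (0 < n)%N -> f n%:R = f p.
  by move=> n0; apply: eq_on_pos; rewrite ?ltr0n//; exact: dE.
have Sle q : 0 < q -> `|S q| <= q * pi.
  move=> q0; have -> : S q = q * J q / 2 by rewrite JS; field.
  rewrite !normrM (gtr0_norm q0) -mulrA ler_wpM2l ?(ltW q0)// (@ger0_norm _ 2^-1)//.
  by have := J_le q; have := normr_ge0 (J q); move: `|J q| => u; lra.
have lim : f n%:R @[n --> \oo] --> (0 : R).
  have h : pi * 3 * expR (- n%:R) @[n --> \oo] --> (0 : R).
    rewrite -[X in _ --> X](mulr0 (pi * 3)); apply: cvgMr.
    have q1 : `|expR (- 1 : R)| < 1 by rewrite gtr0_norm ?expR_gt0// -[ltRHS]expR0 ltr_expR; lra.
    have := cvg_expr q1; apply: cvg_trans; apply: near_eq_cvg; apply: nearW => n.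
    by rewrite -expRM_natl mulrN1.
  apply: norm_cvg0; apply: squeeze_cvgr h; last exact: cvg_cst.
  near=> n; have n1 : 1 <= n%:R :> R by near: n; exact: near_natr_ge.
  have n0 : 0 < n%:R :> R by apply: lt_le_trans n1.
  rewrite normr_ge0/= /f normrM (ger0_norm (expR_ge0 _)) ler_wpM2r ?expR_ge0//.
  rewrite normrM (@ger0_norm _ (_^-1)) ?invr_ge0 ?exprn_ge0// ler_pdivrMr ?exprn_gt0//.
  rewrite /E; apply: le_trans (ler_normB _ _) _; rewrite !normrM (gtr0_norm n0).
  rewrite (@gtr0_norm _ (_ + 1)) ?addr_gt0//.
  have hS := Sle _ n0; have hJ := J2_le n%:R; have hp := @pi_gt0 R.
  have k1 : (n%:R + 1) * `|S n%:R| <= (n%:R + 1) * (n%:R * pi) by rewrite ler_wpM2l// addr_ge0.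
  have k2 : n%:R * `|J2 n%:R| <= n%:R * pi by rewrite ler_wpM2l.
  apply: le_trans (lerD k2 k1) _.
  have h0 : 0 <= pi * n%:R * (n%:R - 1) :> R by rewrite !mulr_ge0 ?subr_ge0// ltW.
  by move: (pi : R) (n%:R : R) h0 => w m h0; lra.
have fp : f p = 0.
  have lim2 : f n%:R @[n --> \oo] --> f p.
    by apply: cvg_near_cst; exists 1%N => // n /= n0; exact: fc.
  exact: (cvg_unique _ lim2 lim).
move: fp => /eqP; rewrite /f mulf_eq0 (gt_eqF (expR_gt0 _)) orbF mulf_eq0 invr_eq0.
by rewrite expf_eq0/= (gt_eqF p0) orbF => /eqP.
Unshelve. all: by end_near. Qed.

Let J2E p : 0 <= p -> J2 p = pi / 2 * (1 + p) * expR (- p).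
Proof.
move=> p0.
pose f q := J2 q * expR q / (1 + q).
suff : f p = f 0.
  rewrite /f J20 expR0 addr0 divr1 mulr1 => <-; rewrite expRN.
  by field; rewrite gt_eqF ?expR_gt0//= gt_eqF// ltr_wpDr.
move: p0; rewrite le_eqVlt => /predU1P[<-//|p0].
have dJ q : 0 <= q -> is_derive q 1 f 0.
  move=> q0; have d1 := dJ2 q.
  have q1 : 1 + q != 0 by rewrite gt_eqF// ltr_wpDr.
  rewrite /f; eapply is_derive_eq; first by der; [exact: d1|exact: q1].
  (* [E = 0] reduces the system to the first-order equation [J2' = - q J2 / (1 + q)]; the case
     [q = 0] is read off from [JS]. *)
  have -> : S q = q * J2 q / (1 + q).
    move: q0; rewrite le_eqVlt => /predU1P[<-|q0].
      by have := JS 0; rewrite !mul0r; lra.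
    have := E_eq0 q0; rewrite /E; move: (S q) (J2 q) => u v e.
    by apply: (mulIf q1); rewrite divfK//; lra.
  by cbv beta; move: (J2 q) (expR q) => u v; field.
have dfz z : z \in `]0, p[ -> is_derive z 1 f 0.
  by rewrite in_itv/= => /andP[/ltW z0 _]; exact: dJ.
have cc : {within `[0, p], continuous f}.
  apply: continuous_in_subspaceT => x; rewrite inE/= in_itv/= => /andP[x0 _].
  by apply: is_derive_continuous (dJ x _).
have [c _] := MVT p0 dfz cc.
by rewrite mul0r => /eqP; rewrite subr_eq0 => /eqP.
Qed.

Lemma cauchy_fourier p : RInt (fun t => cos (p * t) * cauchy t) = pi * expR (- `|p|).
Proof.
rewrite -/(J p); wlog p0 : p / 0 <= p => [hw|].
  have [p0|/ltW p0] := leP 0 p; first exact: hw.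
  rewrite -normrN -hw ?oppr_ge0//; congr RInt; apply/funext => t.
  by rewrite mulNr cosN.
rewrite ger0_norm//; move: p0; rewrite le_eqVlt => /predU1P[<-|p0].
  by rewrite J0 oppr0 expR0 mulr1.
have := E_eq0 p0; rewrite /E J2E ?(ltW p0)// => e.
have -> : J p = 2 * S p / p by rewrite -JS; field; rewrite gt_eqF.
have -> : S p = p * (pi / 2) * expR (- p).
  apply: (@mulfI _ (p + 1)); first by rewrite gt_eqF// addr_gt0.
  by move: e; move: (S p) (expR _) => s q; lra.
by field; rewrite gt_eqF.
Qed.

Lemma cauchy_fourier_scale k p : 0 < k ->
  RInt (fun t => cos (p * t) / (k ^+ 2 + t ^+ 2)) = pi / k * expR (- (k * `|p|)).
Proof.
move=> k0.
have c t : k ^+ 2 + t ^+ 2 != 0 by rewrite gt_eqF// ltr_pwDl ?exprn_gt0// sqr_ge0.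
rewrite (@scale_shift_int _ k 0)//; last by contd.
have -> : (fun x => k * (cos (p * (k * x + 0)) / (k ^+ 2 + (k * x + 0) ^+ 2))) =
   (fun t => k^-1 * (cos ((p * k) * t) * cauchy t)).
  apply/funext => t; rewrite addr0 (mulrA p) /cauchy; field.
  by rewrite sqrD1_neq0 gt_eqF//= -exprMn c.
rewrite intZ; last exact: Jitg.
by rewrite cauchy_fourier normrM (gtr0_norm k0) (mulrC `|p|); field; rewrite gt_eqF.
Qed.

End FourierTransform.

(** * The weight in the variable t *)

Section WeightOnLine.
Context {R : realType}.
Implicit Types (f g h F : R -> R) (x y a b c d p q t k l u : R).

Local Notation mu := (@lebesgue_measure R).

Lemma int_param_continuous (f : R -> R -> R) g :
  (forall x, itg (f x)) -> (forall u, continuous (f^~ u)) ->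
  (forall x u, `|f x u| <= g u) -> itg g ->
  continuous (fun x => RInt (f x)).
Proof.
move=> fi fc fg gi x.
have h := @continuity_under_integral R _ _ mu f setT measurableT (x - 1) (x + 1)
  (fun y _ => fi y) _ g gi _.
apply: h.
- by apply: aeW => u _ y _; exact: fc.
- by move=> y _; apply: aeW => u _; exact: fg.
- by rewrite inE/= in_itv/=; apply/andP; split; lra.
Qed.

Lemma Gamma_gint l : 0 < l -> Gamma l = gint l.
Proof.
move=> l0.
have Dr : `]0, +oo[%classic = range (@expR R).
  apply/seteqP; split=> [y|_ [x _ <-]] /=; rewrite in_itv/= andbT ?expR_gt0// => y0.
  by exists (ln y) => //; rewrite lnK.
rewrite /Gamma (@subst_Rint _ expR expR `]0, +oo[%classic)//.
- congr RInt; apply/funext => u; rewrite /powR gt_eqF ?expR_gt0// expRK /gkernel -!expRD.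
  by congr expR; ring.
- by move=> x; exact: continuous_expR.
- by move=> x; exact: expR_gt0.
- move=> y /=; rewrite in_itv/= andbT => y0.
  by eapply is_derive_continuous; der.
Qed.

Lemma normc_cGamma l y : 0 < l ->
  ComplexField.Normc.normc (cGamma (Complex l y)) ^+ 2 = gnorm2 l y 0.
Proof.
move=> l0.
have Dr : `]0, +oo[%classic = range (@expR R).
  apply/seteqP; split=> [z|_ [x _ <-]] /=; rewrite in_itv/= andbT ?expR_gt0// => y0.
  by exists (ln z) => //; rewrite lnK.
rewrite /cGamma /=; rewrite sqr_sqrtr ?addr_ge0 ?sqr_ge0// /gnorm2.
congr (_ ^+ 2 + _ ^+ 2).
- rewrite (@subst_Rint _ expR expR `]0, +oo[%classic)//.
  + congr RInt; apply/funext => u; rewrite /powR gt_eqF ?expR_gt0// expRK mul0r addr0.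
    have -> : gkernel l u = expR ((l - 1) * u) * expR (- expR u) * expR u.
      by rewrite -!expRD; congr expR; ring.
    ring.
  + by move=> x; exact: continuous_expR.
  + by move=> x; exact: expR_gt0.
  + move=> z /=; rewrite in_itv/= andbT => z0.
    by eapply is_derive_continuous; der.
- rewrite (@subst_Rint _ expR expR `]0, +oo[%classic)//.
  + congr RInt; apply/funext => u; rewrite /powR gt_eqF ?expR_gt0// expRK mul0r addr0.
    have -> : gkernel l u = expR ((l - 1) * u) * expR (- expR u) * expR u.
      by rewrite -!expRD; congr expR; ring.
    ring.
  + by move=> x; exact: continuous_expR.
  + by move=> x; exact: expR_gt0.
  + move=> z /=; rewrite in_itv/= andbT => z0.
    by eapply is_derive_continuous; der.
Qed.

(* x = t / sqrt (1 + t^2), i.e. t = cot theta for x = cos theta. *)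
Definition xt t : R := t / Num.sqrt (1 + t ^+ 2).
Definition xt' t : R := cauchy t / Num.sqrt (1 + t ^+ 2).
Definition tx x : R := x / Num.sqrt (1 - x ^+ 2).

Lemma sqrt_sqrD1_gt0 t : 0 < Num.sqrt (1 + t ^+ 2).
Proof. by rewrite sqrtr_gt0 sqrD1_gt0. Qed.

Lemma sqr_sqrt_sqrD1 t : Num.sqrt (1 + t ^+ 2) ^+ 2 = 1 + t ^+ 2.
Proof. by rewrite sqr_sqrtr// ltW// sqrD1_gt0. Qed.

Lemma xt'_gt0 t : 0 < xt' t.
Proof. by rewrite divr_gt0 ?cauchy_gt0 ?sqrt_sqrD1_gt0. Qed.

Lemma xt_derive t : is_derive t 1 xt (xt' t).
Proof.
rewrite /xt /xt' /cauchy; derc.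
- by rewrite gt_eqF// sqrt_sqrD1_gt0.
- exact: sqrD1_gt0.
have e := sqr_sqrt_sqrD1 t; have s0 := gt_eqF (sqrt_sqrD1_gt0 t).
move: (Num.sqrt _) e s0 => s e s0; rewrite -e.
have -> : t ^+ 2.-1 = t by rewrite expr1.
have -> : 1 * s^-1 + t * (- s ^- 2 * ((2 * s)^-1 * (0 + 2 * t * 1))) =
    (s ^+ 2 - t ^+ 2) / s ^+ 3 by field; rewrite s0.
have -> : s ^+ 2 - t ^+ 2 = 1 by rewrite e addrK.
by field; rewrite s0.
Qed.

Lemma xt'_continuous : continuous xt'.
Proof.
rewrite /xt' /cauchy; contd; first exact: sqrD1_neq0.
  by rewrite gt_eqF// sqrt_sqrD1_gt0.
exact: sqrD1_gt0.
Qed.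

Lemma xt_continuous : continuous xt.
Proof. by move=> t; exact: is_derive_continuous (xt_derive t). Qed.

Lemma xt_sqr t : xt t ^+ 2 = t ^+ 2 * cauchy t.
Proof. by rewrite /xt exprMn exprVn sqr_sqrt_sqrD1. Qed.

Lemma sub1_xt_sqr t : 1 - xt t ^+ 2 = cauchy t.
Proof. by rewrite xt_sqr /cauchy; field; exact: sqrD1_neq0. Qed.

Lemma xt_lt1 t : `|xt t| < 1.
Proof.
rewrite -(@ltr_pXn2r _ 2)// ?nnegrE// real_normK ?num_real// expr1n.
by rewrite -subr_gt0 sub1_xt_sqr cauchy_gt0.
Qed.

Lemma sqrt_cauchy t : Num.sqrt (cauchy t) = (Num.sqrt (1 + t ^+ 2))^-1.
Proof. by rewrite sqrtrV// ltW// sqrD1_gt0. Qed.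

Lemma xtK t : tx (xt t) = t.
Proof.
by rewrite /tx sub1_xt_sqr sqrt_cauchy invrK /xt divfK// gt_eqF// sqrt_sqrD1_gt0.
Qed.

Lemma txK x : `|x| < 1 -> xt (tx x) = x.
Proof.
move=> x1; have p0 : 0 < 1 - x ^+ 2.
  by rewrite subr_gt0 -real_normK ?num_real// expr_lt1.
have s0 : 0 < Num.sqrt (1 - x ^+ 2) by rewrite sqrtr_gt0.
rewrite /xt; have -> : 1 + tx x ^+ 2 = (1 - x ^+ 2)^-1.
  rewrite /tx exprMn exprVn sqr_sqrtr ?(ltW p0)//.
  by field; rewrite gt_eqF.
by rewrite sqrtrV ?(ltW p0)// invrK /tx divfK// gt_eqF.
Qed.

Lemma range_xt : `]-1, 1[%classic = range xt.
Proof.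
apply/seteqP; split=> [x|_ [t _ <-]] /=; rewrite in_itv/= -ltr_norml.
  by move=> x1; exists (tx x) => //; exact: txK.
exact: xt_lt1.
Qed.

Lemma tx_continuous x : -1 < x < 1 -> {for x, continuous tx}.
Proof.
rewrite -ltr_norml => x1; have p0 : 0 < 1 - x ^+ 2.
  by rewrite subr_gt0 -real_normK ?num_real// expr_lt1.
have s0 : 0 < Num.sqrt (1 - x ^+ 2) by rewrite sqrtr_gt0.
by rewrite /tx; eapply is_derive_continuous; der; rewrite ?gt_eqF.
Qed.

(** Only the open interval is seen by [xt]; the endpoints, where the weight has arbitrary values,
    are a null set. *)
Lemma int_xt f h : continuous h -> (forall t, f (xt t) = h t) ->
  (\int[mu]_(x in `[-1, 1]) f x)%R = RInt (fun t => h t * xt' t).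
Proof.
move=> ch fh.
have ec x : `]-1, 1[%classic x -> h (tx x) = f x.
  by rewrite /= in_itv/= -ltr_norml => x1; rewrite -fh txK.
have cht y : `]-1, 1[%classic y -> {for y, continuous (fun x => h (tx x))}.
  rewrite /= in_itv/= => y1; apply: continuous_comp; first exact: tx_continuous.
  exact: ch.
transitivity (\int[mu]_(x in `]-1, 1[) h (tx x))%R.
  rewrite /Rintegral; congr fine.
  transitivity (\int[mu]_(x in `](-1)%R, 1%R[) (f x)%:E)%E.
    apply: integral_itv_bndoo; apply/measurable_EFinP.
    apply: (@eq_measurable_fun _ _ _ _ _ (fun x => h (tx x))).
      by move=> x; rewrite inE; exact: ec.
    by apply: (continuous_range_measurable xt_derive xt'_gt0 range_xt).
  by apply: eq_integral => x; rewrite inE => x1; rewrite ec.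
rewrite (subst_Rint xt_derive xt'_continuous xt'_gt0 range_xt)//.
by congr RInt; apply/funext => t; rewrite xtK.
Qed.

Section Weight.
Variables (l a : R).
Hypotheses (l0 : 0 < l) (a0 : 0 <= a).

Definition wconst : R := 2 `^ (2 * l) * (l + a) / (2 * pi * gint (2 * l)).

(* [W t dt] is [w x dx] under [x = xt t]; the factor [gnorm2 l (a * t) t] is
   [|Gamma (l + i a t)|^2 (1 + t^2)^(-l) exp (- 2 a t atan t)]. *)
Definition W t : R := wconst * gnorm2 l (a * t) t * cauchy t.

Lemma wconst_gt0 : 0 < wconst.
Proof.
rewrite divr_gt0 ?mulr_gt0 ?powR_gt0 ?pi_gt0 ?gint_gt0 ?ltr_wpDr//.
by rewrite mulr_gt0.
Qed.

(** The phase [a t u + t e^u] is linear in [t], namely [t * sigma u]. So [Fc] and [Fs] form the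
    Fourier transform of the image of the kernel under [sigma], and the weight contains the squared
    modulus of such a transform. *)
Definition sigma u : R := a * u + expR u.
Definition Fc t : R := RInt (fun u => gkernel l u * cos (t * sigma u)).
Definition Fs t : R := RInt (fun u => gkernel l u * sin (t * sigma u)).

Lemma gcos_Fc t : gcos l (a * t) t = Fc t.
Proof.
by congr RInt; apply/funext => u; congr (_ * cos _); rewrite /sigma; ring.
Qed.

Lemma gsin_Fs t : gsin l (a * t) t = Fs t.
Proof.
by congr RInt; apply/funext => u; congr (_ * sin _); rewrite /sigma; ring.
Qed.

Lemma W_FcFs t : W t = wconst * (Fc t ^+ 2 + Fs t ^+ 2) * cauchy t.
Proof. by rewrite /W /gnorm2 gcos_Fc gsin_Fs. Qed.

Lemma W_expl t : W t = wconst * gnorm2 l (a * t) 0 *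
  (1 + t ^+ 2) `^ (- l) * expR (- (2 * a * t * atan t)) * cauchy t.
Proof. by rewrite /W gnorm2E// !mulrA. Qed.

Let cos1 t : `|cos t| <= 1 :> R. Proof. by rewrite ler_norml cos_geN1 cos_le1. Qed.
Let sin1 t : `|sin t| <= 1 :> R. Proof. by rewrite ler_norml sin_geN1 sin_le1. Qed.

Lemma Fc_itg t : itg (fun u => gkernel l u * cos (t * sigma u)).
Proof.
have := gcos_itg (a * t) t l0; congr itg; apply/funext => u.
by congr (_ * cos _); rewrite /sigma; ring.
Qed.

Lemma Fs_itg t : itg (fun u => gkernel l u * sin (t * sigma u)).
Proof.
have := gsin_itg (a * t) t l0; congr itg; apply/funext => u.
by congr (_ * sin _); rewrite /sigma; ring.
Qed.

Lemma Fc_continuous : continuous Fc.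
Proof.
apply: (@int_param_continuous _ (gkernel l)).
- exact: Fc_itg.
- by move=> u; contd.
- move=> t u; rewrite normrM (gtr0_norm (gkernel_gt0 _ _)).
  by rewrite ler_piMr// ltW// gkernel_gt0.
- exact: gkernel_itg.
Qed.

Lemma Fs_continuous : continuous Fs.
Proof.
apply: (@int_param_continuous _ (gkernel l)).
- exact: Fs_itg.
- by move=> u; contd.
- move=> t u; rewrite normrM (gtr0_norm (gkernel_gt0 _ _)).
  by rewrite ler_piMr// ltW// gkernel_gt0.
- exact: gkernel_itg.
Qed.

Lemma W_continuous : continuous W.
Proof.
rewrite (_ : W = fun t => wconst * (Fc t * Fc t + Fs t * Fs t) * cauchy t); last first.
  by apply/funext => s; rewrite W_FcFs !expr2.
move=> t.
have hc : {for t, continuous Fc} by exact: Fc_continuous.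
have hs : {for t, continuous Fs} by exact: Fs_continuous.
apply: (@continuousM R R (fun t => wconst * (Fc t * Fc t + Fs t * Fs t)) cauchy); last exact: cauchy_continuous.
apply: (@continuousM R R (fun=> wconst) (fun t => Fc t * Fc t + Fs t * Fs t)); first exact: cst_continuous.
apply: (@continuousD R R R (fun t => Fc t * Fc t) (fun t => Fs t * Fs t)).
  exact: (@continuousM R R Fc Fc).
exact: (@continuousM R R Fs Fs).
Qed.

Lemma W_gt0 t : 0 < W t.
Proof.
rewrite W_expl; apply: mulr_gt0; last exact: cauchy_gt0.
apply: mulr_gt0; last exact: expR_gt0.
apply: mulr_gt0; last exact/powR_gt0/sqrD1_gt0.
by apply: mulr_gt0; [exact: wconst_gt0|exact: gnorm2_gt0].
Qed.

Lemma W_even t : W (- t) = W t.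
Proof.
rewrite !W_FcFs /cauchy sqrrN.
have -> : Fc (- t) = Fc t.
  by congr RInt; apply/funext => u; rewrite mulNr cosN.
have -> : Fs (- t) = - Fs t.
  rewrite /Fs -intN; last exact: Fs_itg.
  by congr RInt; apply/funext => u; rewrite mulNr sinN mulrN.
by rewrite sqrrN.
Qed.

Lemma W_le t : W t <= wconst * gint l ^+ 2 * (1 + t ^+ 2) `^ (- l) *
  expR (- (2 * a * t * atan t)) * cauchy t.
Proof.
rewrite W_expl; do 3 (rewrite ler_wpM2r ?powR_ge0 ?expR_ge0 ?(ltW (cauchy_gt0 _))//).
by rewrite ler_wpM2l ?(ltW wconst_gt0)// gnorm2_le.
Qed.

Lemma atan_mul_ge0 t : 0 <= t * atan t.
Proof.
have [t0|/ltW t0] := leP 0 t; first by rewrite mulr_ge0// -atan0 le_atan.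
by rewrite mulr_le0// -atan0 le_atan.
Qed.

Lemma expR_atan_le1 t : expR (- (2 * a * t * atan t)) <= 1.
Proof.
rewrite -[leRHS]expR0 ler_expR oppr_le0 -!mulrA mulr_ge0// mulr_ge0//.
exact: atan_mul_ge0.
Qed.

Lemma powR_sqrD1_le1 t c : 0 <= c -> (1 + t ^+ 2) `^ (- c) <= 1.
Proof.
by move=> c0; rewrite -[leRHS](powRr0 (1 + t ^+ 2)) ler_powR ?oppr_le0// lerDl sqr_ge0.
Qed.

Lemma W_le_cauchy t : W t <= wconst * gint l ^+ 2 * cauchy t.
Proof.
apply: le_trans (W_le t) _; rewrite ler_wpM2r ?(ltW (cauchy_gt0 _))//.
have p0 : 0 <= wconst * gint l ^+ 2 by apply: mulr_ge0; [exact/ltW/wconst_gt0|exact: sqr_ge0].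
rewrite -mulrA ler_piMr//.
by rewrite mulr_ile1 ?powR_ge0 ?expR_ge0 ?expR_atan_le1// powR_sqrD1_le1// ltW.
Qed.

Lemma W_itg : itg W.
Proof.
apply: itg_le (itgZ (wconst * gint l ^+ 2) cauchy_itg).
  by apply: continuous_measurable_fun; exact: W_continuous.
by move=> t; rewrite gtr0_norm ?W_gt0// W_le_cauchy.
Qed.

Lemma pollaczek_weight_xt t : pollaczek_weight l a (xt t) = W t / xt' t.
Proof.
rewrite /pollaczek_weight sub1_xt_sqr.
have -> : a * xt t / Num.sqrt (cauchy t) = a * t.
  by rewrite sqrt_cauchy invrK /xt -mulrA divfK// gt_eqF// sqrt_sqrD1_gt0.
have l20 : 0 < 2 * l by rewrite mulr_gt0.
rewrite Gamma_gint// normc_cGamma// -/wconst.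
have -> : 2 * acos (xt t) - pi = - (2 * atan t).
  (* [xt t = sin (atan t)], so the exponent of the weight becomes [- 2 a t atan t]. *)
  have -> : acos (xt t) = pi / 2 - atan t.
    have h1 := atan_ltpi2 t; have h2 := atan_gtNpi2 t.
    have c0 : cos (atan t) != 0.
      by rewrite cos_atan invr_eq0 gt_eqF// sqrt_sqrD1_gt0.
    have -> : xt t = cos (pi / 2 - atan t).
      rewrite cosB cos_pihalf sin_pihalf mul0r add0r mul1r.
      have : sin (atan t) / cos (atan t) = t by rewrite -[RHS]atanK.
      by move=> /(canRL (divfK c0)) ->; rewrite cos_atan.
    rewrite cosK// in_itv/=; apply/andP; split; first by move: (pi) h1 => P h1; lra.
    by move: (pi) h1 h2 => P h1 h2; lra.
  by field.
rewrite W_expl /xt' /cauchy.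
have -> : ((1 + t ^+ 2)^-1) `^ (l - 2^-1) = (1 + t ^+ 2) `^ (- l) * Num.sqrt (1 + t ^+ 2).
  rewrite -powR_inv1 ?(ltW (sqrD1_gt0 t))// -powRrM -powR12_sqrt ?(ltW (sqrD1_gt0 t))//.
  rewrite -powRD; first by congr powR; ring.
  by rewrite (gt_eqF (sqrD1_gt0 t)) implybT.
have -> : - (2 * atan t) * (a * t) = - (2 * a * t * atan t) by ring.
move: (gnorm2 _ _ _) (expR _) (_ `^ (- l)) wconst => G E P C.
field.
by rewrite sqrD1_neq0 gt_eqF// sqrt_sqrD1_gt0.
Qed.

End Weight.

End WeightOnLine.

(** * Functions of the second kind *)

Section StieltjesTransform.
Context {R : realType}.
Implicit Types (f g h F : R -> R) (x y b c d p q t k u v : R).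

Local Notation mu := (@lebesgue_measure R).

Lemma measurable_fst_comp (f : R -> R) : continuous f ->
  measurable_fun setT (fun z : R * R => f z.1).
Proof.
by move=> cf; apply: measurableT_comp => //; exact: continuous_measurable_fun.
Qed.

Lemma measurable_snd_comp (f : R -> R) : continuous f ->
  measurable_fun setT (fun z : R * R => f z.2).
Proof.
by move=> cf; apply: measurableT_comp => //; exact: continuous_measurable_fun.
Qed.

Lemma measurable_comp2 (f : R -> R) (g : R * R -> R) : continuous f ->
  measurable_fun setT g -> measurable_fun setT (fun z : R * R => f (g z)).
Proof.
by move=> cf mg; apply: measurableT_comp => //; exact: continuous_measurable_fun.
Qed.

Lemma continuous_id : continuous (fun x : R => x). Proof. by contd. Qed.
Section Kernel.
Variables (l a k : R).
Hypotheses (l0 : 0 < l) (a0 : 0 <= a) (k0 : 0 < k).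

Local Notation sig := (sigma a).
Local Notation gk := (gkernel l).

Let sig_continuous : continuous sig. Proof. by rewrite /sigma; contd. Qed.

Let ck t : R := (k ^+ 2 + t ^+ 2)^-1.

Let ck_gt0 t : 0 < ck t.
Proof. by rewrite invr_gt0 ltr_pwDl ?exprn_gt0// sqr_ge0. Qed.

Let ck_neq0 t : k ^+ 2 + t ^+ 2 != 0.
Proof. by rewrite gt_eqF// ltr_pwDl ?exprn_gt0// sqr_ge0. Qed.

Let ck_continuous : continuous ck.
Proof.
by rewrite /ck; contd; rewrite gt_eqF// ltr_pwDl ?exprn_gt0// sqr_ge0.
Qed.

Let ck_itg : itg ck.
Proof.
have := scale_shift_itg 0 (b := k^-1) _ (@cauchy_continuous R).
rewrite invr_gt0 => /(_ k0) [/(_ (@cauchy_itg R)) + _] => /(itgZ k^-1).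
congr itg; apply/funext => t; rewrite addr0 /cauchy /ck; field.
by rewrite !gt_eqF// ltr_pwDl ?exprn_gt0// sqr_ge0.
Qed.

Let cos_ck_itg p : itg (fun t => cos (p * t) / (k ^+ 2 + t ^+ 2)).
Proof.
apply: itg_le ck_itg.
  by apply: continuous_measurable_fun; contd; exact: ck_neq0.
move=> t; rewrite normrM (gtr0_norm (ck_gt0 t)) ler_piMl ?(ltW (ck_gt0 t))//.
by rewrite ler_norml cos_geN1 cos_le1.
Qed.

Let normgk u : `|gk u| = gk u. Proof. by rewrite gtr0_norm ?gkernel_gt0. Qed.

Let cos1 t : `|cos t| <= 1 :> R. Proof. by rewrite ler_norml cos_geN1 cos_le1. Qed.
Let sin1 t : `|sin t| <= 1 :> R. Proof. by rewrite ler_norml sin_geN1 sin_le1. Qed.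

Let Fc_le t : `|Fc l a t| <= gint l.
Proof.
apply: int_norm_le; [exact: Fc_itg|exact: gkernel_itg|].
by move=> u; rewrite normrM normgk ler_piMr// ltW// gkernel_gt0.
Qed.

Let Fs_le t : `|Fs l a t| <= gint l.
Proof.
apply: int_norm_le; [exact: Fs_itg|exact: gkernel_itg|].
by move=> u; rewrite normrM normgk ler_piMr// ltW// gkernel_gt0.
Qed.

Let f1 t u := (cos (t * sig u) * Fc l a t + sin (t * sig u) * Fs l a t) * ck t * gk u.

Let f1_measurable : measurable_fun setT (fun z : R * R => f1 z.1 z.2).
Proof.
have ms : measurable_fun setT (fun z : R * R => z.1 * sig z.2).
  by apply: measurable_funM; [exact: measurable_fst_comp continuous_id|exact: measurable_snd_comp].
rewrite /f1; apply: measurable_funM; last by apply: measurable_snd_comp; exact: gkernel_continuous.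
apply: measurable_funM; last exact: measurable_fst_comp.
apply: measurable_funD; apply: measurable_funM.
- by apply: (measurable_comp2 _ ms); exact: continuous_cos.
- by apply: measurable_fst_comp; exact: Fc_continuous.
- by apply: (measurable_comp2 _ ms); exact: continuous_sin.
- by apply: measurable_fst_comp; exact: Fs_continuous.
Qed.

Let step1 : itg (fun u => RInt (fun t => f1 t u)) /\
  RInt (fun t => (Fc l a t ^+ 2 + Fs l a t ^+ 2) * ck t) =
  RInt (fun u => RInt (fun t => f1 t u)).
Proof.
have [] := @fubini_product _ f1 (fun t => 2 * gint l * ck t) gk.
- exact: f1_measurable.
- by move=> t; have /measurable_fun_pair2 := f1_measurable; apply.
- by move=> u; have /measurable_fun_pair1 := f1_measurable; apply.
- move=> t u; rewrite /f1 normrM normgk ler_wpM2r ?(ltW (gkernel_gt0 _ _))//.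
  rewrite normrM (gtr0_norm (ck_gt0 t)) ler_wpM2r ?(ltW (ck_gt0 _))//.
  apply: le_trans (ler_normD _ _) _; rewrite !normrM mulrDl !mul1r.
  by rewrite lerD// (le_trans (ler_piMl _ _))// ?Fc_le ?Fs_le.
- exact: itgZ.
- exact: gkernel_itg.
move=> _ i1 <-; split=> //; congr RInt; apply/funext => t.
rewrite /f1; have iC := Fc_itg a l0 t; have iS := Fs_itg a l0 t.
rewrite (_ : (fun u => _) = (fun u => (Fc l a t * ck t) * (gk u * cos (t * sig u)) +
   (Fs l a t * ck t) * (gk u * sin (t * sig u)))); last by apply/funext => u; ring.
rewrite intD; [|exact: itgZ|exact: itgZ].
by rewrite !intZ// -/(Fc l a t) -/(Fs l a t); move: (Fc _ _ _) (Fs _ _ _) => p q; ring.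
Qed.

Let f2 u t v := cos (t * (sig u - sig v)) * ck t * gk v.

Let f2_measurable u : measurable_fun setT (fun z : R * R => f2 u z.1 z.2).
Proof.
have ms : measurable_fun setT (fun z : R * R => z.1 * (sig u - sig z.2)).
  apply: measurable_funM; first exact: measurable_fst_comp continuous_id.
  apply: (@measurable_snd_comp (fun v => sig u - sig v)) => x.
  apply: (@continuousB R R R (fun=> sig u) sig); first exact: cst_continuous.
  exact: sig_continuous.
rewrite /f2; apply: measurable_funM; last by apply: measurable_snd_comp; exact: gkernel_continuous.
apply: measurable_funM; last exact: measurable_fst_comp.
by apply: (measurable_comp2 _ ms); exact: continuous_cos.
Qed.

Let step2 u : RInt (fun t => f1 t u) =
  pi / k * RInt (fun v => gk u * gk v * expR (- (k * `|sig u - sig v|))).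
Proof.
have pk : pi / k != 0 :> R by rewrite mulf_neq0 ?invr_eq0 ?gt_eqF// pi_gt0.
have [] := @fubini_product _ (f2 u) ck gk.
- exact: f2_measurable.
- by move=> t; have /measurable_fun_pair2 := @f2_measurable u; apply.
- by move=> v; have /measurable_fun_pair1 := @f2_measurable u; apply.
- move=> t v; rewrite /f2 normrM normgk ler_wpM2r ?(ltW (gkernel_gt0 _ _))//.
  by rewrite normrM (gtr0_norm (ck_gt0 t)) ler_piMl// ltW// ck_gt0.
- exact: ck_itg.
- exact: gkernel_itg.
move=> i1 i2 e.
transitivity (RInt (fun t => gk u * RInt (f2 u t))).
  congr RInt; apply/funext => t.
  rewrite /f1 /f2; have iC := Fc_itg a l0 t; have iS := Fs_itg a l0 t.
  rewrite [in RHS](_ : (fun v => _) = (fun v => (cos (t * sig u) * ck t) * (gk v * cos (t * sig v)) +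
   (sin (t * sig u) * ck t) * (gk v * sin (t * sig v)))); last first.
    by apply/funext => v; rewrite mulrBr cosB; ring.
  rewrite intD; [|exact: itgZ|exact: itgZ].
  rewrite (intZ _ iC) (intZ _ iS) -/(Fc l a t) -/(Fs l a t).
  by move: (Fc l a t) (Fs l a t) (ck t) (gk u) (cos _) (sin _) => *; ring.
rewrite (intZ (gk u) i1) e {e i1}.
have hv v : RInt (fun t => f2 u t v) = pi / k * expR (- (k * `|sig u - sig v|)) * gk v.
  rewrite -(cauchy_fourier_scale (sig u - sig v) k0) mulrC -intZ.
    by congr RInt; apply/funext => t; rewrite /f2 /ck (mulrC t); ring.
  exact: cos_ck_itg.
rewrite (_ : (fun v => _) = (fun v => (pi / k) * (gk v * expR (- (k * `|sig u - sig v|))))) in i2 *; last first.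
  by apply/funext => v; rewrite hv; ring.
have i3 : itg (fun v => gk v * expR (- (k * `|sig u - sig v|))).
  by have := itgZ (pi / k)^-1 i2; congr itg; apply/funext => v; rewrite mulrA mulVf ?mul1r.
rewrite (intZ _ i3) mulrCA -(intZ _ i3); congr (_ * _); congr RInt.
by apply/funext => v; rewrite mulrA.
Qed.

(** [Fc^2 + Fs^2] is a double integral of [cos (t (sigma u - sigma v))]. Integrating over [t] before
    [u] and [v] leaves the Fourier transform of [1 / (k^2 + t^2)]; Fubini is applied twice, once for
    each factor. *)
Lemma transform_double_integral :
  itg (fun u => RInt (fun v => gk u * gk v * expR (- (k * `|sig u - sig v|)))) /\
  RInt (fun t => (Fc l a t ^+ 2 + Fs l a t ^+ 2) / (k ^+ 2 + t ^+ 2)) =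
  pi / k * RInt (fun u => RInt (fun v => gk u * gk v * expR (- (k * `|sig u - sig v|)))).
Proof.
have pk : pi / k != 0 :> R by rewrite mulf_neq0 ?invr_eq0 ?gt_eqF// pi_gt0.
have [i1 ->] := step1.
have i2 : itg (fun u => RInt (fun v => gk u * gk v * expR (- (k * `|sig u - sig v|)))).
  have := itgZ (pi / k)^-1 i1; congr itg; apply/funext => u.
  by rewrite step2 mulrA mulVf ?mul1r.
split; first exact: i2.
rewrite -(intZ _ i2); congr RInt; apply/funext => u; exact: step2.
Qed.

End Kernel.

End StieltjesTransform.

(** * The transform as an integral over a half-line *)

Section StieltjesFormula.
Context {R : realType}.
Implicit Types (f g F : R -> R) (x y b c d h p q t u v : R).

Local Notation mu := (@lebesgue_measure R).

Lemma gkernel_bound (l u : R) : 0 < l -> gkernel l u <= expR (l * (ln l - 1)).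
Proof.
move=> l0; rewrite /gkernel ler_expR; have := expR_ge_linear u ltr01 l0.
by rewrite divr1 mul1r; lra.
Qed.

Lemma even_int_pos f : continuous f -> (forall x, 0 <= f x) ->
  (forall x, f (- x) = f x) -> itg f ->
  RInt f = 2 * RInt (fun x => \1_`]0, +oo[ x * f x).
Proof.
move=> cf f0 ef jf.
have jf' : mu.-integrable `]0, +oo[ (EFin \o f).
  by apply: (integrableS measurableT _ _ jf) => //; exact: measurable_itv.
rewrite -(I_mkcond `]0, +oo[ f) (Rintegral_itv_obnd_cbnd jf').
rewrite /RInt /Rintegral (ge0_symfun_integralT f0 cf); last by move=> x /=; rewrite ef.
rewrite fineM//; last first.
  rewrite (_ : [set x : R | 0 <= x] = `[0, +oo[%classic).
    apply: integrable_fin_num; first exact: measurable_itv.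
    by apply: (integrableS measurableT _ _ jf) => //; exact: measurable_itv.
  by apply/seteqP; split=> x /=; rewrite in_itv/= andbT.
congr (_ * fine (integral _ _ _)).
by apply/seteqP; split=> x /=; rewrite in_itv/= andbT.
Qed.

Section Kernel.
Variables (l a k : R).
Hypotheses (l0 : 0 < l) (a0 : 0 <= a) (k0 : 0 < k).

Local Notation sig := (sigma a).
Local Notation gk := (gkernel l).

Let K u h := gk u * gk (u - h) * expR (- (k * `|sig u - sig (u - h)|)).

Let sig_continuous : continuous sig. Proof. by rewrite /sigma; contd. Qed.

Let K0 u h : 0 <= K u h.
Proof. by rewrite !mulr_ge0 ?expR_ge0. Qed.

Let inner u : RInt (fun v => gk u * gk v * expR (- (k * `|sig u - sig v|))) = RInt (K u).
Proof.
pose G v := gk u * gk v * expR (- (k * `|sig u - sig v|)).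
have cG : continuous G.
  move=> v; rewrite /G.
  have c1 : {for v, continuous (fun v => gk u * gk v)} by rewrite /gkernel; eapply is_derive_continuous; der.
  have c2 : {for v, continuous (fun v => - (k * `|sig u - sig v|))}.
    have c3 : {for v, continuous (fun v => sig u - sig v)} by rewrite /sigma; eapply is_derive_continuous; der.
    have c4 : {for v, continuous (fun v => `|sig u - sig v|)}.
      by apply: (continuous_comp c3); exact: norm_continuous.
    apply: continuousN; apply: (@continuousM R R (fun=> k) (fun v => `|sig u - sig v|)) => //.
    exact: cst_continuous.
  apply: (@continuousM R R (fun v => gk u * gk v) (fun v => expR (- (k * `|sig u - sig v|)))) => //.
  by apply: (continuous_comp c2); exact: continuous_expR.
have cG' : continuous (fun x => G (x + u)).
  move=> x; apply: (@continuous_comp _ _ _ (fun x => x + u) G); last exact: cG.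
  by move: x; contd.
rewrite -/G -[LHS](shift_int u cG) -[LHS](opp_int cG').
by congr RInt; apply/funext => h; rewrite /K /G (addrC (- h)).
Qed.

Let alpha := l + k * a.

(** For [h >= 0] the exponent of [K u h] is [2 l u - (l + k a) h - A h e^u] with this function as
    [A]; the integral over [u] is thus a Gamma integral at [2 l], shifted by [ln (A h)]. *)
Definition stieltjes_base h := 1 + expR (- h) + k * (1 - expR (- h)).

Let A := stieltjes_base.

Let A_gt0 h : 0 <= h -> 0 < A h.
Proof.
move=> h0; rewrite /A /stieltjes_base; apply: ltr_wpDr.
  by rewrite mulr_ge0 ?(ltW k0)// subr_ge0 -[leRHS]expR0 ler_expR oppr_le0.
by rewrite addr_gt0 ?expR_gt0.
Qed.

Let P h := expR (- (alpha * h)) * A h `^ (- (2 * l)) * gint (2 * l).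

Let M h := RInt (fun u => K u h).

Let M_pos h : 0 <= h -> M h = P h.
Proof.
move=> h0; have Ah := A_gt0 h0; have l20 : 0 < 2 * l by rewrite mulr_gt0.
pose G u := expR (- (alpha * h)) * A h `^ (- (2 * l)) * gkernel (2 * l) (u + ln (A h)).
have e : (fun u => K u h) = G.
  apply/funext => u; rewrite /K /G /gkernel.
  (* Here [a >= 0] enters: [sigma] is nondecreasing, so the absolute value opens with a fixed
     sign. *)
  have s0 : 0 <= sig u - sig (u - h).
    rewrite /sigma mulrBr.
    have : expR (u - h) <= expR u by rewrite ler_expR gerBl.
    by have := mulr_ge0 a0 h0; lra.
  have e1 : expR (u + ln (A h)) = expR u * A h by rewrite expRD lnK ?posrE.
  have e2 : expR (u - h) = expR u * expR (- h) by rewrite expRD.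
  rewrite ger0_norm// /powR (gt_eqF Ah) e1 /sigma e2 /A /stieltjes_base /alpha.
  move: (expR u) (expR (- h)) (ln _) => p q L.
  by rewrite -!expRD; congr expR; ring.
rewrite /M e /G intZ.
  by rewrite shift_int//; exact: gkernel_continuous.
by apply: shift_itg; [exact: gkernel_continuous|exact: gkernel_itg].
Qed.

Let K_continuous h : continuous (fun u => K u h).
Proof.
move=> v; rewrite /K.
have c1 : {for v, continuous (fun u => gk u * gk (u - h))} by rewrite /gkernel; eapply is_derive_continuous; der.
have c2 : {for v, continuous (fun u => - (k * `|sig u - sig (u - h)|))}.
  have c3 : {for v, continuous (fun u => sig u - sig (u - h))} by rewrite /sigma; eapply is_derive_continuous; der.
  have c4 : {for v, continuous (fun u => `|sig u - sig (u - h)|)}.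
    by apply: (continuous_comp c3); exact: norm_continuous.
  apply: continuousN; apply: (@continuousM R R (fun=> k) (fun u => `|sig u - sig (u - h)|)) => //.
  exact: cst_continuous.
apply: (@continuousM R R (fun u => gk u * gk (u - h)) (fun u => expR (- (k * `|sig u - sig (u - h)|)))) => //.
by apply: (continuous_comp c2); exact: continuous_expR.
Qed.

Let M_even h : M (- h) = M h.
Proof.
rewrite /M -(shift_int (- h) (@K_continuous (- h))); congr RInt; apply/funext => u.
by rewrite /K opprK subrK distrC (mulrC (gk u)).
Qed.

Let M_abs h : M h = P `|h|.
Proof.
have [h0|/ltW h0] := leP 0 h; first by rewrite ger0_norm// M_pos.
by rewrite -M_even ler0_norm// M_pos ?oppr_ge0.
Qed.

Let M_continuous : continuous M.
Proof.
rewrite (_ : M = fun h => P `|h|); last by apply/funext => h; exact: M_abs.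
move=> h; apply: continuous_comp; first exact: norm_continuous.
rewrite /P; eapply is_derive_continuous; der.
- exact: A_gt0.
- by rewrite /A /stieltjes_base; der.
Qed.

Let M_ge0 h : 0 <= M h. Proof. by apply: int_ge0. Qed.

Let K_itg2 h : itg (fun u => K u h).
Proof.
apply: itg_le (itgZ (expR (l * (ln l - 1))) (gkernel_itg l0)).
  by apply: continuous_measurable_fun; exact: K_continuous.
move=> u; rewrite ger0_norm// /K.
rewrite mulrAC mulrC ler_pM ?mulr_ge0 ?expR_ge0//; first exact: gkernel_bound.
rewrite ler_piMr ?expR_ge0// -[leRHS]expR0 ler_expR oppr_le0 mulr_ge0//.
exact: ltW.
Qed.

Let K_itg1 u : itg (K u).
Proof.
have iG : itg (fun h => gk (u - h)).
  have cg : continuous (fun x => gk (x + u)).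
    by rewrite /gkernel; contd.
  have := opp_itg cg (shift_itg u (@gkernel_continuous R l) (gkernel_itg l0)).
  by congr itg; apply/funext => h; rewrite addrC.
apply: itg_le (itgZ (gk u) iG).
  apply: continuous_measurable_fun => v; rewrite /K.
  have c1 : {for v, continuous (fun h => gk u * gk (u - h))} by rewrite /gkernel; eapply is_derive_continuous; der.
  have c2 : {for v, continuous (fun h => - (k * `|sig u - sig (u - h)|))}.
    have c3 : {for v, continuous (fun h => sig u - sig (u - h))} by rewrite /sigma; eapply is_derive_continuous; der.
    have c4 : {for v, continuous (fun h => `|sig u - sig (u - h)|)}.
      by apply: (continuous_comp c3); exact: norm_continuous.
    apply: continuousN; apply: (@continuousM R R (fun=> k) (fun h => `|sig u - sig (u - h)|)) => //.
    exact: cst_continuous.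
  apply: (@continuousM R R (fun h => gk u * gk (u - h)) (fun h => expR (- (k * `|sig u - sig (u - h)|)))) => //.
  by apply: (continuous_comp c2); exact: continuous_expR.
move=> h; rewrite ger0_norm// /K ler_piMr ?mulr_ge0 ?expR_ge0//.
rewrite -[leRHS]expR0 ler_expR oppr_le0 mulr_ge0//; exact: ltW.
Qed.

Let K_measurable : measurable_fun setT (fun z : R * R => K z.1 z.2).
Proof.
have md : measurable_fun setT (fun z : R * R => z.1 - z.2).
  by apply: measurable_funB; [exact: measurable_fst_comp continuous_id|exact: measurable_snd_comp continuous_id].
rewrite /K; apply: measurable_funM.
  apply: measurable_funM; first by apply: measurable_fst_comp; exact: gkernel_continuous.
  by apply: (measurable_comp2 _ md); exact: gkernel_continuous.
apply: (@measurable_comp2 _ expR); first exact: continuous_expR.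
apply: (@measurable_comp2 _ (fun x => - (k * `|x|)) (fun z => sig z.1 - sig (z.1 - z.2))).
  move=> x.
  have ck : {for x, continuous (fun x => k * `|x|)}.
    apply: (@continuousM R R (fun=> k) (fun x => `|x|)); first exact: cst_continuous.
    exact: norm_continuous.
  exact: (@continuousN R R R (fun x => k * `|x|) x ck).
by apply: measurable_funB; [exact: measurable_fst_comp|exact: (measurable_comp2 _ md)].
Qed.

(** With the difference [h = u - v] as outer variable the inner integral [M] is even, by exchange of
    [u] and [v], and explicit for [h > 0]; hence the factor 2. *)
Lemma transform_half_line :
  RInt (fun t => (Fc l a t ^+ 2 + Fs l a t ^+ 2) / (k ^+ 2 + t ^+ 2)) =
  2 * pi / k * gint (2 * l) *
  RInt (fun h => \1_`]0, +oo[ h * (expR (- ((l + k * a) * h)) * stieltjes_base h `^ (- (2 * l)))) /\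
  itg (fun h => \1_`]0, +oo[ h * (expR (- ((l + k * a) * h)) * stieltjes_base h `^ (- (2 * l)))).
Proof.
have [i1 ->] := transform_double_integral a l0 k0.
rewrite (_ : (fun u => _) = (fun u => RInt (K u))) in i1 *; last by apply/funext => u; exact: inner.
have [] := @fubini _ K K_measurable K_itg1 K_itg2.
  move: i1; congr itg; apply/funext => u; congr RInt; apply/funext => h.
  by rewrite ger0_norm.
move=> _ iM ->; have iM' : itg M := iM.
have g0 : gint (2 * l) != 0 by rewrite gt_eqF// gint_gt0// mulr_gt0.
have e : (fun x => \1_`]0, +oo[ x * M x) = (fun h => gint (2 * l) *
    (\1_`]0, +oo[ h * (expR (- ((l + k * a) * h)) * stieltjes_base h `^ (- (2 * l))))).
  apply/funext => h; rewrite indicE mem_setE in_itv/= andbT.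
  have [h0|h0] := ltP 0 h; last by rewrite !mul0r mulr0.
  by rewrite M_pos ?(ltW h0)// /P /A /alpha; ring.
have i2 : itg (fun x => \1_`]0, +oo[ x * M x) by apply: itg_indic.
have i3 : itg (fun h => \1_`]0, +oo[ h * (expR (- ((l + k * a) * h)) * stieltjes_base h `^ (- (2 * l)))).
  move: i2; rewrite e => /(itgZ (gint (2 * l))^-1); congr itg; apply/funext => h.
  by rewrite mulrA mulVf ?mul1r.
split; last exact: i3.
rewrite (even_int_pos M_continuous M_ge0 M_even iM') e (intZ _ i3).
by move: (RInt _) (gint _) => x y; field; rewrite gt_eqF.
Qed.

End Kernel.

End StieltjesFormula.

(** * The recurrence of the functions of the second kind *)

Section SecondKind.
Context {R : realType}.
Implicit Types (f g F : R -> R) (x y b c d h t u : R) (p q : {poly R}).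

Local Notation mu := (@lebesgue_measure R).

Variables (l a : R).
Hypotheses (l0 : 0 < l) (a0 : 0 <= a).

Let c := l + a.

Let c_gt0 : 0 < c. Proof. by rewrite /c ltr_wpDr. Qed.

(* [alpha n] is the square of the paper's [a_n]: the monic polynomials satisfy
   [p_(n+1) = X p_n - a_n^2 p_(n-1)]. *)
Definition alpha n : R :=
  n%:R * (n%:R + 2 * l - 1) / (4 * (n%:R + (l + a)) * (n%:R + (l + a) - 1)).

Fixpoint monic_pol_pair n : {poly R} * {poly R} :=
  if n is m.+1 then
    let: (p, q) := monic_pol_pair m in (q, 'X * q - alpha m.+1 *: p)
  else (1, 'X).

Definition monic_pol n := (monic_pol_pair n).1.

Lemma monic_pol0 : monic_pol 0 = 1. Proof. by []. Qed.
Lemma monic_pol1 : monic_pol 1 = 'X. Proof. by []. Qed.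
Lemma monic_polSS n : monic_pol n.+2 = 'X * monic_pol n.+1 - alpha n.+1 *: monic_pol n.
Proof. by rewrite /monic_pol /=; case: (monic_pol_pair n). Qed.

Section Rho.
Variable r : R.
Hypotheses (r0 : 0 < r) (r1 : r < 1).

Let r2 : 0 < 1 - r ^+ 2. Proof. by rewrite subr_gt0 expr_lt1// ltW. Qed.

(* The Joukowski variable [r] of the point [zeta] outside the support. *)
Definition zeta : R := (r + r^-1) / 2.
(** This is [z / sqrt (z^2 - 1)] at [z = zeta]: the [k] for which [z^2 - x^2] equals
    [(z^2 - 1) (k^2 + t^2) / (1 + t^2)] under [x = xt t]. *)
Definition kappa : R := (1 + r ^+ 2) / (1 - r ^+ 2).

Let kappa_gt0 : 0 < kappa.
Proof. by rewrite divr_gt0// ltr_pwDl// sqr_ge0. Qed.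

Let al := l + kappa * a.

Let al_gt0 : 0 < al. Proof. by rewrite /al ltr_wpDr// mulr_ge0// ltW. Qed.

Let D h := 1 - r ^+ 2 * expR (- h).
Let X h := (1 - expR (- h)) / D h.

Let D_ge h : 0 <= h -> 1 - r ^+ 2 <= D h.
Proof.
move=> h0; rewrite /D lerB// ler_piMr ?sqr_ge0// -[leRHS]expR0 ler_expR.
by rewrite oppr_le0.
Qed.

Let D_gt0 h : 0 <= h -> 0 < D h.
Proof. by move=> h0; apply: lt_le_trans (D_ge h0). Qed.

Let X_ge0 h : 0 <= h -> 0 <= X h.
Proof.
move=> h0; rewrite divr_ge0 ?(ltW (D_gt0 h0))// subr_ge0 -[leRHS]expR0 ler_expR.
by rewrite oppr_le0.
Qed.

Let X_le1 h : 0 <= h -> X h <= 1.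
Proof.
move=> h0; rewrite ler_pdivrMr ?D_gt0// mul1r /D lerB// ler_piMl ?expR_ge0//.
by rewrite expr_le1// ltW.
Qed.

(** With [s = e^(-h)] and [A = l + kappa a] this is Euler's hypergeometric integrand [s^(A - 1) (1 -
    s)^n (1 - r^2 s)^(- n - 2 l) ds]. The quotient [X = (1 - s) / (1 - r^2 s)] stays in [[0, 1]],
    and its derivative in [h] is a polynomial in [X]. *)
Definition second_kind_fun n h := expR (- ((l + kappa * a) * h)) *
  ((1 - expR (- h)) / (1 - r ^+ 2 * expR (- h))) ^+ n *
  (1 - r ^+ 2 * expR (- h)) `^ (- (2 * l)).

Let f n h := expR (- (al * h)) * X h ^+ n * D h `^ (- (2 * l)).

Let fE n h : second_kind_fun n h = f n h. Proof. by []. Qed.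

Let Dpow_le h : 0 <= h -> D h `^ (- (2 * l)) <= (1 - r ^+ 2) `^ (- (2 * l)).
Proof.
move=> h0; rewrite !powRN lef_pV2 ?posrE ?powR_gt0 ?D_gt0//.
by rewrite ge0_ler_powR ?nnegrE ?mulr_ge0 ?(ltW l0) ?(ltW r2) ?(ltW (D_gt0 h0)) ?D_ge.
Qed.

Let f_ge0 n h : 0 <= h -> 0 <= f n h.
Proof. by move=> h0; rewrite !mulr_ge0 ?expR_ge0 ?powR_ge0 ?exprn_ge0 ?X_ge0. Qed.

Let f_le n h : 0 <= h -> f n h <= (1 - r ^+ 2) `^ (- (2 * l)) * expR (- (al * h)).
Proof.
move=> h0; rewrite /f mulrC; apply: ler_pM; rewrite ?powR_ge0 ?Dpow_le//.
  by rewrite mulr_ge0 ?expR_ge0 ?exprn_ge0 ?X_ge0.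
by rewrite ler_piMr ?expR_ge0// exprn_ile1 ?X_ge0 ?X_le1.
Qed.

Lemma exp_half_line_itg b : 0 < b -> itg (fun h => \1_`]0, +oo[ h * expR (- (b * h))).
Proof.
move=> b0; apply: itg_le (itgZ (4 / b) (logistic_itg b0)).
  apply: measurable_funM; first by apply: measurable_indic; exact: measurable_itv.
  by apply: continuous_measurable_fun; contd.
move=> h; rewrite indicE mem_setE in_itv/= andbT; have [h0|h0] := ltP 0 h; last first.
  rewrite mul0r normr0 !mulr_ge0 ?invr_ge0 ?expR_ge0 ?exprn_ge0 ?addr_ge0 ?expR_ge0//; exact: ltW.
rewrite mul1r ger0_norm ?expR_ge0// expRN.
have e0 := expR_gt0 (b * h); have e1 : 1 <= expR (b * h).
  by rewrite -[leLHS]expR0 ler_expR mulr_ge0// ltW.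
move: (expR (b * h)) e0 e1 => e e0 e1.
have -> : 4 / b * (e / (1 + e) ^+ 2 * b) = 4 * e / (1 + e) ^+ 2.
  by field; rewrite !gt_eqF// addr_gt0.
rewrite ler_pdivlMr ?exprn_gt0 ?addr_gt0// mulrC ler_pdivrMr//.
have : 0 <= (e - 1) * (3 * e + 1) by apply: mulr_ge0; lra.
by nra.
Qed.

Let f_continuous n h : 0 <= h -> {for h, continuous (f n)}.
Proof.
move=> h0; rewrite /f /X /D; eapply is_derive_continuous; der.
- by rewrite gt_eqF// D_gt0.
- exact: D_gt0.
Qed.

Let indf_measurable n : measurable_fun setT (fun h => \1_`]0, +oo[ h * f n h).
Proof.
rewrite (_ : (fun h => _) = f n \_ `]0, +oo[); last first.
  by apply/funext => h; rewrite patchE indicE; case: ifP; rewrite ?mul1r ?mul0r.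
have mI : measurable (`]0, +oo[%classic : set R) by exact: measurable_itv.
apply: (proj1 (measurable_restrictT (f n) mI)).
apply: subspace_continuous_measurable_fun; first exact: measurable_itv.
apply: continuous_in_subspaceT => h; rewrite inE/= in_itv/= andbT => /ltW; exact: f_continuous.
Qed.

Lemma second_kind_fun_itg n : itg (fun h => \1_`]0, +oo[ h * second_kind_fun n h).
Proof.
apply: itg_le (itgZ ((1 - r ^+ 2) `^ (- (2 * l))) (exp_half_line_itg al_gt0)).
  exact: indf_measurable.
move=> h; rewrite indicE mem_setE in_itv/= andbT fE; have [h0|h0] := ltP 0 h; last first.
  by rewrite !mul0r normr0 mulr0.
by rewrite !mul1r ger0_norm ?f_ge0 ?(ltW h0)// f_le// ltW.
Qed.

Definition second_kind_int n := RInt (fun h => \1_`]0, +oo[ h * second_kind_fun n h).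

Local Notation II := second_kind_int.

Lemma second_kind_int_ge0 n : 0 <= II n.
Proof.
apply: int_ge0 => h; rewrite indicE mem_setE in_itv/= andbT fE.
by have [h0|h0] := ltP 0 h; rewrite ?mul0r// mul1r f_ge0// ltW.
Qed.

Lemma second_kind_int_le n :
  II n <= (1 - r ^+ 2) `^ (- (2 * l)) * RInt (fun h => \1_`]0, +oo[ h * expR (- (al * h))).
Proof.
rewrite -intZ; last exact: exp_half_line_itg.
apply: int_le; [exact: second_kind_fun_itg|exact/itgZ/exp_half_line_itg|] => h.
rewrite indicE mem_setE in_itv/= andbT fE; have [h0|h0] := ltP 0 h; last by rewrite !mul0r mulr0.
by rewrite !mul1r f_le// ltW.
Qed.

Let dX h : 0 <= h -> is_derive h 1 X (expR (- h) * (1 - r ^+ 2) / D h ^+ 2).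
Proof.
move=> h0; have Dn : D h != 0 by rewrite gt_eqF// D_gt0.
rewrite /X /D; derc; first exact: Dn.
by move: Dn; rewrite /D => Dn; field.
Qed.

(* The exact derivative behind the three-term recurrence of the functions of the second kind. *)
Let g n h := - (al * (1 - r ^+ 2)) * f n.+1 h +
  (n.+1%:R * (f n h - (1 + r ^+ 2) * f n.+1 h + r ^+ 2 * f n.+2 h)
   - 2 * l * r ^+ 2 * (f n.+1 h - f n.+2 h)).

Let dF n h : 0 <= h -> is_derive h 1 (fun h => (1 - r ^+ 2) * f n.+1 h) (g n h).
Proof.
move=> h0; have Dn : D h != 0 by rewrite gt_eqF// D_gt0.
have d1 := dX h0.
have dD : is_derive h 1 D (r ^+ 2 * expR (- h)) by rewrite /D; derc; ring.
rewrite /f; eapply is_derive_eq; first by der; [exact: d1|exact: D_gt0|exact: dD].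
cbv beta; rewrite /g /f.
have -> : D h `^ (- (2 * l) - 1) = D h `^ (- (2 * l)) / D h.
  by rewrite powRD ?powR_inv1 ?(ltW (D_gt0 h0))// Dn implybT.
have rn : 1 - r ^+ 2 != 0 by rewrite gt_eqF.
have e1 : expR (- h) / D h = (1 - X h) / (1 - r ^+ 2).
  by rewrite /X; move: Dn; rewrite /D => Dn; field; rewrite Dn rn.
have e2 : (D h)^-1 = (1 - r ^+ 2 * X h) / (1 - r ^+ 2).
  by rewrite /X; move: Dn; rewrite /D => Dn; field; rewrite Dn rn.
rewrite -[n.+1.-1]/n !(exprS (X h)).
have -> : expR (- h) * (1 - r ^+ 2) / D h ^+ 2 = (1 - X h) * (1 - r ^+ 2 * X h) / (1 - r ^+ 2).
  rewrite expr2 invfM; transitivity ((expR (- h) / D h) * (1 - r ^+ 2) * (D h)^-1); first by ring.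
  by rewrite e1 e2; field.
have -> : - (2 * l) * (D h `^ (- (2 * l)) / D h) * (r ^+ 2 * expR (- h)) =
   - (2 * l) * D h `^ (- (2 * l)) * r ^+ 2 * (expR (- h) / D h) by ring.
rewrite e1.
move: (X h) (D h `^ _) (expR (- (al * h))) (X h ^+ n) => x d e xn.
by field.
Qed.

Let cvg_f n : f n m%:R @[m --> \oo] --> (0 : R).
Proof.
have h1 : (1 - r ^+ 2) `^ (- (2 * l)) * expR (- (al * m%:R)) @[m --> \oo] --> (0 : R).
  rewrite -[X in _ --> X](mulr0 ((1 - r ^+ 2) `^ (- (2 * l)))); apply: cvgMr.
  have q1 : `|expR (- al)| < 1.
    by rewrite gtr0_norm ?expR_gt0// -[ltRHS]expR0 ltr_expR oppr_lt0.
  have := cvg_expr q1; apply: cvg_trans; apply: near_eq_cvg; apply: nearW => m.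
  by rewrite -expRM_natl mulrN mulrC.
apply: squeeze_cvgr h1; last exact: cvg_cst.
by apply: nearW => m; rewrite f_ge0 ?f_le.
Qed.

Let int_g n :
  RInt (fun h => \1_`]0, +oo[ h * g n h) = - (al * (1 - r ^+ 2)) * II n.+1 +
  (n.+1%:R * (II n - (1 + r ^+ 2) * II n.+1 + r ^+ 2 * II n.+2)
   - 2 * l * r ^+ 2 * (II n.+1 - II n.+2)) /\ itg (fun h => \1_`]0, +oo[ h * g n h).
Proof.
pose j n h := \1_`]0, +oo[ h * f n h.
have ij m : itg (j m) by exact: second_kind_fun_itg.
have e : (fun h => \1_`]0, +oo[ h * g n h) = (fun h => - (al * (1 - r ^+ 2)) * j n.+1 h +
  (n.+1%:R * (j n h - (1 + r ^+ 2) * j n.+1 h + r ^+ 2 * j n.+2 h)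
   - 2 * l * r ^+ 2 * (j n.+1 h - j n.+2 h))).
  by apply/funext => h; rewrite /g /j; ring.
have i1 : itg (fun h => j n h - (1 + r ^+ 2) * j n.+1 h + r ^+ 2 * j n.+2 h).
  by apply: itgD; [apply: itgB => //|]; exact: itgZ.
have i2 : itg (fun h => j n.+1 h - j n.+2 h) by apply: itgB.
have i3 := itgZ (2 * l * r ^+ 2) i2.
have i4 := itgZ n.+1%:R i1.
have i5 := itgB i4 i3.
have i6 := itgZ (- (al * (1 - r ^+ 2))) (ij n.+1).
rewrite e; split; last exact: itgD.
rewrite (intD i6 i5) (intZ _ (ij _)) (intB i4 i3) (intZ _ i1) (intZ _ i2) (intB (ij _) (ij _)).
rewrite intD; [|by apply: itgB => //; exact: itgZ|exact: itgZ].
rewrite (intZ _ (ij n.+2)) intB; [|exact: ij|exact: itgZ].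
by rewrite (intZ _ (ij n.+1)).
Qed.

Let al_r : al * (1 - r ^+ 2) = l * (1 - r ^+ 2) + a * (1 + r ^+ 2).
Proof. by rewrite /al /kappa; field; rewrite gt_eqF. Qed.

(** [(1 - r^2) f n.+1] vanishes at infinity and at 0, where [X] is 0, so its derivative integrates
    to 0. By [al_r] the coefficient of [II n.+1] becomes proportional to [1 + r^2 = 2 r zeta], the
    spectral variable. *)
Lemma second_kind_recS n :
  (n.+1%:R + c) * (1 + r ^+ 2) * II n.+1 = n.+1%:R * II n + (n.+1%:R + 2 * l) * r ^+ 2 * II n.+2.
Proof.
have [e ig] := int_g n.
have := int_derive_pos (@dF n) _ ig _.
have cg h : 0 <= h -> {for h, continuous (g n)}.
  move=> h0; rewrite /g /f /X /D; eapply is_derive_continuous; der;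
    (exact: D_gt0 || by rewrite gt_eqF// D_gt0).
have lim : (1 - r ^+ 2) * f n.+1 m%:R @[m --> \oo] --> (0 : R).
  by rewrite -[X in _ --> X](mulr0 (1 - r ^+ 2)); apply: cvgMr; exact: cvg_f.
have F0 : (1 - r ^+ 2) * f n.+1 0 = 0.
  by rewrite /f /X oppr0 expR0 subrr mul0r expr0n/= mulr0 mul0r mulr0.
move=> /(_ 0 cg lim); rewrite e F0 subr0 al_r /c.
move: (II n) (II n.+1) (II n.+2) (n.+1%:R : R) => x y z N.
by move=> h; lra.
Qed.

Let g0 h := - al * f 0 h - 2 * l * r ^+ 2 / (1 - r ^+ 2) * (f 0 h - f 1 h).

Let dF0 h : 0 <= h -> is_derive h 1 (f 0) (g0 h).
Proof.
move=> h0; have Dn : D h != 0 by rewrite gt_eqF// D_gt0.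
have dD : is_derive h 1 D (r ^+ 2 * expR (- h)) by rewrite /D; derc; ring.
rewrite (_ : f 0 = fun h => expR (- (al * h)) * D h `^ (- (2 * l))); last first.
  by apply/funext => u; rewrite /f expr0 mulr1.
eapply is_derive_eq; first by der; [exact: D_gt0|exact: dD].
cbv beta; rewrite /g0 /f.
have -> : D h `^ (- (2 * l) - 1) = D h `^ (- (2 * l)) / D h.
  by rewrite powRD ?powR_inv1 ?(ltW (D_gt0 h0))// Dn implybT.
have rn : 1 - r ^+ 2 != 0 by rewrite gt_eqF.
have e1 : expR (- h) / D h = (1 - X h) / (1 - r ^+ 2).
  by rewrite /X; move: Dn; rewrite /D => Dn; field; rewrite Dn rn.
have -> : - (2 * l) * (D h `^ (- (2 * l)) / D h) * (r ^+ 2 * expR (- h)) =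
   - (2 * l) * D h `^ (- (2 * l)) * r ^+ 2 * (expR (- h) / D h) by ring.
rewrite e1 expr0 expr1.
move: (X h) (D h `^ _) (expR (- (al * h))) => x d e.
by field.
Qed.

(** For [n = 0] no power of [X] kills the boundary value [(1 - r^2)^(- 2 l)] at 0: it is the
    inhomogeneous term, normalised to 1 in [second_kind_rec_first]. *)
Lemma second_kind_rec0 :
  c * (1 + r ^+ 2) * II 0 = 2 * l * r ^+ 2 * II 1 + (1 - r ^+ 2) * (1 - r ^+ 2) `^ (- (2 * l)).
Proof.
pose j n h := \1_`]0, +oo[ h * f n h.
have ij m : itg (j m) by exact: second_kind_fun_itg.
have e : (fun h => \1_`]0, +oo[ h * g0 h) =
    (fun h => - al * j 0 h - 2 * l * r ^+ 2 / (1 - r ^+ 2) * (j 0 h - j 1 h)).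
  by apply/funext => h; rewrite /g0 /j; ring.
have i2 : itg (fun h => j 0 h - j 1 h) by apply: itgB.
have i3 := itgZ (2 * l * r ^+ 2 / (1 - r ^+ 2)) i2.
have i6 := itgZ (- al) (ij 0).
have ig : itg (fun h => \1_`]0, +oo[ h * g0 h) by rewrite e; exact: itgB.
have cg h : 0 <= h -> {for h, continuous g0}.
  move=> h0; rewrite /g0 /f /X /D; eapply is_derive_continuous; der;
    (exact: D_gt0 || by rewrite gt_eqF// D_gt0).
have F0 : f 0 0 = (1 - r ^+ 2) `^ (- (2 * l)).
  by rewrite /f /D mulr0 oppr0 expR0 expr0 !mulr1 mul1r.
have := int_derive_pos dF0 cg ig (@cvg_f 0).
rewrite F0 e (intB i6 i3) (intZ _ (ij 0)) (intZ _ i2) (intB (ij 0) (ij 1)).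
have := al_r; rewrite -[RInt (j 0)]/(II 0) -[RInt (j 1)]/(II 1) /c.
move: r2 => /lt0r_neq0 rn.
move: (II 0) (II 1) (_ `^ _) al => x y P A hA h.
have -> : P = A * x + 2 * l * r ^+ 2 / (1 - r ^+ 2) * (x - y) by lra.
have -> : (l + a) * (1 + r ^+ 2) = A * (1 - r ^+ 2) + 2 * l * r ^+ 2 by rewrite hA; ring.
by field.
Qed.

(** The quotient [(2 l)_n / (2^n (l + a)_n)] of Pochhammer symbols. With the factor [r^n] it turns
    [second_kind_recS] into the recurrence of the monic polynomials, with the same [alpha]. *)
Fixpoint second_kind_coef n : R :=
  if n is m.+1 then second_kind_coef m * ((m%:R + 2 * l) / (2 * (m%:R + (l + a)))) else 1.

Definition second_kind n : R :=
  2 * (l + a) * r * (1 - r ^+ 2) `^ (2 * l) / (1 - r ^+ 2) * second_kind_coef n * r ^+ n * II n.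

Lemma zeta_gt1 : 1 < zeta.
Proof.
have r10 : r != 0 by rewrite gt_eqF.
rewrite -subr_gt0 (_ : zeta - 1 = (1 - r) ^+ 2 / (2 * r)); last first.
  by rewrite /zeta; field.
by rewrite divr_gt0 ?exprn_gt0 ?mulr_gt0// subr_gt0.
Qed.

Lemma second_kind_rec n :
  zeta * second_kind n.+1 = second_kind n.+2 + alpha n.+1 * second_kind n.
Proof.
have h := second_kind_recS n.
rewrite /second_kind /alpha /zeta /=; move: h.
have n0 : n.+1%:R + (l + a) != 0 :> R by rewrite gt_eqF// ltr_wpDl.
have n1 : n%:R + (l + a) != 0 :> R by rewrite gt_eqF// ltr_wpDl.
have rn := lt0r_neq0 r2; have r10 : r != 0 by rewrite gt_eqF.
rewrite /c -[n.+1%:R]natr1 in n0 *; rewrite !(exprS r n.+1) !(exprS r n).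
move: (II n) (II n.+1) (II n.+2) (n%:R : R) (second_kind_coef n) (r ^+ n) (_ `^ _) n0 n1.
move=> x y z N m rn' P n0 n1 h.
have -> : y = ((N + 1) * x + (N + 1 + 2 * l) * r ^+ 2 * z) / ((N + 1 + (l + a)) * (1 + r ^+ 2)).
  by rewrite -h [_ * y]mulrC mulfK// mulf_neq0// gt_eqF// ltr_pwDl// sqr_ge0.
field.
rewrite rn n0 r10 andbT/= (_ : N + 1 + (l + a) - 1 = N + (l + a)); last by ring.
by rewrite n1 gt_eqF// ltr_pwDl// sqr_ge0.
Qed.

Lemma second_kind_rec_first : zeta * second_kind 0 = second_kind 1 + 1.
Proof.
have h := second_kind_rec0.
have rn := lt0r_neq0 r2; have r10 : r != 0 by rewrite gt_eqF.
have cn := lt0r_neq0 c_gt0.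
have p0 : (1 - r ^+ 2) `^ (2 * l) != 0 by rewrite gt_eqF// powR_gt0.
rewrite /second_kind /zeta /= expr0 expr1; move: h; rewrite powRN /c in cn *.
move: (II 0) (II 1) (_ `^ _) p0 => x y P p0 h.
have -> : x = (2 * l * r ^+ 2 * y + (1 - r ^+ 2) * P^-1) / ((l + a) * (1 + r ^+ 2)).
  by rewrite -h [_ * x]mulrC mulfK// mulf_neq0// gt_eqF// ltr_pwDl// sqr_ge0.
field.
by rewrite p0 cn r10 rn/= gt_eqF// ltr_pwDl// sqr_ge0.
Qed.

End Rho.

End SecondKind.

(** * Orthogonality *)

Section Orthogonality.
Context {R : realType}.
Implicit Types (f g F : R -> R) (x y b c d h t u r : R) (p q : {poly R}).

Local Notation mu := (@lebesgue_measure R).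

Lemma is_derive_horner p f x d : is_derive x 1 f d ->
  is_derive x 1 (fun t => p.[f t]) ((deriv p).[f x] * d).
Proof.
by move=> fd; apply: (@is_derive_chain _ (horner p)); exact: is_derive_poly.
Qed.

Definition coef_norm p : R := \sum_(i < size p) `|p`_i|.

Lemma coef_norm_ge0 p : 0 <= coef_norm p.
Proof. by apply: sumr_ge0. Qed.

Lemma horner_le p x : `|x| <= 1 -> `|p.[x]| <= coef_norm p.
Proof.
move=> x1; rewrite horner_coef; apply: le_trans (ler_norm_sum _ _ _) _.
apply: ler_sum => i _; rewrite normrM ler_piMr// normrX exprn_ile1//.
Qed.

Lemma horner_xt_le p t : `|p.[xt t]| <= coef_norm p.
Proof. by apply: horner_le; exact/ltW/xt_lt1. Qed.

Lemma horner_xt_continuous p : continuous (fun t => p.[xt t]).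
Proof.
by move=> t; apply: is_derive_continuous (is_derive_horner p (xt_derive t)).
Qed.

Section Functional.
Variables (l a : R).
Hypotheses (l0 : 0 < l) (a0 : 0 <= a).

Local Notation W := (W l a).
Local Notation alpha := (alpha l a).
Local Notation monic_pol := (monic_pol l a).

Lemma itg_W f (M : R) : continuous f -> (forall t, `|f t| <= M) -> itg (fun t => f t * W t).
Proof.
move=> cf fM; apply: itg_le (itgZ M (W_itg l0 a0)).
  apply: continuous_measurable_fun => t.
  by apply: (@continuousM R R f W); [exact: cf|exact: W_continuous].
move=> t; rewrite normrM (gtr0_norm (W_gt0 l0 a0 t)) ler_wpM2r//.
exact/ltW/W_gt0.
Qed.

Lemma horner_W_itg p : itg (fun t => p.[xt t] * W t).
Proof.
have c := @horner_xt_continuous p.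
exact: (@itg_W (fun t => p.[xt t]) _ c (horner_xt_le p)).
Qed.

Definition Lp p : R := RInt (fun t => p.[xt t] * W t).

Lemma LpD p q : Lp (p + q) = Lp p + Lp q.
Proof.
rewrite /Lp -intD; [|exact: horner_W_itg|exact: horner_W_itg].
by congr RInt; apply/funext => t; rewrite hornerD; ring.
Qed.

Lemma LpZ k p : Lp (k *: p) = k * Lp p.
Proof.
rewrite /Lp -intZ; last exact: horner_W_itg.
by congr RInt; apply/funext => t; rewrite hornerZ; ring.
Qed.

Lemma LpB p q : Lp (p - q) = Lp p - Lp q.
Proof. by rewrite LpD -scaleN1r LpZ mulN1r. Qed.

Section Zeta.
Variable z : R.
Hypothesis z1 : 1 < z.

Let zx t : 0 < z - xt t.
Proof.
by rewrite subr_gt0 (le_lt_trans _ z1)// (le_trans (ler_norm _))// ltW// xt_lt1.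
Qed.

Let zx_le t : (z - xt t)^-1 <= (z - 1)^-1.
Proof.
rewrite lef_pV2 ?posrE ?subr_gt0// ?lerB//.
  by rewrite (le_trans (ler_norm _))// ltW// xt_lt1.
by rewrite -subr_gt0; exact: zx.
Qed.

Lemma zx_inv_continuous : continuous (fun t => (z - xt t)^-1).
Proof.
move=> t; have d := xt_derive t.
by eapply is_derive_continuous; der; [rewrite gt_eqF|exact: d].
Qed.

Lemma horner_resolvent_le p t : `|p.[xt t] / (z - xt t)| <= coef_norm p * (z - 1)^-1.
Proof.
rewrite normrM ler_pM ?horner_xt_le// gtr0_norm ?invr_gt0//.
Qed.

Lemma horner_resolvent_itg p : itg (fun t => p.[xt t] / (z - xt t) * W t).
Proof.
apply: (@itg_W (fun t => p.[xt t] / (z - xt t)) _ _ (horner_resolvent_le p)) => t.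
apply: (@continuousM R R (fun t => p.[xt t]) (fun t => (z - xt t)^-1)).
  exact: horner_xt_continuous.
exact: zx_inv_continuous.
Qed.

Definition resolvent_moment p := RInt (fun t => p.[xt t] / (z - xt t) * W t).

Lemma resolvent_momentD p q :
  resolvent_moment (p + q) = resolvent_moment p + resolvent_moment q.
Proof.
rewrite /resolvent_moment -intD; [|exact: horner_resolvent_itg|exact: horner_resolvent_itg].
by congr RInt; apply/funext => t; rewrite hornerD; ring.
Qed.

Lemma resolvent_momentZ k p : resolvent_moment (k *: p) = k * resolvent_moment p.
Proof.
rewrite /resolvent_moment -intZ; last exact: horner_resolvent_itg.
by congr RInt; apply/funext => t; rewrite hornerZ; ring.
Qed.

Lemma resolvent_momentX p : resolvent_moment ('X * p) = z * resolvent_moment p - Lp p.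
Proof.
rewrite /resolvent_moment /Lp -intZ; last exact: horner_resolvent_itg.
rewrite -intB; [|exact/itgZ/horner_resolvent_itg|exact: horner_W_itg].
congr RInt; apply/funext => t; rewrite hornerM hornerX.
by have := gt_eqF (zx t) => e; field; rewrite e.
Qed.

Lemma resolvent_moment_le p : `|resolvent_moment p| <= coef_norm p * (z - 1)^-1 * RInt W.
Proof.
rewrite -intZ; last exact: W_itg.
apply: int_norm_le; [exact: horner_resolvent_itg|exact/itgZ/W_itg|] => t.
rewrite normrM (gtr0_norm (W_gt0 l0 a0 t)) ler_wpM2r ?horner_resolvent_le//.
exact/ltW/W_gt0.
Qed.

End Zeta.

Section Rho.
Variable r : R.
Hypotheses (r0 : 0 < r) (r1 : r < 1).

Let z1 : 1 < zeta r. Proof. exact: zeta_gt1. Qed.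

Let r2 : 0 < 1 - r ^+ 2. Proof. by rewrite subr_gt0 expr_lt1// ltW. Qed.

(** The weight being even, only the part [z / (z^2 - x^2)] of the resolvent counts. In [t] it is a
    multiple of [(1 + t^2) / (kappa^2 + t^2)], whose numerator cancels the [cauchy] in [W], so
    [transform_half_line] applies; the base there is [2 / (1 - r^2)] times [1 - r^2 e^(-h)]. *)
Lemma resolvent_moment1 : resolvent_moment (zeta r) 1 = second_kind l a r 0.
Proof.
have k0 : 0 < kappa r by rewrite divr_gt0// ltr_pwDl// sqr_ge0.
have [e i3] := transform_half_line l0 a0 k0.
have rn := lt0r_neq0 r2; have r10 : r != 0 by rewrite gt_eqF.
have rp : 1 + r ^+ 2 != 0 by rewrite gt_eqF// ltr_pwDl// sqr_ge0.
pose z := zeta r.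
have z0 : 0 <= z by apply/ltW/(lt_trans ltr01).
have z2 : 1 < z ^+ 2 by rewrite expr_gt1.
have den t : 0 < z ^+ 2 - xt t ^+ 2.
  rewrite subr_gt0 (lt_trans _ z2)// -real_normK ?num_real// expr_lt1//.
  exact: xt_lt1.
pose A t := (z ^+ 2 - xt t ^+ 2)^-1.
have cA : continuous A.
  move=> t; have d := xt_derive t; rewrite /A.
  by eapply is_derive_continuous; der; [rewrite gt_eqF|exact: d].
have A_le t : `|A t| <= (z ^+ 2 - 1)^-1.
  rewrite gtr0_norm ?invr_gt0// lef_pV2 ?posrE ?subr_gt0//; last by rewrite -subr_gt0.
  by rewrite lerB// -subr_ge0 sub1_xt_sqr ltW// cauchy_gt0.
have iA : itg (fun t => A t * W t) := itg_W cA A_le.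
have cxA : continuous (fun t => xt t * A t).
  move=> t; apply: (@continuousM R R xt A); last exact: cA.
  exact: xt_continuous.
have xA_le t : `|xt t * A t| <= (z ^+ 2 - 1)^-1.
  rewrite normrM -[leRHS]mul1r ler_pM//; exact/ltW/xt_lt1.
have ixA : itg (fun t => (xt t * A t) * W t) := itg_W cxA xA_le.
have xtN t : xt (- t) = - xt t by rewrite /xt sqrrN mulNr.
have odd0 : RInt (fun t => (xt t * A t) * W t) = 0.
  apply: int_odd ixA.
    move=> t; apply: (@continuousM R R (fun t => xt t * A t) W); first exact: cxA.
    exact: W_continuous.
  by move=> t; rewrite /A xtN sqrrN W_even// !mulNr.
rewrite /resolvent_moment (_ : (fun t => _) = fun t => z * (A t * W t) + (xt t * A t) * W t); last first.
  apply/funext => t; rewrite hornerC /A.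
  have := gt_eqF (den t); have : z - xt t != 0.
    rewrite gt_eqF// subr_gt0 (le_lt_trans _ z1)// (le_trans (ler_norm _))// ltW//.
    exact: xt_lt1.
  by rewrite -/z => h1 h2; field; rewrite h1 h2.
rewrite intD ?odd0 ?addr0; [|exact: itgZ|exact: ixA].
rewrite (intZ _ iA).
have zn : z ^+ 2 - 1 != 0 by rewrite gt_eqF// subr_gt0.
have kz : kappa r ^+ 2 * (z ^+ 2 - 1) = z ^+ 2.
  by rewrite /kappa /z /zeta; field; rewrite r10 rn.
have wn := lt0r_neq0 (wconst_gt0 l0 a0).
have eA t : A t * W t = wconst l a / (z ^+ 2 - 1) *
    ((Fc l a t ^+ 2 + Fs l a t ^+ 2) / (kappa r ^+ 2 + t ^+ 2)).
  rewrite W_FcFs /A xt_sqr /cauchy; have tn := sqrD1_neq0 t.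
  move: (den t) => /lt0r_neq0; rewrite xt_sqr /cauchy => dn.
  have kn : kappa r ^+ 2 + t ^+ 2 != 0.
    by rewrite gt_eqF// ltr_pwDl ?sqr_ge0// exprn_gt0.
  have -> : kappa r ^+ 2 + t ^+ 2 = (1 + t ^+ 2) * (z ^+ 2 - t ^+ 2 / (1 + t ^+ 2)) / (z ^+ 2 - 1).
    apply: (mulIf zn); rewrite divfK// mulrDl kz; field; rewrite tn//.
  move: (Fc l a t ^+ 2 + Fs l a t ^+ 2) (wconst l a) => S C.
  have dn' : z ^+ 2 * (1 + t ^+ 2) - t ^+ 2 != 0.
    rewrite (_ : _ - _ = (z ^+ 2 - t ^+ 2 * (1 + t ^+ 2)^-1) * (1 + t ^+ 2)); last by field.
    by rewrite mulf_neq0.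
  by field; rewrite zn tn.
have ik : itg (fun t => (Fc l a t ^+ 2 + Fs l a t ^+ 2) / (kappa r ^+ 2 + t ^+ 2)).
  move: iA => /(itgZ ((z ^+ 2 - 1) / wconst l a)); congr itg; apply/funext => t.
  rewrite eA; move: (_ / (kappa r ^+ 2 + _)) => S.
  by field; rewrite wn zn.
have -> : (fun t => A t * W t) = (fun t => wconst l a / (z ^+ 2 - 1) *
    ((Fc l a t ^+ 2 + Fs l a t ^+ 2) / (kappa r ^+ 2 + t ^+ 2))).
  by apply/funext => t; exact: eA.
rewrite (intZ _ ik) e.
have -> : RInt (fun h => \1_`]0, +oo[ h * (expR (- ((l + kappa r * a) * h)) *
    stieltjes_base (kappa r) h `^ (- (2 * l)))) =
  (2 / (1 - r ^+ 2)) `^ (- (2 * l)) * second_kind_int l a r 0.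
  rewrite -intZ; last exact: second_kind_fun_itg.
  congr RInt; apply/funext => h; rewrite indicE mem_setE in_itv/= andbT.
  have [h0|h0] := ltP 0 h; last by rewrite !mul0r mulr0.
  rewrite !mul1r /second_kind_fun expr0 mulr1.
  have -> : stieltjes_base (kappa r) h = 2 / (1 - r ^+ 2) * (1 - r ^+ 2 * expR (- h)).
    by rewrite /stieltjes_base /kappa; field.
  rewrite powRM ?divr_ge0 ?(ltW r2)//; first by ring.
  rewrite subr_ge0 mulr_ile1 ?sqr_ge0 ?expR_ge0 ?expr_le1 ?(ltW r0) ?(ltW r1)//.
  by rewrite -[leRHS]expR0 ler_expR oppr_le0 ltW.
rewrite /second_kind /= expr0 /wconst powRM ?invr_ge0 ?(ltW r2)// -[(1 - r ^+ 2)^-1]powR_inv1 ?(ltW r2)//.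
rewrite -powRrM mulN1r opprK powRN.
have g0 : gint (2 * l) != 0 by rewrite gt_eqF// gint_gt0// mulr_gt0.
have p0 : pi != 0 :> R by rewrite gt_eqF// pi_gt0.
have t0 : 2 `^ (2 * l) != 0 :> R by rewrite gt_eqF// powR_gt0.
rewrite /z /zeta /kappa powR_inv1 ?(ltW r2)//.
move: (second_kind_int l a r 0) (gint (2 * l)) (2 `^ (2 * l)) ((1 - r ^+ 2) `^ (2 * l)) pi g0 p0 t0.
move=> I0 G T Q P g0 p0 t0.
have qn : (r * r + 1) ^+ 2 + -1 * (r ^+ 2 * 4) != 0.
  by rewrite (_ : _ + _ = (1 - r ^+ 2) ^+ 2) ?expf_neq0//; ring.
by field; rewrite rn t0 rp r10 qn g0 p0.
Qed.

Lemma resolvent_moment_small p : r <= 2^-1 ->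
  `|resolvent_moment (zeta r) p| <= coef_norm p * 8 * RInt W * r.
Proof.
move=> r12; apply: le_trans (resolvent_moment_le z1 p) _.
have W0 : 0 <= RInt W by apply: int_ge0 => t; exact/ltW/W_gt0.
have -> : coef_norm p * 8 * RInt W * r = coef_norm p * (8 * r) * RInt W by ring.
rewrite ler_wpM2r// ler_wpM2l ?coef_norm_ge0//.
have r10 : r != 0 by rewrite gt_eqF.
have r1n : 0 < 1 - r by rewrite subr_gt0.
have -> : (zeta r - 1)^-1 = 2 * r / (1 - r) ^+ 2.
  rewrite /zeta; field; rewrite r10 gt_eqF//=.
  by rewrite (_ : _ + _ = (1 - r) ^+ 2) ?expf_neq0 ?gt_eqF//; ring.
rewrite ler_pdivrMr ?exprn_gt0//.
have : 4^-1 <= (1 - r) ^+ 2.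
  have h : 2^-1 <= 1 - r by move: r12; lra.
  have : 2^-1 * 2^-1 <= (1 - r) * (1 - r) by apply: ler_pM; rewrite ?invr_ge0.
  by rewrite -expr2; lra.
by move: ((1 - r) ^+ 2) => w hw; have := ler_wpM2l (ltW r0) hw; lra.
Qed.

Lemma second_kind_coef_ge0 n : 0 <= second_kind_coef l a n.
Proof.
elim: n => [|n IH] /=; first by [].
rewrite mulr_ge0// divr_ge0 ?addr_ge0 ?mulr_ge0 ?(ltW l0)//.
by rewrite addr_ge0// addr_ge0// ltW.
Qed.

Lemma second_kind_small n : r <= 2^-1 -> `|second_kind l a r n| <=
  4 * (l + a) * second_kind_coef l a n * RInt (fun h => \1_`]0, +oo[ h * expR (- (l * h))) * r.
Proof.
move=> r12; rewrite /second_kind.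
have m0 := second_kind_coef_ge0 n; have I0 := second_kind_int_ge0 l a r0 r1 n.
have I1 := second_kind_int_le l0 a0 r0 r1 n.
have ca : 0 <= l + a by rewrite addr_ge0// ltW.
have P0 := powR_gt0 (2 * l) r2.
have rn0 : 0 <= r ^+ n <= 1 by rewrite exprn_ge0 ?exprn_ile1 ?(ltW r0) ?(ltW r1).
rewrite ger0_norm; last by rewrite !mulr_ge0 ?invr_ge0 ?(ltW r0) ?(ltW P0) ?(ltW r2)//; case/andP: rn0.
have B1 : RInt (fun h => \1_`]0, +oo[ h * expR (- ((l + kappa r * a) * h))) <=
    RInt (fun h => \1_`]0, +oo[ h * expR (- (l * h))).
  have ka0 : 0 <= kappa r * a by rewrite mulr_ge0// divr_ge0 ?(ltW r2)// addr_ge0 ?sqr_ge0.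
  apply: int_le; [apply: exp_half_line_itg|exact: exp_half_line_itg|].
    by rewrite ltr_wpDr.
  move=> h; rewrite indicE mem_setE in_itv/= andbT; have [h0|h0] := ltP 0 h; last by rewrite !mul0r.
  by rewrite !mul1r ler_expR lerN2 ler_pM2r// lerDl.
have B0 : 0 <= RInt (fun h => \1_`]0, +oo[ h * expR (- (l * h))).
  by apply: int_ge0 => h; rewrite mulr_ge0 ?expR_ge0.
rewrite powRN in I1; set B := RInt _ in B0 B1 *.
have I2 : (1 - r ^+ 2) `^ (2 * l) * second_kind_int l a r n <= B.
  apply: le_trans B1; rewrite -ler_pdivlMl//.
have i34 : (1 - r ^+ 2)^-1 <= 2.
  rewrite -[2]invrK lef_pV2 ?posrE ?invr_gt0//.
  have : r ^+ 2 <= (2^-1) ^+ 2 by rewrite lerXn2r ?nnegrE ?(ltW r0).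
  by rewrite expr2; lra.
case/andP: rn0 => rn0 rn1.
have r2i : 0 < (1 - r ^+ 2)^-1 by rewrite invr_gt0.
move: (_ `^ _) (second_kind_int l a r n) (second_kind_coef l a n) (r ^+ n) ((1 - r ^+ 2)^-1) P0 I0 I2 m0 rn0 rn1 (ltW r2i) i34 => P II m x i P0 I0 I2 m0 rn0 rn1 i0 i34.
have -> : 2 * (l + a) * r * P * i * m * x * II = (2 * (l + a) * r * m) * (i * x * (P * II)) by ring.
have -> : 4 * (l + a) * m * B * r = (2 * (l + a) * r * m) * (2 * 1 * B) by ring.
rewrite ler_wpM2l ?mulr_ge0 ?(ltW r0)//.
by rewrite ler_pM ?mulr_ge0 ?(ltW P0)// ler_pM.
Qed.

End Rho.

Let dlt r n := resolvent_moment (zeta r) (monic_pol n) - second_kind l a r n.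

Let dlt_small n : exists2 C, 0 <= C & forall r, 0 < r -> r <= 2^-1 -> `|dlt r n| <= C * r.
Proof.
pose B := RInt (fun h => \1_`]0, +oo[ h * expR (- (l * h))).
exists (coef_norm (monic_pol n) * 8 * RInt W + 4 * (l + a) * second_kind_coef l a n * B).
  rewrite addr_ge0// !mulr_ge0 ?coef_norm_ge0 ?second_kind_coef_ge0//.
  - by apply: int_ge0 => t; exact/ltW/W_gt0.
  - by rewrite addr_ge0// ltW.
  - by apply: int_ge0 => h; rewrite mulr_ge0 ?expR_ge0.
move=> r r0 r12; have r1 : r < 1 by lra.
apply: le_trans (ler_normB _ _) _; rewrite mulrDl lerD//.
  exact: resolvent_moment_small.
exact: second_kind_small.
Qed.

(* The defect [dlt] between the transform of [monic_pol n] and the function of the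
   second kind obeys an inhomogeneous recurrence with source [Lp (monic_pol n)], and
   vanishes at infinity; so all the sources vanish. *)
Let const_small (k C : R) : 0 <= C -> (forall r, 0 < r -> r <= 2^-1 -> `|k| <= C * r) -> k = 0.
Proof.
move=> C0 h; apply/eqP; rewrite -normr_eq0; apply/negP => /negP k0.
have k1 : 0 < `|k| by rewrite lt_neqAle eq_sym k0 normr_ge0.
pose e := `|k| / (2 * (C + `|k| + 1)).
have d0 : 0 < 2 * (C + `|k| + 1) by lra.
have e0 : 0 < e by rewrite divr_gt0.
have e1 : e <= 2^-1 by rewrite ler_pdivrMr//; lra.
have := h e e0 e1; rewrite /e mulrA ler_pdivlMr// -subr_ge0.
move: `|k| k1 => x x0; nra.
Qed.

Lemma monic_dlt n : (forall r, 0 < r -> r <= 2^-1 -> dlt r n = 0 /\ dlt r n.+1 = 0) /\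
  Lp (monic_pol 0) = 1 /\ (forall k, (0 < k <= n)%N -> Lp (monic_pol k) = 0).
Proof.
elim: n => [|n [IH [L1 L0]]].
  have d0 r : 0 < r -> r <= 2^-1 -> dlt r 0 = 0.
    move=> r0 r12; have r1 : r < 1 by lra.
    by rewrite /dlt monic_pol0 resolvent_moment1// subrr.
  have d1 r : 0 < r -> r <= 2^-1 -> dlt r 1 = 1 - Lp (monic_pol 0).
    move=> r0 r12; have r1 : r < 1 by lra.
    have := d0 r r0 r12; rewrite /dlt => /subr0_eq e0.
    have := second_kind_rec_first l0 a0 r0 r1; rewrite -e0.
    have := resolvent_momentX (zeta_gt1 r0 r1) 1.
    rewrite monic_pol1 monic_pol0 mulr1 => ->.
    by move: (second_kind l a r 1) => y ->; ring.
  (* The normalisation of the weight is obtained here: total mass 1 follows from the inhomogeneous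
     term 1, without a separate integration. *)
  have L1 : 1 - Lp (monic_pol 0) = 0.
    have [C C0 hC] := dlt_small 1; apply: (const_small C0) => r r0 r12.
    by rewrite -(d1 r r0 r12); exact: hC.
  split; last by split; [move: L1; lra|case].
  by move=> r r0 r12; split; [exact: d0|rewrite d1].
have d2 r : 0 < r -> r <= 2^-1 -> dlt r n.+2 = - Lp (monic_pol n.+1).
  move=> r0 r12; have r1 : r < 1 by lra.
  have [] := IH r r0 r12; rewrite /dlt => /subr0_eq e0 /subr0_eq e1.
  have := second_kind_rec l0 a0 r0 r1 n; rewrite -e0 -e1.
  rewrite monic_polSS -scaleNr resolvent_momentD; last exact: zeta_gt1.
  rewrite resolvent_momentZ; last exact: zeta_gt1.
  rewrite resolvent_momentX; last exact: zeta_gt1.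
  by move: (second_kind l a r n.+2) => y; lra.
have L2 : - Lp (monic_pol n.+1) = 0.
  have [C C0 hC] := dlt_small n.+2; apply: (const_small C0) => r r0 r12.
  by rewrite -(d2 r r0 r12); exact: hC.
split.
  by move=> r r0 r12; split; [exact: (proj2 (IH r r0 r12))|rewrite d2].
split=> // k /andP[k0]; rewrite leq_eqVlt => /predU1P[->|kn].
  by move: L2; lra.
by apply: L0; rewrite k0.
Qed.

Lemma Lp_monic n : Lp (monic_pol n) = (n == 0)%:R.
Proof.
have [_ [L1 L0]] := monic_dlt n; case: n L0 => [|n] L0 //.
by rewrite L0/=.
Qed.

End Functional.

End Orthogonality.

(** * Orthonormal polynomials, their coefficients and derivatives *)

Section Algebra.
Context {R : realType}.
Implicit Types (f g F : R -> R) (x y b c d h t u r : R) (p q : {poly R}).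

Local Notation mu := (@lebesgue_measure R).

Variables (l a : R).
Hypotheses (l0 : 0 < l) (a0 : 0 <= a).

Local Notation W := (W l a).
Local Notation alpha := (alpha l a).
Local Notation monic_pol := (monic_pol l a).
Local Notation Lp := (Lp l a).

Lemma Lp0 : Lp 0 = 0.
Proof. by rewrite -(subrr 1) LpB// subrr. Qed.

Lemma Lp_sum (I : Type) (s : seq I) (P : pred I) (F : I -> {poly R}) :
  Lp (\sum_(i <- s | P i) F i) = \sum_(i <- s | P i) Lp (F i).
Proof.
elim: s => [|i s IH]; first by rewrite !big_nil Lp0.
by rewrite !big_cons; case: ifP => _ //; rewrite LpD// IH.
Qed.

Lemma alpha_gt0 n : 0 < alpha n.+1.
Proof.
rewrite /alpha -natr1; have n0 : 0 <= n%:R :> R by []; move: l0 a0 (n%:R) n0.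
by move=> l1 a1 x x0; rewrite divr_gt0// mulr_gt0//; lra.
Qed.

Lemma size_monic_pol n : size (monic_pol n) = n.+1 /\ monic_pol n \is monic.
Proof.
suff: (size (monic_pol n) = n.+1 /\ monic_pol n \is monic) /\
    (size (monic_pol n.+1) = n.+2 /\ monic_pol n.+1 \is monic) by case.
elim: n => [|n [IH1 IH2]].
  by rewrite monic_pol0 monic_pol1 size_poly1 monic1 size_polyX monicX.
split=> //; case: IH1 IH2 => s1 m1 [s2 m2].
have sX : size ('X * monic_pol n.+1) = n.+3.
  by rewrite mulrC size_mulX ?s2// -size_poly_eq0 s2.
have sB : (size (- (alpha n.+1 *: monic_pol n)) < size ('X * monic_pol n.+1)%R)%N.
  by rewrite size_polyN sX (leq_ltn_trans (size_scale_leq _ _))// s1.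
rewrite monic_polSS; split; first by rewrite size_polyDl.
by rewrite monicE lead_coefDl// -monicE monicMl ?monicX.
Qed.

Lemma mulX_monic_pol n :
  'X * monic_pol n.+1 = monic_pol n.+2 + alpha n.+1 *: monic_pol n.
Proof. by rewrite monic_polSS subrK. Qed.

(** [X^k] times [monic_pol n] only involves members of index at least [n - k > 0], all annihilated
    by [Lp]. The recurrence thus upgrades the vanishing of single moments to orthogonality. *)
Lemma Lp_Xn_monic_lt k n : (k < n)%N -> Lp ('X^k * monic_pol n) = 0.
Proof.
elim: k n => [|k IH] [|n] //; first by rewrite expr0 mul1r Lp_monic.
rewrite ltnS => kn; rewrite exprSr -mulrA mulX_monic_pol mulrDr LpD//.
by rewrite -scalerAr LpZ// !IH// ?mulr0 ?addr0// !ltnS ltnW// ltnS ltnW.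
Qed.

Definition sqnorm n : R := \prod_(k < n) alpha k.+1.

Lemma sqnormS n : sqnorm n.+1 = sqnorm n * alpha n.+1.
Proof. by rewrite /sqnorm big_ord_recr. Qed.

Lemma sqnorm_gt0 n : 0 < sqnorm n.
Proof. by apply: prodr_gt0 => i _; exact: alpha_gt0. Qed.

Lemma Lp_Xn_monic n : Lp ('X^n * monic_pol n) = sqnorm n.
Proof.
elim: n => [|n IH]; first by rewrite expr0 mul1r Lp_monic// /sqnorm big_ord0.
rewrite exprSr -mulrA mulX_monic_pol mulrDr LpD// -scalerAr LpZ// IH.
by rewrite Lp_Xn_monic_lt// add0r sqnormS mulrC.
Qed.

Lemma Lp_mul_monic p n : (size p <= n.+1)%N -> Lp (p * monic_pol n) = p`_n * sqnorm n.
Proof.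
move=> pn; have -> : p = \sum_(i < n.+1) p`_i *: 'X^i.
  rewrite -poly_def; apply/polyP => i; rewrite coef_poly; case: ltnP => // ni.
  by rewrite nth_default// (leq_trans pn).
rewrite mulr_suml Lp_sum big_ord_recr/= big1 ?add0r; last first.
  by move=> i _; rewrite -scalerAl LpZ// Lp_Xn_monic_lt ?mulr0.
rewrite -scalerAl LpZ// Lp_Xn_monic -poly_def coef_poly ltnSn//.
Qed.

Definition aa n : R := Num.sqrt (alpha n).

Definition onp n : {poly R} := (Num.sqrt (sqnorm n))^-1 *: monic_pol n.

Let s0 n : 0 < Num.sqrt (sqnorm n). Proof. by rewrite sqrtr_gt0 sqnorm_gt0. Qed.

Lemma aa_gt0 n : 0 < aa n.+1.
Proof. by rewrite sqrtr_gt0 alpha_gt0. Qed.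

Lemma sqr_aa n : aa n.+1 ^+ 2 = alpha n.+1.
Proof. by rewrite sqr_sqrtr// ltW// alpha_gt0. Qed.

Let sS n : Num.sqrt (sqnorm n.+1) = Num.sqrt (sqnorm n) * aa n.+1.
Proof. by rewrite sqnormS sqrtrM// ltW// sqnorm_gt0. Qed.

Lemma onp0 : onp 0 = 1.
Proof. by rewrite /onp /sqnorm big_ord0 sqrtr1 invr1 scale1r. Qed.

Lemma mulX_onp0 : 'X * onp 0 = aa 1 *: onp 1.
Proof.
rewrite onp0 mulr1 /onp scalerA sS /sqnorm big_ord0 sqrtr1 mul1r mulfV ?scale1r//.
by rewrite gt_eqF// aa_gt0.
Qed.

Lemma mulX_onp n : 'X * onp n.+1 = aa n.+2 *: onp n.+2 + aa n.+1 *: onp n.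
Proof.
rewrite /onp -scalerAr mulX_monic_pol scalerDr !scalerA !sS -sqr_aa.
have := gt_eqF (s0 n); have := gt_eqF (aa_gt0 n); have := gt_eqF (aa_gt0 n.+1).
move: (Num.sqrt _) (aa _) (aa _) => s A B B0 A0 sn.
by congr (_ *: _ + _ *: _); field; rewrite ?sn ?A0 ?B0.
Qed.

Lemma size_onp n : size (onp n) = n.+1.
Proof.
by rewrite size_scale ?invr_eq0 ?gt_eqF// (proj1 (size_monic_pol n)).
Qed.

Lemma lead_coef_onp_gt0 n : 0 < lead_coef (onp n).
Proof.
by rewrite lead_coefZ (monicP (proj2 (size_monic_pol n))) mulr1 invr_gt0.
Qed.

Lemma Lp_monic_onp p n : (size p <= n)%N -> Lp (p * onp n) = 0.
Proof.
move=> pn; rewrite -scalerAr LpZ// Lp_mul_monic ?(leq_trans pn)//.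
by rewrite nth_default// mul0r mulr0.
Qed.

Lemma Lp_onp n m : Lp (onp n * onp m) = (n == m)%:R.
Proof.
wlog nm : n m / (n <= m)%N.
  by case/orP: (leq_total n m) => nm h; [exact: h|rewrite mulrC eq_sym h].
move: nm; rewrite leq_eqVlt => /predU1P[->|nm]; last first.
  by rewrite Lp_monic_onp ?size_onp// ltn_eqF.
rewrite eqxx /onp -scalerAr LpZ// -scalerAl LpZ// Lp_mul_monic; last first.
  by rewrite (proj1 (size_monic_pol m)).
have /monicP := proj2 (size_monic_pol m).
rewrite lead_coefE (proj1 (size_monic_pol m)) /= => ->; rewrite mul1r.
rewrite -[X in _ * (_ * X)]sqr_sqrtr ?(ltW (sqnorm_gt0 m))//.
by have := gt_eqF (s0 m); move: (Num.sqrt _) => s sn; field; rewrite sn.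
Qed.

Lemma onp_expansion p N : (size p <= N)%N -> p = \sum_(k < N) Lp (p * onp k) *: onp k.
Proof.
elim: N p => [|N IH] p pN.
  by rewrite big_ord0; apply/eqP; rewrite -size_poly_eq0 -leqn0.
pose c := lead_coef (onp N); have c0 : 0 < c := lead_coef_onp_gt0 N.
pose q := p - (p`_N / c) *: onp N.
have qN : (size q <= N)%N.
  apply/leq_sizeP => j; rewrite leq_eqVlt => /predU1P[<-|Nj].
    rewrite coefB coefZ /c lead_coefE size_onp/= divfK ?subrr//.
    by move: c0; rewrite /c lead_coefE size_onp/= => /gt_eqF ->.
  rewrite coefB coefZ (nth_default 0 (leq_trans pN Nj)) (@nth_default _ _ (onp N)).
    by rewrite mulr0 subr0.
  by rewrite size_onp.
have e : p = q + (p`_N / c) *: onp N by rewrite subrK.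
have -> : \sum_(k < N.+1) Lp (p * onp k) *: onp k = q + (p`_N / c) *: onp N.
  rewrite big_ord_recr/=; congr (_ + _).
    rewrite [RHS](IH q qN); apply: eq_bigr => k _; congr (_ *: _).
    by rewrite e mulrDl LpD// -scalerAl LpZ// Lp_onp gtn_eqF// mulr0 addr0.
  congr (_ *: _).
  by rewrite e mulrDl LpD// -scalerAl LpZ// Lp_onp eqxx mulr1 Lp_monic_onp// add0r -e.
exact: e.
Qed.

(** The definition of orthonormality mentions no recurrence, so a given sequence must be identified
    with [onp]. By strong induction the components of [P n] along lower members vanish; the
    remaining factor has square 1, and is positive since both leading coefficients are. *)
Lemma orthonormal_unique (P : nat -> {poly R}) :
  orthonormal_polynomials (pollaczek_weight l a) P -> forall n, P n = onp n.
Proof.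
case=> sP lP oP.
have o n m : Lp (P n * P m) = (n == m)%:R.
  rewrite -oP; rewrite (@int_xt _ _ (fun t => (P n).[xt t] * (P m).[xt t] * (W t / xt' t))).
  - rewrite /Lp; congr RInt; apply/funext => t; rewrite hornerM.
    by rewrite -[RHS]mulrA divfK// gt_eqF// xt'_gt0.
  - move=> t; have cx := gt_eqF (xt'_gt0 t).
    have c1 := @horner_xt_continuous _ (P n) t; have c2 := @horner_xt_continuous _ (P m) t.
    apply: (@continuousM R R (fun t => (P n).[xt t] * (P m).[xt t]) (fun t => W t / xt' t)).
      exact: (@continuousM R R (fun t => (P n).[xt t]) (fun t => (P m).[xt t])).
    apply: (@continuousM R R W (fun t => (xt' t)^-1)); first exact: W_continuous.
    by apply: (@continuousV R R); [rewrite cx|exact: xt'_continuous].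
  - by move=> t; rewrite pollaczek_weight_xt.
move=> n; have [k] := ubnP n; elim: k n => // k IH n; rewrite ltnS => nk.
have e : P n = Lp (P n * onp n) *: onp n.
  rewrite {1}(@onp_expansion (P n) n.+1) ?sP// big_ord_recr/= big1 ?add0r// => i _.
  by rewrite -IH ?(leq_trans (ltn_ord i))// o gtn_eqF// scale0r.
move: (Lp _) e => c e.
have c1 : c ^+ 2 = 1.
  by have := o n n; rewrite e -scalerAr LpZ// -scalerAl LpZ// Lp_onp !eqxx mulr1 expr2.
have c0 : 0 < c.
  by have := lP n; rewrite e lead_coefZ pmulr_lgt0// lead_coef_onp_gt0.
have : c == 1 by rewrite -(@eqrXn2 _ 2)// ?(ltW c0)// expr1n c1.
by move=> /eqP c11; rewrite e c11 scale1r.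
Qed.

Lemma monic_pol_parity n x : (monic_pol n).[- x] = (-1) ^+ n * (monic_pol n).[x].
Proof.
suff: (monic_pol n).[- x] = (-1) ^+ n * (monic_pol n).[x] /\
  (monic_pol n.+1).[- x] = (-1) ^+ n.+1 * (monic_pol n.+1).[x] by case.
elim: n => [|n [IH1 IH2]].
  by rewrite monic_pol0 monic_pol1 !hornerC !hornerX expr0 expr1 mul1r mulN1r.
by split=> //; rewrite monic_polSS !(hornerD, hornerN, hornerM, hornerZ, hornerX) IH1 IH2 !exprS; ring.
Qed.

Lemma onp_sqr_even n x : (onp n).[- x] ^+ 2 = (onp n).[x] ^+ 2.
Proof.
by rewrite !hornerZ monic_pol_parity !exprMn -exprM mulnC exprM sqrrN expr1n expr1n mul1r.
Qed.

Lemma monic_pol_coef_pred n : (monic_pol n.+1)`_n = 0.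
Proof.
suff: (monic_pol n.+1)`_n = 0 /\ (monic_pol n.+2)`_n.+1 = 0 by case.
elim: n => [|n [IH1 IH2]].
  rewrite monic_polSS monic_pol1 monic_pol0 coefX/= coefB -expr2 coefXn coefZ coef1/=.
  by rewrite mulr0 subr0.
split=> //; rewrite monic_polSS coefB coefXM/= IH2 coefZ nth_default ?mulr0 ?subr0//.
by rewrite (proj1 (size_monic_pol _)).
Qed.

(** The harmonic sum of the final computation originates here: [4 alpha k.+1] is
    [1 - 2 a / (k + 1 + l + a)] up to a telescoping term. *)
Lemma monic_pol_coef_pred2 n : (monic_pol n.+2)`_n = - \sum_(j < n.+1) alpha j.+1.
Proof.
elim: n => [|n IH].
  by rewrite monic_polSS monic_pol1 monic_pol0 coefB -expr2 coefXn coefZ coef1/= big_ord1 mulr1 sub0r.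
rewrite monic_polSS coefB coefXM/= IH coefZ [in RHS]big_ord_recr/= opprD; congr (_ - _).
have /monicP := proj2 (size_monic_pol n.+1).
by rewrite lead_coefE (proj1 (size_monic_pol _))/= => ->; rewrite mulr1.
Qed.

Lemma Lp_X2_onp n : Lp ('X^2 * onp n.+1 ^+ 2) = alpha n.+2 + alpha n.+1.
Proof.
rewrite -exprMn mulX_onp expr2.
have := Lp_onp n n; have := Lp_onp n.+2 n; have := Lp_onp n n.+2; have := Lp_onp n.+2 n.+2.
have -> : (n.+2 == n) = false by rewrite gtn_eqF.
have -> : (n == n.+2) = false by rewrite ltn_eqF.
rewrite !eqxx.
move: (onp n) (onp n.+2) => p q e1 e2 e3 e4.
rewrite mulrDl !mulrDr -!scalerAl -!scalerAr !LpD// !LpZ// e1 e2 e3 e4.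
by rewrite -!sqr_aa mulr1n mulr0n; ring.
Qed.

Lemma Lp_mul_onp p n : (size p <= n.+1)%N ->
  Lp (p * onp n) = p`_n * Num.sqrt (sqnorm n).
Proof.
move=> pn; rewrite -scalerAr LpZ// Lp_mul_monic// mulrCA; congr (_ * _).
rewrite -[X in _ * X]sqr_sqrtr ?(ltW (sqnorm_gt0 n))//.
by have := gt_eqF (s0 n); move: (Num.sqrt _) => s sn; field; rewrite sn.
Qed.

Lemma coef_mulX_deriv p n : ('X * deriv p)`_n = n%:R * p`_n.
Proof.
case: n => [|n]; rewrite coefXM ?mul0r//= coef_deriv mulr_natl//.
Qed.

Lemma size_mulX_deriv p : (size ('X * deriv p)%R <= size p)%N.
Proof.
by apply/leq_sizeP => j pj; rewrite coef_mulX_deriv nth_default ?mulr0.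
Qed.

Lemma Lp_X_deriv_onp n : Lp ('X * onp n * deriv (onp n)) = n%:R.
Proof.
rewrite -mulrA [onp n * _]mulrC mulrA Lp_mul_onp; last first.
  by rewrite (leq_trans (size_mulX_deriv _))// size_onp.
have /monicP := proj2 (size_monic_pol n).
rewrite lead_coefE (proj1 (size_monic_pol n))/= => e.
by rewrite coef_mulX_deriv coefZ e mulr1 -mulrA mulVf ?mulr1// gt_eqF.
Qed.

(** For [p] of degree [N = n + 2], the polynomial [x p' - N p] has no term of degree [N], by parity
    none of degree [N - 1], and at degree [N - 2] it has [-2] times the coefficient of [p]. What
    remains is a [q] of lower degree, and [x^2 q] is orthogonal to [p]. *)
Lemma Lp_X3_deriv_onp n : Lp ('X^3 * onp n.+2 * deriv (onp n.+2)) =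
  n.+2%:R * (alpha n.+3 + alpha n.+2) + 2 * \sum_(j < n.+1) alpha j.+1.
Proof.
pose s := Num.sqrt (sqnorm n.+2).
have sn : s != 0 by rewrite gt_eqF// s0.
have [szP mP] := size_monic_pol n.+2.
have lP : (monic_pol n.+2)`_n.+2 = 1 by move/monicP: mP; rewrite lead_coefE szP.
pose b := (monic_pol n.+2)`_n.
pose q := 'X * deriv (onp n.+2) - n.+2%:R *: onp n.+2 + (2 * b / s) *: 'X^n.
have qn : (size q <= n)%N.
  apply/leq_sizeP => j; rewrite leq_eqVlt => /predU1P[<-|].
    rewrite coefD coefB coef_mulX_deriv !coefZ coefXn eqxx mulr1 -/b -/s -addn2 natrD.
    by field; rewrite sn.
  rewrite coefD coefB coef_mulX_deriv !coefZ coefXn => nj; rewrite gtn_eqF// mulr0 addr0.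
  move: nj; rewrite leq_eqVlt => /predU1P[<-|].
    by rewrite monic_pol_coef_pred !mulr0 subrr.
  rewrite leq_eqVlt => /predU1P[<-|nj]; first by rewrite subrr.
  by rewrite nth_default ?szP// !mulr0 subrr.
have e : 'X * deriv (onp n.+2) = q + n.+2%:R *: onp n.+2 - (2 * b / s) *: 'X^n.
  by rewrite /q; move: ('X * _) (_ *: onp _) (_ *: 'X^n) => A B C; ring.
have -> : 'X^3 * onp n.+2 * deriv (onp n.+2) = 'X^2 * ('X * deriv (onp n.+2)) * onp n.+2.
  by move: (onp _) (deriv _) => A B; ring.
have gen (u v o : {poly R}) (k m : R) : Lp ('X^2 * (u + k *: o - m *: v) * o) =
    Lp ('X^2 * u * o) + k * Lp ('X^2 * (o * o)) - m * Lp ('X^2 * v * o).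
  by rewrite mulrBr mulrDr mulrBl mulrDl -!scalerAr -!scalerAl LpB// LpD// !LpZ// mulrA.
rewrite {}e gen Lp_monic_onp ?add0r; last first.
  by rewrite mulrC (leq_trans (size_polyMleq _ _))// size_polyXn addnS/= addn2/= !ltnS.
rewrite -mulrA -[onp _ * onp _]expr2 Lp_X2_onp -exprD add2n.
rewrite Lp_mul_onp ?size_polyXn// coefXn eqxx mul1r -/s.
rewrite /b monic_pol_coef_pred2; move: (\sum_(_ < _) _) => S; field; exact: sn.
Qed.

End Algebra.

(** * Integration by parts *)

Section IntegrationByParts.
Context {R : realType}.
Implicit Types (f g F : R -> R) (x y b c d h s t u r : R) (p q : {poly R}).

Local Notation mu := (@lebesgue_measure R).

Variables (l a : R).
Hypotheses (l0 : 0 < l) (a0 : 0 <= a).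

Local Notation W := (W l a).
Local Notation Lp := (Lp l a).

(** The Euler derivative [y ell'(y)]. Hence [rr (s t)] is the value of [s d/ds], and also of
    [t d/dt], on [ell (s t)]. *)
Definition rr y : R := 2 * y ^+ 2 / (1 + y ^+ 2).
Definition ell y : R := ln (1 + y ^+ 2).
Definition qk k : R := a / (l + k%:R).

Lemma lk_gt0 k : 0 < l + k%:R. Proof. by rewrite ltr_wpDr. Qed.

Lemma qk_ge0 k : 0 <= qk k. Proof. by rewrite divr_ge0// ltW// lk_gt0. Qed.

Lemma rr_ge0 y : 0 <= rr y.
Proof. by apply: divr_ge0; [rewrite mulr_ge0 ?sqr_ge0|exact/ltW/sqrD1_gt0]. Qed.

Lemma rr_le y : rr y <= 2 * y ^+ 2.
Proof.
have y0 := sqr_ge0 y; rewrite /rr ler_pdivrMr ?sqrD1_gt0//; move: (y ^+ 2) y0 => z z0; nra.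
Qed.

Lemma rr_scale_continuous s : continuous (fun t => rr (s * t)).
Proof. rewrite /rr; contd; exact: sqrD1_neq0. Qed.

Lemma sum_rr_continuous N : continuous (fun t => \sum_(k < N) rr (qk k * t)).
Proof.
elim: N => [|N IH] t.
  have -> : (fun t => \sum_(k < 0) rr (qk k * t)) = fun=> 0.
    by apply/funext => u; rewrite big_ord0.
  exact: cst_continuous.
have -> : (fun t => \sum_(k < N.+1) rr (qk k * t)) =
    fun t => \sum_(k < N) rr (qk k * t) + rr (qk N * t).
  by apply/funext => u; rewrite big_ord_recr.
apply: (@continuousD R R R (fun t => \sum_(k < N) rr (qk k * t)) (fun t => rr (qk N * t))).
  exact: IH.
exact: rr_scale_continuous.
Qed.

Lemma sum_inv_sqr_le N : \sum_(k < N) (l + k%:R) ^- 2 <= l ^- 2 + l^-1.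
Proof.
suff h : \sum_(k < N.+1) (l + k%:R) ^- 2 <= l ^- 2 + l^-1 - (l + N%:R)^-1.
  apply: le_trans (_ : \sum_(k < N.+1) (l + k%:R) ^- 2 <= _).
    by rewrite [leRHS]big_ord_recr/= lerDl invr_ge0 sqr_ge0.
  by apply: le_trans h _; rewrite lerBlDr lerDl invr_ge0 ltW// lk_gt0.
elim: N => [|N IH]; first by rewrite big_ord1 addr0; lra.
rewrite big_ord_recr/=; move: IH; set S := \sum_(_ < _) _ => IH.
suff : (l + N.+1%:R) ^- 2 <= (l + N%:R)^-1 - (l + N.+1%:R)^-1 by lra.
rewrite -natr1 addrA; move: (l + N%:R) (lk_gt0 N) => y y0.
have y1 : 0 < y + 1 by rewrite addr_gt0.
have -> : y^-1 - (y + 1)^-1 = (y * (y + 1))^-1 by field; rewrite !gt_eqF.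
by rewrite lef_pV2 ?posrE ?mulr_gt0// expr2 ler_pM2r// lerDl.
Qed.

Lemma sum_qk_sqr_le N : \sum_(k < N) qk k ^+ 2 <= a ^+ 2 * (l ^- 2 + l^-1).
Proof.
rewrite (eq_bigr (fun k : 'I_N => a ^+ 2 * (l + k%:R) ^- 2)); last first.
  by move=> k _; rewrite exprMn exprVn.
by rewrite -mulr_sumr ler_wpM2l ?sqr_ge0// sum_inv_sqr_le.
Qed.

Lemma sum_rr_le N t : \sum_(k < N) rr (qk k * t) <= 2 * (l ^- 2 + l^-1) * (a * t) ^+ 2.
Proof.
apply: le_trans (_ : \sum_(k < N) 2 * t ^+ 2 * qk k ^+ 2 <= _).
  by apply: ler_sum => k _; apply: le_trans (rr_le _) _; rewrite exprMn; lra.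
rewrite -mulr_sumr; have := ler_wpM2l (sqr_ge0 t) (sum_qk_sqr_le N).
by move: (\sum_(_ < _) _) (l ^- 2) => S i; rewrite exprMn; lra.
Qed.

Lemma sum_rr_cvg t : cvg ((\sum_(k < n) rr (qk k * t)) @[n --> \oo]).
Proof.
apply: nondecreasing_is_cvgn.
  apply/nondecreasing_seqP => n; rewrite big_ord_recr/= lerDl; exact: rr_ge0.
exists (2 * (l ^- 2 + l^-1) * (a * t) ^+ 2) => _ [n _ <-]; exact: sum_rr_le.
Qed.

Definition RS t : R := limn (fun n => \sum_(k < n) rr (qk k * t)).

Lemma RS_cvg t : (\sum_(k < n) rr (qk k * t)) @[n --> \oo] --> RS t.
Proof. exact: sum_rr_cvg. Qed.

(* The weight with the Weierstrass product of [1 / |Gamma|^2] truncated after [N] factors. *)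
Definition WN N t : R := wconst l a * gint l ^+ 2 *
  (\prod_(k < N) (1 + (qk k * t) ^+ 2)^-1) * (1 + t ^+ 2) `^ (- l) *
  expR (- (2 * a * t * atan t)) * cauchy t.

Let V N t : R := \prod_(k < N) (1 + (qk k * t) ^+ 2)^-1.

(** Only finite products are differentiated; the passage to the infinite one is made in the
    integrals, by domination. *)
Let dV N t : is_derive t 1 (V N) (- (\sum_(k < N) 2 * qk k ^+ 2 * t / (1 + (qk k * t) ^+ 2)) * V N t).
Proof.
elim: N => [|N IH].
  rewrite big_ord0 oppr0 mul0r (_ : V 0 = fun=> 1); first exact: is_derive_const.
  by apply/funext => x; rewrite /V big_ord0.
rewrite (_ : V N.+1 = fun t => V N t * (1 + (qk N * t) ^+ 2)^-1); last first.
  by apply/funext => x; rewrite /V big_ord_recr.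
derc; [exact: IH|exact: sqrD1_neq0|].
rewrite big_ord_recr/=; move: (\sum_(_ < _) _) (V N t) (sqrD1_neq0 (qk N * t)) => S v n.
by field.
Qed.

Let V_ge0 N t : 0 <= V N t.
Proof. by apply: prodr_ge0 => k _; rewrite invr_ge0 ltW// sqrD1_gt0. Qed.

Let V_le1 N t : V N t <= 1.
Proof.
by apply: prodr_ile1 => k _; rewrite (ltW (cauchy_gt0 (qk k * t))) (cauchy_le1 (qk k * t)).
Qed.

Let K0 : 0 <= wconst l a * gint l ^+ 2.
Proof. by apply: mulr_ge0; [exact/ltW/wconst_gt0|exact: sqr_ge0]. Qed.

Lemma WN_ge0 N t : 0 <= WN N t.
Proof.
have := ltW (wconst_gt0 l0 a0); have := sqr_ge0 (gint l); have := V_ge0 N t.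
have := powR_ge0 (1 + t ^+ 2) (- l); have := expR_ge0 (- (2 * a * t * atan t)).
have := ltW (cauchy_gt0 t); rewrite /WN -/(V N t).
move: (wconst l a) (gint l ^+ 2) (V N t) (_ `^ _) (expR _) (cauchy t) => A B C D E F.
by move=> F0 E0 D0 C0 B0 A0; rewrite !mulr_ge0.
Qed.

Lemma WN_le N t : WN N t <= wconst l a * gint l ^+ 2 * expR (- (2 * a * t * atan t)) * cauchy t.
Proof.
rewrite ler_wpM2r ?(ltW (cauchy_gt0 _))// ler_wpM2r ?expR_ge0//.
rewrite -mulrA (ler_piMr K0)//.
by rewrite mulr_ile1 ?V_ge0 ?V_le1 ?powR_ge0// powR_sqrD1_le1// ltW.
Qed.

Lemma WN_cvg t : WN n t @[n --> \oo] --> W t.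
Proof.
have g0 := gint_gt0 l0; have n0 := gnorm2_gt0 (a * t) l0.
have h := gnorm2_weierstrass (a * t) l0.
have h2 : (gnorm2 l (a * t) 0 / gint l ^+ 2 *
    \prod_(k < n) (1 + (a * t / (l + k%:R)) ^+ 2))^-1 @[n --> \oo] --> (1^-1 : R).
  by apply: cvgV; [exact: oner_neq0|exact: h].
pose K := wconst l a * gnorm2 l (a * t) 0 * (1 + t ^+ 2) `^ (- l) *
  expR (- (2 * a * t * atan t)) * cauchy t.
have -> : W t = K * 1^-1 by rewrite W_expl// invr1 mulr1.
have h3 : K * (gnorm2 l (a * t) 0 / gint l ^+ 2 *
    \prod_(k < n) (1 + (a * t / (l + k%:R)) ^+ 2))^-1 @[n --> \oo] --> K * 1^-1.
  by apply: cvgMr; exact: h2.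
apply: cvg_trans h3; apply: near_eq_cvg; apply: nearW => n.
rewrite /WN /K invfM.
have -> : \prod_(k < n) (1 + (qk k * t) ^+ 2)^-1 = (\prod_(k < n) (1 + (a * t / (l + k%:R)) ^+ 2))^-1.
  by rewrite -prodfV; apply: eq_bigr => k _; rewrite /qk mulrAC.
move: (\prod_(_ < _) _)^-1 (gnorm2 _ _ _) (gint l) (_ `^ _) (expR _) (cauchy t) (wconst l a) g0 n0.
move=> P G g A B C D g0 n0; field; rewrite !gt_eqF//.
Qed.

(** The sums of [rr] are controlled only by a multiple of [(a t)^2]; this decay pays for it,
    uniformly in the truncation. For [|t| > 1] the exponent is at most [- a |t|], as
    [atan |t| >= pi / 4 >= 1/2]; for [|t| <= 1] the exponential is at most 1. For [a = 0] there is
    no decay, but then [a t = 0] too. *)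
Lemma sqr_expR_atan_le t : (1 + (a * t) ^+ 2) * expR (- (2 * a * t * atan t)) <= 4 + a ^+ 2.
Proof.
have a2 : 0 <= a ^+ 2 by exact: sqr_ge0.
have [t1|t1] := leP `|t| 1.
  have e1 := expR_atan_le1 a0 t.
  have t2 : t ^+ 2 <= 1 by rewrite -real_normK ?num_real// expr_le1.
  apply: le_trans (_ : 1 + (a * t) ^+ 2 <= _).
    by rewrite ler_piMr// ltW// sqrD1_gt0.
  have := ler_wpM2l a2 t2; rewrite exprMn; lra.
have k x : 1 < x -> x <= 2 * (x * atan x).
  move=> x1; have : pi / 4 <= atan x by rewrite -atan1 le_atan// ltW.
  have := @pi_ge2 R; move: (atan x) => A p2 pA.
  have : 0 <= x * (2 * A - 1) by rewrite mulr_ge0; lra.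
  lra.
have h : `|t| <= 2 * (t * atan t).
  have -> : t * atan t = `|t| * atan `|t|.
    have [t0|t0] := ger0P t; first by [].
    by rewrite atanN mulrNN.
  exact: k.
have e2 : expR (- (2 * a * t * atan t)) <= expR (- (a * `|t|)).
  by rewrite ler_expR lerN2; have := ler_wpM2l a0 h; lra.
have y0 : 0 <= a * `|t| by rewrite mulr_ge0.
have -> : (a * t) ^+ 2 = (a * `|t|) ^+ 2 by rewrite !exprMn real_normK ?num_real.
apply: le_trans (ler_wpM2l (ltW (sqrD1_gt0 _)) e2) _.
rewrite expRN; move: (a * `|t|) y0 => y y0.
rewrite ler_pdivrMr ?expR_gt0//.
have e3 : 1 + y / 2 <= expR (y / 2) by rewrite expR_ge1Dx.
have e4 : expR y = expR (y / 2) * expR (y / 2) by rewrite -expRD -splitr.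
have e5 : (1 + y / 2) * (1 + y / 2) <= expR y.
  by rewrite e4; apply: ler_pM; rewrite ?addr_ge0 ?divr_ge0.
have := ler_wpM2r (expR_ge0 y) (_ : 4 <= 4 + a ^+ 2); rewrite lerDl => /(_ a2).
move: (expR y) e5 => e e5; nra.
Qed.

Let sqr_WN_le N t : (1 + (a * t) ^+ 2) * WN N t <=
  wconst l a * gint l ^+ 2 * (4 + a ^+ 2) * cauchy t.
Proof.
apply: le_trans (ler_wpM2l (ltW (sqrD1_gt0 _)) (WN_le N t)) _.
have := ler_wpM2l K0 (sqr_expR_atan_le t).
move: (wconst l a * _) (expR _) (1 + _) => A C D h.
have -> : D * (A * C * cauchy t) = A * (D * C) * cauchy t by ring.
by rewrite ler_wpM2r// ltW// cauchy_gt0.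
Qed.

Section Poly.
Variable q : {poly R}.

(** The terms of the derivative of [t q W] that are polynomial in [x = xt t]: the powers of
    [1 + t^2] in [W] contribute [- (2 l + 2) x^2 q], the rational part of the derivative of
    [2 a t atan t] contributes [- 2 a x^2 q]. *)
Let Q : {poly R} := q + 'X * (1 - 'X^2) * deriv q - (2 * (l + a) + 2) *: ('X^2 * q).

Let fN N t : R := (Q.[xt t] - (2 * a * t * atan t + \sum_(k < N) rr (qk k * t)) * q.[xt t]) * WN N t.

Let FN N t : R := t * q.[xt t] * WN N t.

Let dWN N t : is_derive t 1 (WN N) ((- (\sum_(k < N) 2 * qk k ^+ 2 * t / (1 + (qk k * t) ^+ 2))
  - 2 * l * t * cauchy t - 2 * a * (atan t + t * cauchy t) - 2 * t * cauchy t) * WN N t).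
Proof.
have d := dV N t.
have dc : is_derive t 1 cauchy (- (2 * t * cauchy t ^+ 2)).
  by rewrite /cauchy; derc; [exact: sqrD1_neq0|field; exact: sqrD1_neq0].
rewrite /WN; derc.
- exact: d.
- exact: sqrD1_gt0.
- exact: dc.
have -> : (1 + t ^+ 2) `^ (- l - 1) = (1 + t ^+ 2) `^ (- l) * cauchy t.
  by rewrite powRD ?sqrD1_neq0 ?implybT// powR_inv1// ltW// sqrD1_gt0.
rewrite -/(V N t).
have n := sqrD1_neq0 t.
move: (V N t) (\sum_(_ < _) _) => v S.
move: (wconst _ _) (gint l) ((1 + t ^+ 2) `^ (- l)) => C g P.
move: (expR (- _)) => e; move: (atan t) => A.
by rewrite /cauchy; field.
Qed.

Let dFN N t : is_derive t 1 (FN N) (fN N t).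
Proof.
have d1 := dWN N t; have d2 := is_derive_horner q (xt_derive t).
rewrite /FN; derc; [exact: d2|exact: d1|].
have e1 : t * xt' t = xt t * (1 - xt t ^+ 2) by rewrite sub1_xt_sqr /xt /xt'; ring.
have e2 : t * \sum_(k < N) 2 * qk k ^+ 2 * t / (1 + (qk k * t) ^+ 2) = \sum_(k < N) rr (qk k * t).
  by rewrite mulr_sumr; apply: eq_bigr => k _; rewrite /rr; field; exact: sqrD1_neq0.
have e3 : t * (t * cauchy t) = xt t * xt t by rewrite -expr2 xt_sqr; ring.
rewrite /fN /Q !(hornerD, hornerN, hornerM, hornerZ, hornerX, hornerXn, hornerC) -e2.
have -> : xt t * (1 - xt t ^+ 2) * (deriv q).[xt t] = t * xt' t * (deriv q).[xt t].
  by rewrite e1.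
rewrite -e3; move: (WN N t) (q.[_]) ((deriv q).[_]) (cauchy t) (xt' t) => w u v c x.
move: (\sum_(_ < _) _) (atan t) => S A.
by ring.
Qed.

Let cWN N : continuous (WN N).
Proof. by move=> t; exact: is_derive_continuous (dWN N t). Qed.

Let catan t : {for t, continuous (fun t : R => 2 * a * t * atan t)}.
Proof. by eapply is_derive_continuous; der. Qed.

Let csum N t : {for t, continuous (fun t => \sum_(k < N) rr (qk k * t))}.
Proof. exact: sum_rr_continuous. Qed.

Let cfN N : continuous (fN N).
Proof.
move=> t; apply: (@continuousM R R (fun t => Q.[xt t] - (2 * a * t * atan t + \sum_(k < N) rr (qk k * t)) * q.[xt t]) (WN N)); last exact: cWN.
apply: (@continuousB R R R (fun t => Q.[xt t]) (fun t => (2 * a * t * atan t + \sum_(k < N) rr (qk k * t)) * q.[xt t])).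
  exact: horner_xt_continuous.
apply: (@continuousM R R (fun t => 2 * a * t * atan t + \sum_(k < N) rr (qk k * t)) (fun t => q.[xt t])); last exact: horner_xt_continuous.
apply: (@continuousD R R R (fun t => 2 * a * t * atan t) (fun t => \sum_(k < N) rr (qk k * t))).
  exact: catan.
exact: csum.
Qed.

Let C0 := coef_norm Q + coef_norm q * (4 + 2 * (l ^- 2 + l^-1)).

Let atan_le y : `|2 * a * y * atan y| <= 4 * (1 + (a * y) ^+ 2).
Proof.
have -> : `|2 * a * y * atan y| = 2 * `|a * y| * `|atan y|.
  by rewrite -(mulrA 2) 2!normrM (@ger0_norm _ 2).
have h1 : `|atan y| <= 2 by apply: le_trans (atan_norm_le y) _; exact/ltW/pihalf_lt2.
have -> : (a * y) ^+ 2 = `|a * y| ^+ 2 by rewrite real_normK ?num_real.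
have : 2 * `|a * y| * `|atan y| <= 2 * `|a * y| * 2 by rewrite ler_wpM2l// mulr_ge0.
by move: `|a * y| (normr_ge0 (a * y)) `|atan y| => z z0 A h; have := sqr_ge0 (z - 1); lra.
Qed.

Let li0 : 0 <= l ^- 2 + l^-1.
Proof. by rewrite addr_ge0 ?invr_ge0 ?sqr_ge0// ltW. Qed.

Let fN_le N t : `|fN N t| <= C0 * (wconst l a * gint l ^+ 2 * (4 + a ^+ 2)) * cauchy t.
Proof.
rewrite /fN normrM (ger0_norm (WN_ge0 N t)) -[leRHS]mulrA.
have C00 : 0 <= C0.
  by rewrite addr_ge0 ?coef_norm_ge0// mulr_ge0 ?coef_norm_ge0// addr_ge0// mulr_ge0.
apply: le_trans (ler_wpM2l C00 (sqr_WN_le N t)); rewrite [leRHS]mulrA ler_wpM2r ?WN_ge0//.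
apply: le_trans (ler_normB _ _) _; rewrite normrM.
have h1 := horner_xt_le Q t; have h2 := horner_xt_le q t.
have h3 : `|2 * a * t * atan t + \sum_(k < N) rr (qk k * t)| <= (4 + 2 * (l ^- 2 + l^-1)) * (1 + (a * t) ^+ 2).
  apply: le_trans (ler_normD _ _) _; rewrite [leRHS]mulrDl; apply: lerD; first exact: atan_le.
  rewrite ger0_norm; last by apply: sumr_ge0 => k _; exact: rr_ge0.
  by apply: le_trans (sum_rr_le _ _) _; rewrite ler_wpM2l ?mulr_ge0// lerDr.
have h4 : `|2 * a * t * atan t + \sum_(k < N) rr (qk k * t)| * `|q.[xt t]| <= (4 + 2 * (l ^- 2 + l^-1)) * (1 + (a * t) ^+ 2) * coef_norm q by rewrite ler_pM.
apply: le_trans (lerD h1 h4) _; rewrite /C0 [leRHS]mulrDl lerD//.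
  by rewrite ler_peMr ?coef_norm_ge0// lerDl sqr_ge0.
by rewrite le_eqVlt; apply/orP; left; apply/eqP; ring.
Qed.

Let itg_dom : itg (fun t => C0 * (wconst l a * gint l ^+ 2 * (4 + a ^+ 2)) * cauchy t).
Proof. exact/itgZ/cauchy_itg. Qed.

Let mfN N : measurable_fun setT (fN N).
Proof. by apply: continuous_measurable_fun => t; exact: cfN. Qed.

Let itg_fN N : itg (fN N).
Proof. exact: itg_le (mfN N) (fN_le N) itg_dom. Qed.

Let FN_le N t : `|FN N t| <= coef_norm q * (wconst l a * gint l ^+ 2) * `|t|^-1.
Proof.
rewrite /FN normrM (ger0_norm (WN_ge0 N t)) normrM.
have h1 : WN N t <= wconst l a * gint l ^+ 2 * cauchy t.
  apply: le_trans (WN_le N t) _; rewrite ler_wpM2r ?(ltW (cauchy_gt0 _))//.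
  by rewrite (ler_piMr K0)// expR_atan_le1.
have h2 : `|t| * cauchy t <= `|t|^-1.
  have [->|t0] := eqVneq t 0; first by rewrite normr0 mul0r invr0.
  have t1 : 0 < `|t| by rewrite normr_gt0.
  rewrite ler_pdivrMr ?sqrD1_gt0// -[t ^+ 2]real_normK ?num_real// mulrDr mulr1.
  by rewrite expr2 mulrA mulVf ?mul1r ?gt_eqF// lerDr invr_ge0.
have h3 := horner_xt_le q t.
move: (wconst l a * _) K0 h1 => K K1 h1.
apply: le_trans (_ : `|t| * coef_norm q * (K * cauchy t) <= _).
  apply: ler_pM h1; [exact: mulr_ge0|exact: WN_ge0|exact: ler_wpM2l].
have -> : `|t| * coef_norm q * (K * cauchy t) = coef_norm q * K * (`|t| * cauchy t) by ring.
by rewrite ler_wpM2l// mulr_ge0 ?coef_norm_ge0.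
Qed.

Let FN_cvg N (v : nat -> R) : (forall n, `|v n| = n%:R) -> FN N (v n) @[n --> \oo] --> (0 : R).
Proof.
move=> vn; apply: norm_cvg0.
have h : coef_norm q * (wconst l a * gint l ^+ 2) * (n%:R + 0)^-1 @[n --> \oo] --> (0 : R).
  by rewrite -[X in _ --> X](mulr0 (coef_norm q * (wconst l a * gint l ^+ 2))); apply: cvgMr; exact: cvg_invn.
apply: squeeze_cvgr h; last exact: cvg_cst.
by apply: nearW => n; rewrite normr_ge0/= addr0 -vn FN_le.
Qed.

(* The integral of the derivative of [t q(xt t) W(t)] vanishes, and [t d/dt] is
   [x (1 - x^2) d/dx]. *)
Lemma pollaczek_by_parts : itg (fun t => (2 * a * t * atan t + RS t) * q.[xt t] * W t) /\
  RInt (fun t => (2 * a * t * atan t + RS t) * q.[xt t] * W t) =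
  Lp (q + 'X * (1 - 'X^2) * deriv q - (2 * (l + a) + 2) *: ('X^2 * q)).
Proof.
have z N : RInt (fN N) = 0.
  rewrite -(subrr 0); notypeclasses refine (@int_derive _ (FN N) (fN N) _ _ _ _ _ _ _).
  - exact: dFN.
  - exact: cfN.
  - exact: itg_fN.
  - by apply: FN_cvg => n; rewrite ger0_norm.
  - by apply: FN_cvg => n; rewrite normrN ger0_norm.
pose f t := (Q.[xt t] - (2 * a * t * atan t + RS t) * q.[xt t]) * W t.
have [|if0 lf] := @int_dct _ fN f _ mfN itg_dom fN_le.
  move=> t; have h1 := @WN_cvg t; have h2 := @RS_cvg t.
  apply: cvgM; last exact: h1.
  apply: cvgB; first exact: cvg_cst.
  apply: cvgMl; apply: cvgD; last exact: h2.
  exact: cvg_cst.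
have e0 : RInt f = 0.
  have l2 : RInt (fN n) @[n --> \oo] --> (0 : R).
    by under eq_fun do rewrite z; exact: cvg_cst.
  exact: (cvg_unique _ lf l2).
have iQ : itg (fun t => Q.[xt t] * W t) by exact: horner_W_itg.
have ee t : (2 * a * t * atan t + RS t) * q.[xt t] * W t = Q.[xt t] * W t - f t.
  by rewrite /f; ring.
have -> : (fun t => (2 * a * t * atan t + RS t) * q.[xt t] * W t) = fun t => Q.[xt t] * W t - f t.
  by apply/funext => t; exact: ee.
by split; [exact: itgB|rewrite intB// e0 subr0].
Qed.

End Poly.

End IntegrationByParts.

(** * Weak limit of the densities *)

Section WeakLimit.
Context {R : realType}.
Implicit Types (f g F : R -> R) (x y b c d h s t u r : R) (p q : {poly R}).

Local Notation mu := (@lebesgue_measure R).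

(** Diagonal form of the exchange of limits: a limit of [K] is not presupposed, as
    [|K M - K N| <= e M + e N] makes [K n] comparable with a fixed [K M]. It is meant for partial
    sums cut at the index [n] of the sequence. *)
Lemma cvg_uniform_approx_sub (u : nat -> R) (v : nat -> nat -> R) (e K : nat -> R) :
  (forall M n, `|u n - v M n| <= e M) -> e n @[n --> \oo] --> (0 : R) ->
  (forall M, v M n @[n --> \oo] --> K M) -> u n - K n @[n --> \oo] --> (0 : R).
Proof.
move=> uv e0 vK.
have KK M N : `|K M - K N| <= e M + e N.
  have h : `|v M n - v N n| @[n --> \oo] --> `|K M - K N|.
    by apply: cvg_norm; apply: cvgB; exact: vK.
  apply: (ler_cvg_to h (cvg_cst _)); apply: nearW => n.
  have -> : v M n - v N n = (u n - v N n) - (u n - v M n) by ring.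
  by apply: le_trans (ler_normB _ _) _; rewrite addrC lerD.
apply/cvgrPdist_lt => eps eps0.
have eps5 : 0 < eps / 5 by rewrite divr_gt0.
have he : \forall n \near \oo, e n < eps / 5.
  move/cvgrPdist_lt: e0 => /(_ _ eps5); apply: filterS => n; rewrite sub0r normrN.
  by apply: le_lt_trans; exact: ler_norm.
have [M _ hM] := he.
have /cvgrPdist_lt /(_ _ eps5) hv := vK M.
near=> n.
have h1 : e n < eps / 5 by near: n; exact: he.
have h2 : `|K M - v M n| < eps / 5 by near: n; exact: hv.
have h3 := hM M (leqnn M); have h4 := uv M n; have h5 := KK M n; rewrite /= in h3.
rewrite sub0r normrN.
have -> : u n - K n = (u n - v M n) - (K M - v M n) + (K M - K n) by ring.
have := ler_normD ((u n - v M n) - (K M - v M n)) (K M - K n).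
have := ler_normB (u n - v M n) (K M - v M n).
move: h2 h4 h5; move: `|_ - _ - _ + _| `|_ - _ - _| `|_| `|_| `|_| => A B C D E; lra.
Unshelve. all: by end_near. Qed.

Lemma cvg_uniform_approx (u : nat -> R) (v : nat -> nat -> R) (e K : nat -> R) (L : R) :
  (forall M n, `|u n - v M n| <= e M) -> e n @[n --> \oo] --> (0 : R) ->
  (forall M, v M n @[n --> \oo] --> K M) -> K n @[n --> \oo] --> L ->
  u n @[n --> \oo] --> L.
Proof.
move=> uv e0 vK KL; have h := cvg_uniform_approx_sub uv e0 vK.
have h2 : (u n - K n) + K n @[n --> \oo] --> 0 + L by apply: cvgD; [exact: h|exact: KL].
rewrite add0r in h2; apply: cvg_trans h2; apply: near_eq_cvg; apply: nearW => n.
by rewrite subrK.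
Qed.

Variables (l a : R).
Hypotheses (l0 : 0 < l) (a0 : 0 <= a).

Local Notation W := (W l a).
Local Notation Lp := (Lp l a).
Local Notation alpha := (alpha l a).
Local Notation aa := (aa l a).
Local Notation onp := (onp l a).

Lemma alpha_cvg : alpha n @[n --> \oo] --> (4^-1 : R).
Proof.
have h1 := @cvg_ratio R 0 (l + a); have h2 := @cvg_ratio R (2 * l - 1) (l + a - 1).
have h : 4^-1 * ((n%:R + 0) / (n%:R + (l + a)) * ((n%:R + (2 * l - 1)) / (n%:R + (l + a - 1))))
    @[n --> \oo] --> 4^-1 * (1 * 1 : R).
  by apply: cvgMr; apply: cvgM; [exact: h1|exact: h2].
rewrite !mulr1 in h; apply: cvg_trans h; apply: near_eq_cvg; apply: nearW => n.
by rewrite /alpha !invfM !addrA addr0; ring.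
Qed.

Lemma aa_cvg : aa n @[n --> \oo] --> (2^-1 : R).
Proof.
have e : Num.sqrt 4^-1 = 2^-1 :> R.
  by rewrite (_ : 4^-1 = (2^-1) ^+ 2); [rewrite sqrtr_sqr ger0_norm|field].
rewrite -e; apply: (@cvg_comp _ _ _ alpha Num.sqrt); first exact: alpha_cvg.
exact: sqrt_continuous.
Qed.

Lemma aa_shift_cvg k : aa (n + k)%N @[n --> \oo] --> (2^-1 : R).
Proof. by rewrite (cvg_shiftn k aa); exact: aa_cvg. Qed.

Fixpoint cheb_pair n : {poly R} * {poly R} :=
  if n is m.+1 then
    let: (p, q) := cheb_pair m in (q, 2 *: ('X * q) - p)
  else (1, 'X).

Definition cheb n := (cheb_pair n).1.

Lemma chebSS n : cheb n.+2 = 2 *: ('X * cheb n.+1) - cheb n.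
Proof. by rewrite /cheb /=; case: (cheb_pair n). Qed.

Lemma cheb_cos n s : (cheb n).[cos s] = cos (n%:R * s).
Proof.
suff: (cheb n).[cos s] = cos (n%:R * s) /\ (cheb n.+1).[cos s] = cos (n.+1%:R * s) by case.
elim: n => [|n [IH1 IH2]].
  by rewrite /cheb /= hornerC hornerX mul0r cos0 mul1r.
split=> //; rewrite chebSS !(hornerD, hornerN, hornerM, hornerZ, hornerX) IH1 IH2.
have -> : n.+2%:R * s = n.+1%:R * s + s by rewrite -[n.+2%:R]natr1 mulrDl mul1r.
have -> : n%:R * s = n.+1%:R * s - s by rewrite -natr1; ring.
by rewrite cosB cosD; ring.
Qed.

Lemma cheb_xt n t : (cheb n).[xt t] = cos (n%:R * acos (xt t)).
Proof.
rewrite -cheb_cos acosK// in_itv/= -ler_norml; exact/ltW/xt_lt1.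
Qed.

(** Matrix entries of [T_j] of the free Jacobi matrix, doubly infinite with off-diagonal entries
    [1/2]. Both indicators hold at once for [j = 0], [d1 = d2], giving 1. *)
Let kron (j d1 d2 : nat) : R := ((d1 == d2 + j)%N%:R + (d2 == d1 + j)%N%:R) / 2.

(** Multiplication by [X] moves one index and leaves the other, so the induction on [j] must carry
    all pairs of offsets, although only equal ones are wanted. *)
Lemma cheb_moment_cvg (j d1 d2 : nat) :
  Lp (cheb j * onp (n + d1)%N * onp (n + d2)%N) @[n --> \oo] --> kron j d1 d2.
Proof.
suff: (forall d1 d2 : nat, Lp (cheb j * onp (n + d1)%N * onp (n + d2)%N) @[n --> \oo] --> kron j d1 d2) /\
  (forall d1 d2 : nat, Lp (cheb j.+1 * onp (n + d1)%N * onp (n + d2)%N) @[n --> \oo] --> kron j.+1 d1 d2).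
  by case.
have rec p k m : Lp ('X * p * onp k.+1 * onp m) =
    aa k.+2 * Lp (p * onp k.+2 * onp m) + aa k.+1 * Lp (p * onp k * onp m).
  rewrite -(LpZ l0 a0) -(LpZ l0 a0) -LpD//; congr Lp.
  have := mulX_onp l0 a0 k; move: (onp _) (onp _) (onp _) (onp _) => P Q S U e.
  have -> : 'X * p * U * P = p * ('X * U) * P by ring.
  by rewrite e mulrDr mulrDl -!scalerAr -!scalerAl.
elim: j {d1 d2} => [|j [IH1 IH2]]; split=> // d1 d2.
- apply: cvg_near_cst; apply: nearW => n; rewrite /cheb /= mul1r Lp_onp// eqn_add2l /kron !addn0.
  by rewrite (eq_sym d2); field.
(* The shift by 1 makes the first index positive, as the three-term recurrence requires, and keeps
   the lowered index a natural offset. *)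
- rewrite -(cvg_shiftn 1); rewrite /cheb /=.
  have h : aa (n + (d1 + 2))%N * ((d1 + 2 == d2 + 1)%N%:R : R) + aa (n + (d1 + 1))%N * (d1 == d2 + 1)%N%:R
      @[n --> \oo] --> (2^-1 * (d1 + 2 == d2 + 1)%N%:R + 2^-1 * (d1 == d2 + 1)%N%:R : R).
    by apply: cvgD; apply: cvgMl; exact: aa_shift_cvg.
  have -> : kron 1 d1 d2 = 2^-1 * (d1 + 2 == d2 + 1)%N%:R + 2^-1 * (d1 == d2 + 1)%N%:R.
    rewrite /kron (_ : (d1 + 2)%N = (d1 + 1 + 1)%N) ?eqn_add2r -?addnA//.
    by rewrite (eq_sym d2); field.
  apply: cvg_trans h; apply: near_eq_cvg; apply: nearW => n.
  have := rec 1 (n + d1)%N (n + 1 + d2)%N; rewrite mulr1 !mul1r !Lp_onp//.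
  have -> : (n + d1).+1 = (n + 1 + d1)%N by rewrite addn1 addSn.
  move=> ->; have e0 (d : nat) : (n + 1 + d = n + (d + 1))%N by rewrite -addnA (addnC 1%N).
  have e1 : ((n + (d1 + 1)).+1 = n + (d1 + 2))%N by rewrite addn1 addn2 !addnS.
  by rewrite !e0 e1 !eqn_add2l.
- rewrite -(cvg_shiftn 1).
  have h : 2 * (aa (n + (d1 + 2))%N * Lp (cheb j.+1 * onp (n + (d1 + 2))%N * onp (n + (d2 + 1))%N) +
      aa (n + (d1 + 1))%N * Lp (cheb j.+1 * onp (n + d1)%N * onp (n + (d2 + 1))%N)) -
      Lp (cheb j * onp (n + 1 + d1)%N * onp (n + 1 + d2)%N)
      @[n --> \oo] --> 2 * (2^-1 * kron j.+1 (d1 + 2)%N (d2 + 1)%N + 2^-1 * kron j.+1 d1 (d2 + 1)%N) - kron j d1 d2.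
    apply: cvgB; last by rewrite (cvg_shiftn 1 (fun n => Lp (cheb j * onp (n + d1)%N * onp (n + d2)%N))); exact: IH1.
    apply: cvgMr; apply: cvgD; (apply: cvgM; [exact: aa_shift_cvg|exact: IH2]).
  have -> : kron j.+2 d1 d2 = 2 * (2^-1 * kron j.+1 (d1 + 2)%N (d2 + 1)%N + 2^-1 * kron j.+1 d1 (d2 + 1)%N) - kron j d1 d2.
    rewrite /kron !addn1 !addn2 !addnS !addSn !eqSS.
    by field.
  apply: cvg_trans h; apply: near_eq_cvg; apply: nearW => n.
  rewrite /= chebSS !mulrBl LpB// -!scalerAl LpZ//.
  have := rec (cheb j.+1) (n + d1)%N (n + 1 + d2)%N.
  have -> : (n + d1).+1 = (n + 1 + d1)%N by rewrite addn1 addSn.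
  move=> ->; have e0 (d : nat) : (n + 1 + d = n + (d + 1))%N by rewrite -addnA (addnC 1%N).
  have e1 : ((n + (d1 + 1)).+1 = n + (d1 + 2))%N by rewrite addn1 addn2 !addnS.
  by rewrite !e0 e1.
Qed.

Lemma cheb_sqr_moment_cvg j : Lp (cheb j.+1 * onp n * onp n) @[n --> \oo] --> (0 : R).
Proof.
have := @cheb_moment_cvg j.+1 0 0; rewrite /kron !add0n /= addr0 mul0r.
by under eq_fun do rewrite !addn0.
Qed.

Definition mean n f : R := RInt (fun t => f t * ((onp n).[xt t] ^+ 2 * W t)).

Lemma sqr_onp_W_ge0 n t : 0 <= (onp n).[xt t] ^+ 2 * W t.
Proof. by apply: mulr_ge0; [exact: sqr_ge0|exact/ltW/W_gt0]. Qed.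

Lemma sqr_onp_W_continuous n : continuous (fun t => (onp n).[xt t] ^+ 2 * W t).
Proof.
move=> t; apply: (@continuousM R R (fun t => (onp n).[xt t] ^+ 2) W); last exact: W_continuous.
by rewrite (_ : (fun t => _) = fun t => (onp n ^+ 2).[xt t]);
  [exact: horner_xt_continuous|apply/funext => u; rewrite horner_exp].
Qed.

Lemma sqr_onp_W_itg n : itg (fun t => (onp n).[xt t] ^+ 2 * W t).
Proof.
by have := horner_W_itg l0 a0 (onp n ^+ 2); congr itg; apply/funext => t; rewrite horner_exp.
Qed.

Lemma sqr_onp_W_int n : RInt (fun t => (onp n).[xt t] ^+ 2 * W t) = 1.
Proof.
transitivity (Lp (onp n * onp n)); last by rewrite Lp_onp// eqxx.
congr RInt.
by apply/funext => t; rewrite hornerM expr2.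
Qed.

Lemma mean_itg n f (M : R) : continuous f -> (forall t, `|f t| <= M) ->
  itg (fun t => f t * ((onp n).[xt t] ^+ 2 * W t)).
Proof.
move=> cf fM; apply: itg_le (itgZ M (sqr_onp_W_itg n)).
  apply: continuous_measurable_fun => t.
  apply: (@continuousM R R f (fun t => (onp n).[xt t] ^+ 2 * W t)); first exact: cf.
  exact: sqr_onp_W_continuous.
by move=> t; rewrite normrM (ger0_norm (sqr_onp_W_ge0 n t)) ler_wpM2r// sqr_onp_W_ge0.
Qed.

Lemma mean_norm_le n f (M : R) : continuous f -> (forall t, `|f t| <= M) -> `|mean n f| <= M.
Proof.
move=> cf fM; rewrite -[leRHS]mulr1 -(sqr_onp_W_int n) -intZ; last exact: sqr_onp_W_itg.
apply: int_norm_le; [exact: mean_itg fM|exact/itgZ/sqr_onp_W_itg|] => t.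
by rewrite normrM (ger0_norm (sqr_onp_W_ge0 n t)) ler_wpM2r// sqr_onp_W_ge0.
Qed.

Lemma mean_horner n p : mean n (fun t => p.[xt t]) = Lp (p * onp n * onp n).
Proof.
by congr RInt; apply/funext => t; rewrite !hornerM; ring.
Qed.

Lemma rr_le2 y : rr y <= 2.
Proof.
have y0 := sqr_ge0 y; rewrite /rr ler_pdivrMr ?sqrD1_gt0//; move: (y ^+ 2) y0 => z z0; lra.
Qed.

Lemma rr_norm_le2 y : `|rr y| <= 2.
Proof. by rewrite ger0_norm ?rr_ge0// rr_le2. Qed.

Lemma mean_rr_itg n s : itg (fun t => rr (s * t) * ((onp n).[xt t] ^+ 2 * W t)).
Proof. exact: (@mean_itg n _ 2 (@rr_scale_continuous R s) (fun t => rr_norm_le2 (s * t))). Qed.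

Section PoissonKernel.
Variable q : R.
Hypothesis q0 : 0 < q.

Let rho : R := (1 - q) / (1 + q).

Let q1 : 1 + q != 0. Proof. by rewrite gt_eqF// addr_gt0. Qed.

Let rho1 : `|rho| < 1.
Proof.
rewrite normrM normfV (@gtr0_norm _ (1 + q)) ?addr_gt0// ltr_pdivrMr ?addr_gt0// mul1r.
by rewrite ltr_norml; have := q0; lra.
Qed.

(** Partial sum of a Poisson-kernel expansion: [rr (q t)] is [2 q / (1 + q)] times [1 + 2 / (1 + q)
    sum_j rho^j T_(2 j + 2)(x)], with [x = xt t] and [|rho| < 1]. In the limit of the means only the
    constant term is left. *)
Let P M : {poly R} := (2 * q / (1 + q)) *:
  (1 + (2 / (1 + q)) *: \sum_(j < M) rho ^+ j *: cheb (2 * j.+1)).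

Let Pcvg M : mean n (fun t => (P M).[xt t]) @[n --> \oo] --> 2 * q / (1 + q).
Proof.
have e n : Lp (P M * onp n * onp n) = 2 * q / (1 + q) * (1 + 2 / (1 + q) *
    \sum_(j < M) rho ^+ j * Lp (cheb (2 * j.+1) * onp n * onp n)).
  have gen (A B : R) S o : Lp (A *: (1 + B *: S) * o * o) = A * (Lp (o * o) + B * Lp (S * o * o)).
    by rewrite -!scalerAl LpZ// 2!mulrDl mul1r LpD// -!scalerAl LpZ.
  rewrite /P gen Lp_onp// eqxx; congr (_ * (_ + _ * _)).
  rewrite !mulr_suml Lp_sum//; apply: eq_bigr => j _.
  by rewrite -!scalerAl LpZ.
have -> : (fun n => mean n (fun t => (P M).[xt t])) = fun n => 2 * q / (1 + q) * (1 + 2 / (1 + q) *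
    \sum_(j < M) rho ^+ j * Lp (cheb (2 * j.+1) * onp n * onp n)).
  by apply/funext => n; rewrite mean_horner e.
rewrite -[X in _ --> X](_ : 2 * q / (1 + q) * (1 + 2 / (1 + q) * (\sum_(j < M) rho ^+ j * 0)) = _); last first.
  by rewrite big1 ?mulr0 ?addr0 ?mulr1// => j _; rewrite mulr0.
apply: cvgMr; apply: cvgD; first exact: cvg_cst.
apply: cvgMr; elim: M {e} => [|M IH].
  rewrite big_ord0 (_ : (fun _ => _) = fun=> 0); first exact: cvg_cst.
  by apply/funext => n; rewrite big_ord0.
rewrite big_ord_recr/= (_ : (fun n => _) = fun n => \sum_(j < M) rho ^+ j * Lp (cheb (2 * j.+1) * onp n * onp n) +
  rho ^+ M * Lp (cheb (2 * M.+1) * onp n * onp n)); last first.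
  by apply/funext => n; rewrite big_ord_recr.
apply: cvgD; first exact: IH.
by apply: cvgMr; rewrite mulnS; exact: cheb_sqr_moment_cvg.
Qed.

Let rem_le M t : `|rr (q * t) - (P M).[xt t]| <=
  2 * q / (1 + q) * (2 / (1 + q)) * (2 / (1 - `|rho|) ^+ 2) * `|rho| ^+ M.
Proof.
pose s := acos (xt t); pose c j : R := cos ((2 * j)%N%:R * s).
have xs : xt t = cos s by rewrite acosK// in_itv/= -ler_norml; exact/ltW/xt_lt1.
pose D := 1 - 2 * rho * c 1%N + rho ^+ 2.
have cSS j : c j.+2 = 2 * c 1%N * c j.+1 - c j.
  rewrite /c; have -> : (2 * j.+2)%N%:R * s = (2 * j.+1)%N%:R * s + (2 * 1)%N%:R * s.
    by rewrite -mulrDl -natrD -mulnDr addn1.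
  have -> : (2 * j)%N%:R * s = (2 * j.+1)%N%:R * s - (2 * 1)%N%:R * s.
    by rewrite -[j.+1]addn1 mulnDr natrD; ring.
  by rewrite cosB cosD; ring.
(* Multiplied by the Poisson denominator [D], the sum telescopes by the three-term recurrence [cSS],
   with an explicit remainder of order [rho^M]. *)
have tele : D * \sum_(j < M) rho ^+ j * c j.+1 = c 1%N - rho - rho ^+ M * c M.+1 + rho ^+ M.+1 * c M.
  elim: M => [|M IH].
    by rewrite big_ord0 /c muln0 mul0r cos0 expr0 expr1; ring.
  rewrite big_ord_recr/= mulrDr IH cSS /D !exprS; ring.
have c1 j : `|c j| <= 1 by rewrite ler_norml cos_geN1 cos_le1.
have ec1 : c 1%N = 2 * xt t ^+ 2 - 1.
  rewrite /c muln1 xs (_ : 2%:R * s = s + s); last by ring.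
  by rewrite cosD -!expr2 sin2cos2; ring.
have Dge : (1 - `|rho|) ^+ 2 <= D.
  have : rho * c 1%N <= `|rho|.
    by apply: le_trans (ler_norm _) _; rewrite normrM ler_piMr.
  rewrite /D; have -> : rho ^+ 2 = `|rho| ^+ 2 by rewrite real_normK ?num_real.
  by rewrite -mulrA; move: (rho * _) `|rho| => u v; lra.
have r1 : 0 < 1 - `|rho| by rewrite subr_gt0.
have r2 : 0 < (1 - `|rho|) ^+ 2 by rewrite exprn_gt0.
have D0 : 0 < D by apply: lt_le_trans Dge.
have Pt : (P M).[xt t] = 2 * q / (1 + q) * (1 + 2 / (1 + q) * \sum_(j < M) rho ^+ j * c j.+1).
  rewrite /P hornerZ hornerD hornerC hornerZ horner_sum; congr (_ * (_ + _ * _)).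
  by apply: eq_bigr => j _; rewrite hornerZ cheb_xt.
have eS : \sum_(j < M) rho ^+ j * c j.+1 = (c 1%N - rho - rho ^+ M * c M.+1 + rho ^+ M.+1 * c M) / D.
  by rewrite -tele mulrC mulKf// gt_eqF.
have er : rr (q * t) = 2 * q / (1 + q) * (1 + 2 / (1 + q) * ((c 1%N - rho) / D)).
  have eD : D = 4 * (1 + (q * t) ^+ 2) / (1 + t ^+ 2) / (1 + q) ^+ 2.
    rewrite /D ec1 xt_sqr /cauchy /rho; have tn := sqrD1_neq0 t.
    by field; rewrite tn q1.
  rewrite eD ec1 xt_sqr /cauchy /rho /rr.
  have tn := sqrD1_neq0 t; have qn := sqrD1_neq0 (q * t).
  by field; rewrite tn q1 -?exprMn qn.
rewrite Pt er eS.
have -> : 2 * q / (1 + q) * (1 + 2 / (1 + q) * ((c 1%N - rho) / D)) -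
    2 * q / (1 + q) * (1 + 2 / (1 + q) * ((c 1%N - rho - rho ^+ M * c M.+1 + rho ^+ M.+1 * c M) / D)) =
    2 * q / (1 + q) * (2 / (1 + q)) * ((rho ^+ M * c M.+1 - rho ^+ M.+1 * c M) / D) by ring.
have k0 : 0 <= 2 * q / (1 + q) * (2 / (1 + q)).
  by rewrite !mulr_ge0 ?invr_ge0 ?addr_ge0 ?(ltW q0).
rewrite normrM (ger0_norm k0) -[leRHS]mulrA ler_wpM2l// normrM normfV (gtr0_norm D0).
have gen (r x y : R) : `|r| <= 1 -> `|x| <= 1 -> `|y| <= 1 ->
    `|r ^+ M * x - r ^+ M.+1 * y| <= 2 * `|r| ^+ M.
  move=> r1' x1 y1; apply: le_trans (ler_normB _ _) _; rewrite !normrM !normrX exprS.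
  have z0 : 0 <= `|r| ^+ M by rewrite exprn_ge0.
  have h1 : `|r| ^+ M * `|x| <= `|r| ^+ M by rewrite ler_piMr.
  have h2 := ler_wpM2r z0 (mulr_ile1 (normr_ge0 r) (normr_ge0 y) r1' y1).
  by move: `|r| (`|r| ^+ M) `|x| `|y| h1 h2 => v z e f; lra.
have n1 : `|rho ^+ M * c M.+1 - rho ^+ M.+1 * c M| <= 2 * `|rho| ^+ M.
  by apply: gen => //; exact/ltW/rho1.
have -> : 2 / (1 - `|rho|) ^+ 2 * `|rho| ^+ M = (2 * `|rho| ^+ M) / (1 - `|rho|) ^+ 2 by ring.
by apply: ler_pM => //; rewrite ?invr_ge0 ?(ltW D0)// lef_pV2.
Qed.

Lemma mean_rr_cvg : mean n (fun t => rr (q * t)) @[n --> \oo] --> 2 * q / (1 + q).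
Proof.
pose K := 2 * q / (1 + q) * (2 / (1 + q)) * (2 / (1 - `|rho|) ^+ 2).
apply: (@cvg_uniform_approx _ (fun M n => mean n (fun t => (P M).[xt t])) (fun M => K * `|rho| ^+ M) (fun=> 2 * q / (1 + q))).
- move=> M n; rewrite /mean -intB; [|exact: mean_rr_itg|]; last first.
    by apply: (mean_itg n (@horner_xt_continuous _ (P M))) => t; exact: horner_xt_le.
  have -> : (fun t => rr (q * t) * ((onp n).[xt t] ^+ 2 * W t) - (P M).[xt t] * ((onp n).[xt t] ^+ 2 * W t)) =
     (fun t => (rr (q * t) - (P M).[xt t]) * ((onp n).[xt t] ^+ 2 * W t)).
    by apply/funext => t; rewrite mulrBl.
  apply: (@mean_norm_le n (fun t => rr (q * t) - (P M).[xt t])); last by move=> t; exact: rem_le.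
  move=> t; apply: (@continuousB R R R (fun t => rr (q * t)) (fun t => (P M).[xt t])).
    exact: rr_scale_continuous.
  exact: horner_xt_continuous.
- rewrite -[X in _ --> X](mulr0 K); apply: cvgMr; apply: cvg_expr.
  by rewrite normr_id.
- exact: Pcvg.
- exact: cvg_cst.
Qed.

End PoissonKernel.

End WeakLimit.

(** * A uniform resolvent bound *)

Section ResolventBound.
Context {R : realType}.
Implicit Types (f g F : R -> R) (x y b c d h s t u r z : R) (p q : {poly R}).

Local Notation mu := (@lebesgue_measure R).

Variables (l a : R).
Hypotheses (l0 : 0 < l) (a0 : 0 <= a).

Local Notation W := (W l a).
Local Notation Lp := (Lp l a).
Local Notation alpha := (alpha l a).
Local Notation aa := (aa l a).
Local Notation onp := (onp l a).
Local Notation mean := (mean l a).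
Local Notation monic_pol := (monic_pol l a).

(** A common lower bound of the [alpha k.+1]: the factors [(k + 1) / (k + 1 + l + a)] and
    [(k + 2 l) / (k + l + a)] are at least [1 / (1 + l + a)] and [l / (2 l + a)]. *)
Let m2 : R := l / (4 * (1 + (l + a)) * (2 * l + a)).

Let m2_gt0 : 0 < m2.
Proof. by have := l0; have := a0 => ? ?; rewrite divr_gt0// !mulr_gt0//; lra. Qed.

Let m : R := Num.sqrt m2.

Let m_gt0 : 0 < m. Proof. by rewrite sqrtr_gt0. Qed.

Let aa_ge k : m <= aa k.+1.
Proof.
apply: ler_wsqrtr; rewrite /m2 /alpha -[k.+1%:R]natr1.
have := ler0n R k; have := l0; have := a0; move: (k%:R) => x a1 l1 x0.
rewrite ler_pdivrMr; last by rewrite !mulr_gt0//; lra.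
rewrite mulrAC ler_pdivlMr; last by rewrite !mulr_gt0//; lra.
have h1 : x + 1 + (l + a) <= (x + 1) * (1 + (l + a)).
  by have : 0 <= x * (l + a) by [rewrite mulr_ge0//; lra]; lra.
have h2 : l * (x + (l + a)) <= (x + 2 * l) * (2 * l + a).
  have : 0 <= x * (l + a) by rewrite mulr_ge0//; lra.
  have : 0 <= l * (l + a) by rewrite mulr_ge0//; lra.
  have : 0 <= l * l by rewrite mulr_ge0//; lra.
  lra.
have h3 : (x + 1 + (l + a)) * (l * (x + (l + a))) <= (x + 1) * (1 + (l + a)) * ((x + 2 * l) * (2 * l + a)).
  by apply: ler_pM => //; [lra|rewrite mulr_ge0//; lra].
lra.
Qed.

(** The ratio bound is the statement that the induction can carry. It gives positivity at 1, and
    since [aa k.+1] is at most [(k + 2 (l + a)) / (2 (k + l + a))] it makes the orthonormal values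
    [g] nondecreasing. *)
Let monic1 k : 0 < (monic_pol k).[1] /\
  (k%:R + 2 * (l + a)) * (monic_pol k).[1] <= (monic_pol k.+1).[1] * (2 * (k%:R + (l + a))).
Proof.
elim: k => [|k [IH0 IH]].
  by rewrite monic_pol0 monic_pol1 hornerC hornerX; split=> //; lra.
have := ler0n R k; have := l0; have := a0 => a1 l1 x0.
have p1 : 0 < (monic_pol k.+1).[1].
  have h : 0 < (k%:R + 2 * (l + a)) * (monic_pol k).[1] by rewrite mulr_gt0//; lra.
  have := lt_le_trans h IH; rewrite pmulr_lgt0//; lra.
split=> //; rewrite monic_polSS !(hornerD, hornerN, hornerM, hornerZ, hornerX) mul1r /alpha -natr1.
move: (k%:R) ((monic_pol k).[1]) ((monic_pol k.+1).[1]) IH0 IH p1 x0 => x u v u0 uv v0 x0.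
set c := l + a in uv *; have lc : l <= c by rewrite /c; lra.
have c0 : 0 < c by lra.
have -> : (v - (x + 1) * (x + 1 + 2 * l - 1) / (4 * (x + 1 + c) * (x + 1 + c - 1)) * u) * (2 * (x + 1 + c)) =
  2 * (x + 1 + c) * v - (x + 1) * (x + 2 * l) * u / (2 * (x + c)).
  by field; rewrite !gt_eqF//; lra.
have h1 : (x + 2 * l) * u <= v * (2 * (x + c)).
  by apply: le_trans uv; rewrite ler_pM2r//; lra.
have h2 : (x + 1) * (x + 2 * l) * u / (2 * (x + c)) <= (x + 1) * v.
  rewrite ler_pdivrMr; last lra.
  by rewrite -!mulrA ler_pM2l//; lra.
lra.
Qed.

Let g k : R := (onp k).[1].

Let g_gt0 k : 0 < g k.
Proof. by rewrite /g hornerZ mulr_gt0 ?invr_gt0 ?sqrtr_gt0 ?sqnorm_gt0// (proj1 (monic1 k)). Qed.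

Let g_le k : g k <= g k.+1.
Proof.
have [u0 uv] := monic1 k; rewrite /g /onp !hornerZ sqnormS sqrtrM ?(ltW (sqnorm_gt0 _ _ _))//.
have s0 : 0 < Num.sqrt (sqnorm l a k) by rewrite sqrtr_gt0 sqnorm_gt0.
rewrite invfM -mulrA ler_pM2l ?invr_gt0// mulrC ler_pdivlMr; last exact: aa_gt0.
have := ler0n R k; have := l0; have := a0 => a1 l1 x0.
pose y := (k%:R + 2 * (l + a)) / (2 * (k%:R + (l + a))).
have y0 : 0 <= y by rewrite divr_ge0//; lra.
have ay : aa k.+1 <= y.
  rewrite -[leRHS]ger0_norm// -sqrtr_sqr; apply: ler_wsqrtr.
  rewrite /alpha -natr1 /y; move: (k%:R) x0 => x x0.
  rewrite expr_div_n ler_pdivrMr; last by rewrite !mulr_gt0//; lra.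
  rewrite mulrAC ler_pdivlMr; last by rewrite exprn_gt0//; lra.
  have -> : (x + 1) * (x + 1 + 2 * l - 1) * (2 * (x + (l + a))) ^+ 2 =
    4 * (x + (l + a)) * ((x + 2 * l) * ((x + 1) * (x + (l + a)))) by ring.
  have -> : (x + 2 * (l + a)) ^+ 2 * (4 * (x + 1 + (l + a)) * (x + 1 + (l + a) - 1)) =
    4 * (x + (l + a)) * ((x + 2 * (l + a)) * ((x + 1 + (l + a)) * (x + 2 * (l + a)))) by ring.
  rewrite ler_pM2l; last lra.
  apply: ler_pM; [lra|by rewrite mulr_ge0//; lra|lra|].
  by apply: ler_pM; lra.
apply: le_trans (_ : (monic_pol k).[1] * y <= _); first by rewrite ler_pM2l.
rewrite /y mulrA ler_pdivrMr; last lra.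
by rewrite mulrC.
Qed.

Let g_mono n k : (n <= k)%N -> g n <= g k.
Proof.
elim: k => [|k IH]; first by rewrite leqn0 => /eqP ->.
by rewrite leq_eqVlt => /predU1P[->//|]; rewrite ltnS => /IH h; apply: le_trans h (g_le k).
Qed.

Let g_rec0 : g 0 = aa 1 * g 1.
Proof.
have := mulX_onp0 l0 a0; rewrite /g; move: (onp 0) (onp 1) => P Q /(congr1 (horner^~ 1)).
by rewrite hornerM hornerX mul1r hornerZ.
Qed.

Let g_rec k : g k.+1 = aa k.+2 * g k.+2 + aa k.+1 * g k.
Proof.
have := mulX_onp l0 a0 k; rewrite /g; move: (onp k) (onp k.+1) (onp k.+2) => P Q S.
by move=> /(congr1 (horner^~ 1)); rewrite hornerM hornerX mul1r hornerD !hornerZ.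
Qed.

(* The sequence [g] solves [J g = g], so [1 - J] is a weighted Dirichlet form in [f / g]. *)
Let ground_state (f : nat -> R) N :
  \sum_(k < N.+1) (f k ^+ 2 - 2 * aa k.+1 * f k * f k.+1) =
  \sum_(k < N.+1) aa k.+1 * g k * g k.+1 * (f k / g k - f k.+1 / g k.+1) ^+ 2
  - aa N.+1 * g N / g N.+1 * f N.+1 ^+ 2.
Proof.
elim: N => [|N IH].
  rewrite !big_ord1; have n0 := lt0r_neq0 (g_gt0 0); have n1 := lt0r_neq0 (g_gt0 1).
  have a1 : aa 1 = g 0 / g 1 by rewrite g_rec0 mulfK.
  by rewrite a1; field; rewrite n0 n1.
rewrite big_ord_recr/= IH [in RHS]big_ord_recr/=; move: (\sum_(_ < _) _) => S.
have n0 := lt0r_neq0 (g_gt0 N); have n1 := lt0r_neq0 (g_gt0 N.+1); have n2 := lt0r_neq0 (g_gt0 N.+2).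
have e : aa N.+2 = (g N.+1 - aa N.+1 * g N) / g N.+2.
  by rewrite (g_rec N) addrK mulfK.
rewrite e; move: (f N.+1) (f N.+2) (g N) (g N.+1) (g N.+2) (aa N.+1) n0 n1 n2 => u v G H K A n0 n1 n2.
by field; rewrite n1 n2.
Qed.

(* AM-GM with weight [nu], after [g n] has been bounded by [g k] and [g k.+1] *)
Let step_le (A G0 G1 u0 u1 h nu : R) : 0 < nu -> m <= A -> 0 < h -> h <= G0 -> h <= G1 ->
  2 * h ^+ 2 * ((u0 / G0) ^+ 2 - (u1 / G1) ^+ 2) <=
  nu * (A * G0 * G1 * (u0 / G0 - u1 / G1) ^+ 2) + 2 / (nu * m) * (u0 ^+ 2 + u1 ^+ 2).
Proof.
move=> nu0 mA h0 hG0 hG1.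
have G00 : 0 < G0 by apply: lt_le_trans hG0.
have G10 : 0 < G1 by apply: lt_le_trans hG1.
have A0 : 0 < A by apply: lt_le_trans mA; exact: m_gt0.
pose x := u0 / G0; pose y := u1 / G1.
have e0 : u0 = x * G0 by rewrite divfK// gt_eqF.
have e1 : u1 = y * G1 by rewrite divfK// gt_eqF.
rewrite -/x -/y e0 e1 {e0 e1}; move: x y => x y.
have hh : h ^+ 2 <= G0 * G1 by rewrite expr2 ler_pM// ltW.
have hx : h ^+ 2 * x ^+ 2 <= (x * G0) ^+ 2.
  by rewrite exprMn mulrC ler_wpM2l ?sqr_ge0// lerXn2r ?nnegrE ?(ltW h0) ?(ltW G00).
have hy : h ^+ 2 * y ^+ 2 <= (y * G1) ^+ 2.
  by rewrite exprMn mulrC ler_wpM2l ?sqr_ge0// lerXn2r ?nnegrE ?(ltW h0) ?(ltW G10).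
have h2 : 0 <= h ^+ 2 by exact: sqr_ge0.
have hS : h ^+ 2 * (h ^+ 2 * (x + y) ^+ 2) <= G0 * G1 * (2 * ((x * G0) ^+ 2 + (y * G1) ^+ 2)).
  apply: ler_pM => //; first by rewrite mulr_ge0 ?sqr_ge0.
  apply: le_trans (_ : h ^+ 2 * (2 * (x ^+ 2 + y ^+ 2)) <= _).
    by rewrite ler_wpM2l//; have := sqr_ge0 (x - y); rewrite !expr2; lra.
  lra.
have P0 : 0 < nu * (A * (G0 * G1)) by rewrite !mulr_gt0.
have main : 2 * h ^+ 2 * (x ^+ 2 - y ^+ 2) <=
    nu * (A * G0 * G1 * (x - y) ^+ 2) + 2 / (nu * A) * ((x * G0) ^+ 2 + (y * G1) ^+ 2).
  rewrite -(ler_pM2l P0).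
  have -> : nu * (A * (G0 * G1)) * (nu * (A * G0 * G1 * (x - y) ^+ 2) + 2 / (nu * A) * ((x * G0) ^+ 2 + (y * G1) ^+ 2)) =
    (nu * (A * (G0 * G1)) * (x - y)) ^+ 2 + G0 * G1 * (2 * ((x * G0) ^+ 2 + (y * G1) ^+ 2)).
    by field; rewrite !gt_eqF.
  have := sqr_ge0 (nu * (A * (G0 * G1)) * (x - y) - h ^+ 2 * (x + y)).
  move: hS; move: (nu * (A * (G0 * G1))) (G0 * G1 * (2 * ((x * G0) ^+ 2 + (y * G1) ^+ 2))) (h ^+ 2).
  by move=> P Z H hS sq; move: hS sq; rewrite !expr2; lra.
apply: le_trans main _; rewrite lerD2l ler_wpM2r ?addr_ge0 ?sqr_ge0//.
by rewrite ler_wpM2l// lef_pV2 ?posrE ?mulr_gt0// ler_pM2l.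
Qed.

(** [(f n / g n)^2] is a telescoping sum over [n <= k <= N], as [f] vanishes at [N + 1];
    monotonicity of [g] makes [step_le] applicable to each term with [h = g n]. Minimised over [nu],
    the bound reads [f_n^4 <= (4 / m) |f|^2 <(1 - J) f, f>]. *)
Let nash (f : nat -> R) n N nu : (n <= N)%N -> f N.+1 = 0 -> 0 < nu ->
  2 * f n ^+ 2 <= nu * (\sum_(k < N.+1) (f k ^+ 2 - 2 * aa k.+1 * f k * f k.+1)) +
    4 / (nu * m) * \sum_(k < N.+1) f k ^+ 2.
Proof.
move=> nN fN nu0; rewrite ground_state fN expr0n/= mulr0 subr0.
pose T k := nu * (aa k.+1 * g k * g k.+1 * (f k / g k - f k.+1 / g k.+1) ^+ 2) +
  2 / (nu * m) * (f k ^+ 2 + f k.+1 ^+ 2).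
have T0 k : 0 <= T k.
  apply: addr_ge0; apply: mulr_ge0.
  - exact: ltW.
  - apply: mulr_ge0; last exact: sqr_ge0.
    by rewrite mulr_ge0 ?(ltW (g_gt0 _))// mulr_ge0 ?(ltW (g_gt0 _))// ltW// aa_gt0.
  - by rewrite divr_ge0// mulr_ge0 ?(ltW nu0)// ltW// m_gt0.
  - by rewrite addr_ge0 ?sqr_ge0.
have e1 : 2 * f n ^+ 2 = \sum_(n <= k < N.+1) 2 * g n ^+ 2 * ((f k / g k) ^+ 2 - (f k.+1 / g k.+1) ^+ 2).
  rewrite -mulr_sumr; have -> : \sum_(n <= k < N.+1) ((f k / g k) ^+ 2 - (f k.+1 / g k.+1) ^+ 2) =
      - \sum_(n <= k < N.+1) ((f k.+1 / g k.+1) ^+ 2 - (f k / g k) ^+ 2).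
    by rewrite -sumrN; apply: eq_bigr => k _; rewrite opprB.
  rewrite (telescope_sumr (fun k => (f k / g k) ^+ 2)) ?(leq_trans nN)// fN mul0r expr0n/=.
  by have := lt0r_neq0 (g_gt0 n) => gn; field; rewrite gn.
have h1 : 2 * f n ^+ 2 <= \sum_(n <= k < N.+1) T k.
  rewrite e1 big_nat_cond [leRHS]big_nat_cond; apply: ler_sum => k /andP[/andP[nk _] _].
  by apply: (step_le _ _ nu0 (aa_ge k) (g_gt0 n)); [exact: g_mono|apply: g_mono; exact: leqW].
have h2 : \sum_(n <= k < N.+1) T k <= \sum_(k < N.+1) T k.
  rewrite -(big_mkord predT T) [leRHS](@big_cat_nat _ _ _ n)//= ?(leqW nN)// lerDr.
  exact: sumr_ge0.
apply: le_trans h1 (le_trans h2 _).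
rewrite big_split/= -!mulr_sumr lerD2l.
have -> : 4 / (nu * m) * \sum_(k < N.+1) f k ^+ 2 = 2 / (nu * m) * (2 * \sum_(k < N.+1) f k ^+ 2) by ring.
have k0 : 0 <= 2 / (nu * m) by rewrite divr_ge0// mulr_ge0// ltW// m_gt0.
rewrite ler_wpM2l// big_split/= mulr2n mulrDl mul1r lerD2l.
rewrite big_ord_recr/= fN expr0n/= addr0 [leRHS]big_ord_recl/=.
by rewrite lerDr sqr_ge0.
Qed.

Let Lp_sum_sqr p N : (size p <= N.+1)%N ->
  \sum_(k < N.+1) Lp (p * onp k) ^+ 2 = Lp (p * p) /\
  \sum_(k < N.+1) 2 * aa k.+1 * Lp (p * onp k) * Lp (p * onp k.+1) = Lp ('X * p * p).
Proof.
move=> pN; pose f k := Lp (p * onp k).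
have ep : p = \sum_(k < N.+1) f k *: onp k by exact: onp_expansion.
have LpE q : Lp (q * p) = \sum_(k < N.+1) f k * Lp (q * onp k).
  by rewrite {1}ep mulr_sumr Lp_sum//; apply: eq_bigr => k _; rewrite -scalerAr LpZ.
have fN : f N.+1 = 0 by exact: Lp_monic_onp.
split; first by rewrite LpE; apply: eq_bigr => k _; rewrite expr2.
have e0 : Lp ('X * p * onp 0) = aa 1 * f 1%N.
  by rewrite mulrAC mulX_onp0// -scalerAl LpZ// [onp 1 * p]mulrC.
have eS k : Lp ('X * p * onp k.+1) = aa k.+2 * f k.+2 + aa k.+1 * f k.
  have gen (A B : R) P Q : Lp ((A *: P + B *: Q) * p) = A * Lp (p * P) + B * Lp (p * Q).
    by rewrite mulrDl -!scalerAl LpD// !LpZ// [P * p]mulrC [Q * p]mulrC.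
  by rewrite mulrAC mulX_onp// gen.
rewrite LpE [RHS]big_ord_recl/= e0.
rewrite (eq_bigr (fun k : 'I_N => aa k.+2 * f k.+1 * f k.+2 + aa k.+1 * f k * f k.+1)); last first.
  by move=> k _; rewrite /bump/= add1n eS; ring.
rewrite big_split/=.
have -> : \sum_(k < N.+1) 2 * aa k.+1 * Lp (p * onp k) * Lp (p * onp k.+1) =
   \sum_(k < N.+1) aa k.+1 * f k * f k.+1 + \sum_(k < N.+1) aa k.+1 * f k * f k.+1.
  by rewrite -big_split/=; apply: eq_bigr => k _; rewrite /f; ring.
rewrite {1}big_ord_recl/= [X in _ + X = _]big_ord_recr/= fN mulr0 addr0 addrA; congr (_ + _).
by congr (_ + _); ring.
Qed.

(** The Nash inequality for the Fourier coefficients of [p], which vanish beyond its degree;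
    Parseval's identity turns both sums into values of [Lp]. *)
Lemma Lp_onp_sqr_le p n nu : 0 < nu -> 2 * Lp (p * onp n) ^+ 2 <=
  nu * (Lp (p * p) - Lp ('X * p * p)) + 4 / (nu * m) * Lp (p * p).
Proof.
move=> nu0; pose N := maxn n (size p).
have pN : (size p <= N.+1)%N by rewrite (leq_trans (leq_maxr n _)).
have [<- <-] := Lp_sum_sqr pN.
rewrite -sumrB; apply: (@nash (fun k => Lp (p * onp k))) => //; first exact: leq_maxl.
exact: Lp_monic_onp.
Qed.

Let K : R := (Num.sqrt m)^-1.

Let sm0 : 0 < Num.sqrt m. Proof. by rewrite sqrtr_gt0 m_gt0. Qed.

(** The mean of [q] is the [n]-th Fourier coefficient of [q p_n], which is where the inequality is
    applied. The choice of [nu] satisfies [4 / (nu m) = nu s^2], so that the two terms combine into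
    the factor [1 + s^2 - x]. *)
Let mean_sqr_le q n s : 0 < s ->
  mean n (fun t => q.[xt t]) ^+ 2 <= K / s * mean n (fun t => (1 + s ^+ 2 - xt t) * q.[xt t] ^+ 2).
Proof.
move=> s0; pose nu := 2 * K / s.
have K0 : 0 < K by rewrite invr_gt0 sm0.
have nu0 : 0 < nu by rewrite /nu divr_gt0// mulr_gt0.
have -> : mean n (fun t => q.[xt t]) = Lp (q * onp n * onp n) by rewrite mean_horner.
have -> : mean n (fun t => (1 + s ^+ 2 - xt t) * q.[xt t] ^+ 2) =
    (1 + s ^+ 2) * Lp (q * onp n * (q * onp n)) - Lp ('X * (q * onp n) * (q * onp n)).
  rewrite -(LpZ l0 a0) -(LpB l0 a0) /mean; congr RInt; apply/funext => t.
  by rewrite !(hornerD, hornerN, hornerM, hornerZ, hornerX); ring.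
have := Lp_onp_sqr_le (q * onp n) n nu0.
have -> : 4 / (nu * m) = nu * s ^+ 2.
  have er : Num.sqrt m ^+ 2 = m by rewrite sqr_sqrtr// ltW// m_gt0.
  have := sm0; rewrite /nu /K; move: (Num.sqrt m) er => r <- r0.
  by field; rewrite !gt_eqF.
move: (Lp _) (Lp _) (Lp _) => A B C; rewrite /nu -!mulrA; move: (K / s) => k; lra.
Qed.

(** At [q = 1 / (z - x)], [z = 1 + s^2], the preceding bound says [I^2 <= (K / s) I] for the mean
    [I] of [q]. The resolvent is not a polynomial and is reached through the partial sums [Q M] of
    its Neumann series, convergent because [z > 1]. *)
Lemma mean_resolvent_le n s : 0 < s -> mean n (fun t => (1 + s ^+ 2 - xt t)^-1) <= K / s.
Proof.
move=> s0; pose z := 1 + s ^+ 2.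
have z1 : 1 < z by rewrite ltrDl exprn_gt0.
have z0 : 0 < z by apply: lt_trans z1.
have xz t : `|xt t| < z by apply: lt_trans (xt_lt1 t) z1.
have zx t : 0 < z - xt t by rewrite subr_gt0 (le_lt_trans (ler_norm _)).
have zx1 t : z - 1 <= z - xt t by rewrite lerB// (le_trans (ler_norm _))// ltW// xt_lt1.
have z10 : 0 < z - 1 by rewrite subr_gt0.
have zxV t : (z - xt t)^-1 <= (z - 1)^-1 by rewrite lef_pV2 ?posrE.
pose Q M : {poly R} := \sum_(k < M) (z ^- k.+1) *: 'X^k.
have QE M t : (Q M).[xt t] = (1 - (xt t / z) ^+ M) / (z - xt t).
  apply: (mulIf (lt0r_neq0 (zx t))); rewrite divfK ?gt_eqF//.
  elim: M => [|M IH]; first by rewrite /Q big_ord0 hornerC mul0r expr0 subrr.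
  rewrite /Q big_ord_recr/= hornerD mulrDl IH hornerZ hornerXn !exprS expr_div_n.
  have zn := lt0r_neq0 z0; have zMn : z ^+ M != 0 by rewrite expf_neq0.
  by field; rewrite zn zMn.
have y1 t : `|xt t / z| < 1 by rewrite normrM normfV (gtr0_norm z0) ltr_pdivrMr// mul1r.
have yM M t : `|1 - (xt t / z) ^+ M| <= 2.
  apply: le_trans (ler_normB _ _) _; rewrite normr1 normrX.
  have : `|xt t / z| ^+ M <= 1 by rewrite exprn_ile1// ltW.
  by move: (_ ^+ M) => w; lra.
have yc t : 1 - (xt t / z) ^+ n @[n --> \oo] --> (1 : R).
  by rewrite -[X in _ --> X]subr0; apply: cvgB; [exact: cvg_cst|exact: cvg_expr].
pose w t := (onp n).[xt t] ^+ 2 * W t.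
have w0 t : 0 <= w t by exact: sqr_onp_W_ge0.
have iw : itg (fun t => 4 * (z - 1)^-1 * w t) by exact/itgZ/sqr_onp_W_itg.
have mQ M : measurable_fun setT (fun t => (Q M).[xt t] * w t).
  apply: itg_measurable; apply: (mean_itg l0 a0 n (@horner_xt_continuous _ (Q M))).
  exact: horner_xt_le.
have cQ2 M : continuous (fun t => (z - xt t) * (Q M).[xt t] ^+ 2).
  have -> : (fun t => (z - xt t) * (Q M).[xt t] ^+ 2) = fun t => ((z%:P - 'X) * Q M ^+ 2).[xt t].
    by apply/funext => t; rewrite hornerM horner_exp hornerD hornerN hornerC hornerX.
  exact: horner_xt_continuous.
have Q2_le M t : `|(z - xt t) * (Q M).[xt t] ^+ 2| <= 4 * (z - 1)^-1.
  have -> : (z - xt t) * (Q M).[xt t] ^+ 2 = (1 - (xt t / z) ^+ M) ^+ 2 / (z - xt t).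
    by rewrite QE; have := lt0r_neq0 (zx t) => zn; field; rewrite ?zn ?(lt0r_neq0 z0).
  rewrite normrM ler_pM//; last by rewrite gtr0_norm ?invr_gt0.
  rewrite normrX; have := yM M t; move: `|_| (normr_ge0 (1 - (xt t / z) ^+ M)) => v v0 v2.
  by have : v * v <= 2 * 2 by [rewrite ler_pM]; rewrite expr2; lra.
have mQ2 M : measurable_fun setT (fun t => (z - xt t) * (Q M).[xt t] ^+ 2 * w t).
  by apply: itg_measurable; exact: (mean_itg l0 a0 n (cQ2 M) (Q2_le M)).
have [||i1 l1] := @int_dct _ (fun M t => (Q M).[xt t] * w t) (fun t => (z - xt t)^-1 * w t) _ mQ iw.
- move=> M t; rewrite normrM (ger0_norm (w0 t)) ler_wpM2r// QE normrM.
  apply: le_trans (_ : 2 * (z - 1)^-1 <= _); last first.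
    by rewrite ler_wpM2r ?invr_ge0 ?(ltW z10)//; lra.
  by rewrite ler_pM// gtr0_norm ?invr_gt0.
- move=> t; have h := yc t.
  have h2 : (1 - (xt t / z) ^+ n) / (z - xt t) * w t @[n --> \oo] --> 1 / (z - xt t) * w t.
    by apply: cvgMl; apply: cvgMl; exact: h.
  by rewrite div1r in h2; under eq_fun do rewrite QE; exact: h2.
have [||i2 l2] := @int_dct _ (fun M t => (z - xt t) * (Q M).[xt t] ^+ 2 * w t) (fun t => (z - xt t)^-1 * w t) _ mQ2 iw.
- by move=> M t; rewrite normrM (ger0_norm (w0 t)) ler_wpM2r.
- move=> t; have h := yc t.
  have h2 : (1 - (xt t / z) ^+ n) * (1 - (xt t / z) ^+ n) / (z - xt t) * w t @[n --> \oo] --> 1 * 1 / (z - xt t) * w t.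
    by apply: cvgMl; apply: cvgMl; apply: cvgM; exact: h.
  rewrite mulr1 div1r in h2; apply: cvg_trans h2; apply: near_eq_cvg; apply: nearW => M.
  by rewrite QE; have := lt0r_neq0 (zx t) => zn; field; rewrite ?zn ?(lt0r_neq0 z0).
pose I := mean n (fun t => (z - xt t)^-1).
have I2 : I ^+ 2 <= K / s * I.
  have l3 : mean n (fun t => (Q M).[xt t]) ^+ 2 @[M --> \oo] --> I ^+ 2.
    by rewrite /I !expr2; under eq_fun do rewrite expr2; apply: cvgM; exact: l1.
  have l4 : K / s * mean n (fun t => (z - xt t) * (Q M).[xt t] ^+ 2) @[M --> \oo] --> K / s * I.
    by apply: cvgMr; exact: l2.
  by apply: (ler_cvg_to l3 l4); apply: nearW => M; exact: mean_sqr_le.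
have I0 : 0 <= I by apply: int_ge0 => t; apply: mulr_ge0; [rewrite invr_ge0 ltW|exact: w0].
rewrite -/z -/I; move: I0; rewrite le_eqVlt => /predU1P[<-|I0].
  by rewrite divr_ge0 ?(ltW s0)// invr_ge0 ltW// sm0.
by rewrite -(ler_pM2r I0) -expr2.
Qed.

Lemma mean_opp n f : continuous f -> mean n (fun t => f (- t)) = mean n f.
Proof.
move=> cf; rewrite /mean -(@opp_int _ (fun t => f t * ((onp n).[xt t] ^+ 2 * W t))); last first.
  move=> t; apply: (@continuousM R R f (fun t => (onp n).[xt t] ^+ 2 * W t)); first exact: cf.
  exact: sqr_onp_W_continuous.
congr RInt; apply/funext => t; rewrite W_even//.
have -> : xt (- t) = - xt t by rewrite /xt sqrrN mulNr.
by rewrite onp_sqr_even.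
Qed.

Lemma mean_le n (u v : R -> R) (M N : R) : continuous u -> continuous v ->
  (forall t, `|u t| <= M) -> (forall t, `|v t| <= N) -> (forall t, u t <= v t) ->
  mean n u <= mean n v.
Proof.
move=> cu cv uM vN uv; apply: int_le; [exact: mean_itg uM|exact: mean_itg vN|] => t.
by rewrite ler_wpM2r// sqr_onp_W_ge0.
Qed.

(** For [s <= 1] and [z = 1 + s^2], [rr (s t)] is at most [4 s^2 (1 / (z - x) + 1 / (z + x))]; both
    resolvents have the same mean by parity, so the bound is [8 s^2 K / s]. For [s > 1] the trivial
    bound 2 is enough. *)
Lemma mean_rr_le : exists2 C, 0 <= C & forall n s, 0 < s -> mean n (fun t => rr (s * t)) <= C * s.
Proof.
have K0 : 0 < K by rewrite invr_gt0 sm0.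
exists (8 * K + 2); first by rewrite addr_ge0// mulr_ge0// ltW.
move=> n s s0; have [s1|s1] := leP s 1; last first.
  apply: le_trans (ler_norm _) (le_trans (mean_norm_le l0 a0 n (@rr_scale_continuous R s) (fun t => rr_norm_le2 (s * t))) _).
  have : 0 <= K * s by apply: mulr_ge0; exact: ltW.
  lra.
pose z := 1 + s ^+ 2; have ss0 : 0 < s ^+ 2 by rewrite exprn_gt0.
have z1 : 1 < z by rewrite ltrDl.
have x1 t : - 1 < xt t < 1 by rewrite -ltr_norml xt_lt1.
have zx t : 0 < z - xt t by have := x1 t; lra.
have zx' t : 0 < z + xt t by have := x1 t; lra.
pose f1 t := (z - xt t)^-1; pose f2 t := (z + xt t)^-1.
have cf1 : continuous f1 by exact: zx_inv_continuous.
have xN t : xt (- t) = - xt t by rewrite /xt sqrrN mulNr.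
have f2E : f2 = fun t => f1 (- t) by apply/funext => t; rewrite /f1 /f2 xN opprK.
have cf2 : continuous f2.
  move=> t; rewrite f2E; apply: continuous_comp; first exact: oppr_continuous.
  exact: cf1.
have f1_le t : `|f1 t| <= (z - 1)^-1.
  rewrite gtr0_norm ?invr_gt0// lef_pV2 ?posrE ?subr_gt0//; have := x1 t; lra.
have f2_le t : `|f2 t| <= (z - 1)^-1 by rewrite f2E.
have e : mean n (fun t => 4 * s ^+ 2 * (f1 t + f2 t)) = 8 * s ^+ 2 * mean n f1.
  have i1 := mean_itg l0 a0 n cf1 f1_le; have i2 := mean_itg l0 a0 n cf2 f2_le.
  have -> : mean n (fun t => 4 * s ^+ 2 * (f1 t + f2 t)) = 4 * s ^+ 2 * (mean n f1 + mean n f2).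
    rewrite /mean -intD// -intZ; last exact: itgD.
    by congr RInt; apply/funext => t; ring.
  by rewrite f2E mean_opp//; ring.
apply: le_trans (_ : 8 * s ^+ 2 * mean n f1 <= _); last first.
  have := mean_resolvent_le n s0; rewrite -/z -/f1 => h.
  have := ler_wpM2l (ltW ss0) h.
  have -> : s ^+ 2 * (K / s) = K * s by field; rewrite gt_eqF.
  by move: (mean n f1) => I hI; rewrite -mulrA; lra.
rewrite -e; apply: (@mean_le n _ _ 2 (4 * s ^+ 2 * ((z - 1)^-1 + (z - 1)^-1))).
- exact: rr_scale_continuous.
- move=> t; apply: (@continuousM R R (fun=> 4 * s ^+ 2) (fun t => f1 t + f2 t)); first exact: cst_continuous.
  by apply: (@continuousD R R R f1 f2); [exact: cf1|exact: cf2].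
- by move=> t; exact: rr_norm_le2.
- have k4 : 0 <= 4 * s ^+ 2 by rewrite mulr_ge0// sqr_ge0.
  move=> t; rewrite normrM (ger0_norm k4); apply: (ler_wpM2l k4).
  by apply: le_trans (ler_normD _ _) _; rewrite lerD.
move=> t; rewrite /f1 /f2.
have p2 : 0 < z ^+ 2 - xt t ^+ 2.
  by rewrite subr_sqr mulr_gt0.
have -> : 4 * s ^+ 2 * ((z - xt t)^-1 + (z + xt t)^-1) = 8 * s ^+ 2 * z / (z ^+ 2 - xt t ^+ 2).
  by field; rewrite !gt_eqF.
rewrite /rr ler_pdivlMr// mulrAC ler_pdivrMr ?sqrD1_gt0//.
have xx : xt t ^+ 2 * (1 + t ^+ 2) = t ^+ 2.
  by rewrite xt_sqr /cauchy -mulrA mulVf ?mulr1// sqrD1_neq0.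
have x01 : xt t ^+ 2 <= 1 by rewrite -real_normK ?num_real// expr_le1// ltW// xt_lt1.
have h1 : t ^+ 2 * (z ^+ 2 - xt t ^+ 2) <= 1 + 3 * (s * t) ^+ 2.
  have -> : t ^+ 2 * (z ^+ 2 - xt t ^+ 2) = xt t ^+ 2 + 2 * (s * t) ^+ 2 + s ^+ 2 * (s * t) ^+ 2.
    apply/eqP; rewrite -subr_eq0; apply/eqP.
    have -> : t ^+ 2 * (z ^+ 2 - xt t ^+ 2) - (xt t ^+ 2 + 2 * (s * t) ^+ 2 + s ^+ 2 * (s * t) ^+ 2) =
      t ^+ 2 - xt t ^+ 2 * (1 + t ^+ 2) by rewrite /z; ring.
    by rewrite xx subrr.
  have : s ^+ 2 * (s * t) ^+ 2 <= (s * t) ^+ 2.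
    by rewrite ler_piMl ?sqr_ge0// expr_le1// ltW.
  move: x01; move: ((s * t) ^+ 2) (xt t ^+ 2) (s ^+ 2) => B X S; lra.
have -> : 2 * (s * t) ^+ 2 * (z ^+ 2 - xt t ^+ 2) = 2 * s ^+ 2 * (t ^+ 2 * (z ^+ 2 - xt t ^+ 2)) by rewrite exprMn; ring.
have -> : 8 * s ^+ 2 * z * (1 + (s * t) ^+ 2) = 2 * s ^+ 2 * (4 * z * (1 + (s * t) ^+ 2)) by ring.
have k2 : 0 <= 2 * s ^+ 2 by rewrite mulr_ge0// ltW.
apply: (ler_wpM2l k2); apply: le_trans h1 _.
have := sqr_ge0 (s * t); move: ((s * t) ^+ 2) => B B0.
have : 0 <= (z - 1) * (1 + B) by rewrite mulr_ge0//; lra.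
lra.
Qed.

End ResolventBound.

(** * Logarithmic moments *)

Section LogarithmicMoments.
Context {R : realType}.
Implicit Types (f g F : R -> R) (x y b c d h s t u r z : R) (p : {poly R}).

Local Notation mu := (@lebesgue_measure R).

Variables (l a : R).
Hypotheses (l0 : 0 < l) (a0 : 0 <= a).

Local Notation W := (W l a).
Local Notation onp := (onp l a).
Local Notation mean := (mean l a).
Local Notation qk := (qk l a).

Lemma ell_ge0 y : 0 <= ell y.
Proof. by apply: ln_ge0; rewrite lerDl sqr_ge0. Qed.

Lemma ell_le y : ell y <= y ^+ 2.
Proof. by apply: le_ln1Dx; apply: lt_le_trans (sqr_ge0 y); rewrite ltrN10. Qed.

Lemma ell_scale_continuous s : continuous (fun t => ell (s * t)).
Proof. rewrite /ell; contd; exact: sqrD1_gt0. Qed.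

Lemma ln_le_powR u : 0 < u -> ln u <= u `^ l / l.
Proof.
move=> u0; rewrite ler_pdivlMr// mulrC -ln_powR; apply/ltW/ln_sublinear.
exact: powR_gt0.
Qed.

(** For [a = 0] the weight decays only like [(1 + t^2)^(- l - 1)]. Bounding the logarithm by a
    multiple of [(1 + t^2)^l] leaves exactly the integrable [cauchy]. *)
Lemma ell_W_le q t : ell (q * t) * W t <=
  wconst l a * gint l ^+ 2 * ((1 + q ^+ 2) `^ l / l) * cauchy t.
Proof.
have K0 : 0 <= wconst l a * gint l ^+ 2.
  by apply: mulr_ge0; [exact/ltW/wconst_gt0|exact: sqr_ge0].
have c0 := ltW (cauchy_gt0 t).
have w1 : W t <= wconst l a * gint l ^+ 2 * (1 + t ^+ 2) `^ (- l) * cauchy t.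
  apply: le_trans (W_le l0 a0 t) _; rewrite ler_wpM2r//.
  by rewrite ler_piMr ?expR_atan_le1//; apply: mulr_ge0; [exact: K0|exact: powR_ge0].
have e1 : ell (q * t) <= (1 + q ^+ 2) `^ l / l * (1 + t ^+ 2) `^ l.
  apply: le_trans (ln_le_powR (sqrD1_gt0 _)) _; rewrite mulrAC ler_wpM2r ?invr_ge0 ?(ltW l0)//.
  rewrite -powRM ?(ltW (sqrD1_gt0 _))//; apply: ge0_ler_powR; rewrite ?nnegrE ?(ltW l0)//.
  - exact/ltW/sqrD1_gt0.
  - by apply: mulr_ge0; exact/ltW/sqrD1_gt0.
  - have := sqr_ge0 q; have := sqr_ge0 t; rewrite exprMn.
    by move: (q ^+ 2) (t ^+ 2) => x y x0 y0; lra.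
have pp : (1 + t ^+ 2) `^ l * (1 + t ^+ 2) `^ (- l) = 1.
  by rewrite -powRD ?addrN ?powRr0// sqrD1_neq0 implybT.
apply: le_trans (ler_pM (ell_ge0 _) (ltW (W_gt0 l0 a0 t)) e1 w1) _.
rewrite le_eqVlt; apply/orP; left; apply/eqP.
move: (wconst l a * _) (_ `^ l / l) (_ `^ l) (_ `^ (- l)) pp => A B P Q pp.
have -> : B * P * (A * Q * cauchy t) = A * B * (P * Q) * cauchy t by ring.
by rewrite pp mulr1.
Qed.

Lemma mean_ell_itg n q : itg (fun t => ell (q * t) * ((onp n).[xt t] ^+ 2 * W t)).
Proof.
apply: itg_le (itgZ (coef_norm (onp n) ^+ 2 * (wconst l a * gint l ^+ 2 * ((1 + q ^+ 2) `^ l / l))) cauchy_itg).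
  apply: continuous_measurable_fun => t.
  apply: (@continuousM R R (fun t => ell (q * t)) (fun t => (onp n).[xt t] ^+ 2 * W t)).
    exact: ell_scale_continuous.
  exact: sqr_onp_W_continuous.
move=> t; rewrite normrM (ger0_norm (ell_ge0 _)) (ger0_norm (sqr_onp_W_ge0 l0 a0 n t)).
rewrite mulrCA -[leRHS]mulrA; apply: ler_pM (ell_W_le q t).
- exact: sqr_ge0.
- by apply: mulr_ge0; [exact: ell_ge0|exact/ltW/W_gt0].
- by rewrite -real_normK ?num_real// lerXn2r ?nnegrE ?coef_norm_ge0// horner_xt_le.
Qed.

(** Valid at [s = 0] as well, where division by 0 gives 0; the right side is continuous in [s]. *)
Let rr_div s t : rr (s * t) / s = 2 * s * t ^+ 2 / (1 + (s * t) ^+ 2).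
Proof.
have [->|s0] := eqVneq s 0; first by rewrite invr0 !mulr0 !mul0r.
by rewrite /rr; field; rewrite s0 -?exprMn sqrD1_neq0.
Qed.

(* [ell (q t)] is the integral of [rr (s t) / s] over [0 <= s <= q]. *)
Lemma mean_ell_rr n q : 0 < q ->
  itg (fun s => \1_`[0, q] s * (mean n (fun t => rr (s * t)) / s)) /\
  mean n (fun t => ell (q * t)) = RInt (fun s => \1_`[0, q] s * (mean n (fun t => rr (s * t)) / s)).
Proof.
move=> q0; pose w t := (onp n).[xt t] ^+ 2 * W t.
have w0 t : 0 <= w t by exact: sqr_onp_W_ge0.
have cw : continuous w by exact: sqr_onp_W_continuous.
(* The quotient [rr (s t) / s] is written without [s] in the denominator, which gives measurability
   on the plane and continuity in [s]. *)
pose f t s := \1_`[0, q] s * (2 * s * t ^+ 2 / (1 + (s * t) ^+ 2)) * w t.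
have ind01 s : 0 <= (\1_`[0, q] s : R) by rewrite indicE.
have mq : measurable (`[0, q]%classic : set R) by exact: measurable_itv.
have iq : itg (\1_`[0, q] : R -> R).
  apply: itg_le (itgZ (1 + q ^+ 2) cauchy_itg); first exact: measurable_indic.
  move=> s; rewrite (ger0_norm (ind01 s)) indicE mem_setE in_itv/=.
  have [/andP[s0 sq]|_] := boolP (0 <= s <= q); last first.
    by rewrite mulr_ge0 ?(ltW (sqrD1_gt0 _)) ?(ltW (cauchy_gt0 _)).
  rewrite /cauchy ler_pdivlMr ?sqrD1_gt0// mul1r lerD2l lerXn2r ?nnegrE//.
  exact: le_trans sq.
have fs t : RInt (f t) = ell (q * t) * w t.
  rewrite /f; have -> : (fun s => \1_`[0, q] s * (2 * s * t ^+ 2 / (1 + (s * t) ^+ 2)) * w t) =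
      fun s => w t * (\1_`[0, q] s * (2 * s * t ^+ 2 / (1 + (s * t) ^+ 2))).
    by apply/funext => s; ring.
  have ik : itg (fun s => \1_`[0, q] s * (2 * s * t ^+ 2 / (1 + (s * t) ^+ 2))).
    apply: itg_le (itgZ (2 * q * t ^+ 2) iq).
      apply: measurable_funM; first exact: measurable_indic.
      by apply: continuous_measurable_fun; contd; exact: sqrD1_neq0.
    move=> s; rewrite indicE mem_setE in_itv/=.
    have [/andP[s0 sq]|_] := boolP (0 <= s <= q); last by rewrite mul0r normr0 mulr0.
    rewrite mul1r mulr1 ger0_norm; last first.
      by rewrite divr_ge0 ?(ltW (sqrD1_gt0 _))// mulr_ge0 ?sqr_ge0// mulr_ge0.
    rewrite ler_pdivrMr ?sqrD1_gt0//.
    apply: le_trans (_ : 2 * q * t ^+ 2 <= _).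
      by rewrite ler_wpM2r ?sqr_ge0// ler_wpM2l.
    apply: ler_peMr; last by rewrite lerDl sqr_ge0.
    by apply: mulr_ge0; [rewrite mulr_ge0// ltW|exact: sqr_ge0].
  rewrite intZ// mulrC; congr (_ * _).
  have -> : ell (q * t) = ell (q * t) - ell (0 * t).
    by rewrite mul0r /ell expr0n/= addr0 ln1 subr0.
  notypeclasses refine (@int_derive_segment _ (fun s => ell (s * t)) _ _ _ q0 _ _).
  - move=> s _; rewrite /ell; derc; first exact: sqrD1_gt0.
    by rewrite expr1; field; exact: sqrD1_neq0.
  - by move=> s _; eapply is_derive_continuous; der; exact: sqrD1_neq0.
have fE t s : f t s = \1_`[0, q] s / s * (rr (s * t) * w t).
  by rewrite /f -rr_div; ring.
have f0 t s : 0 <= f t s.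
  rewrite /f indicE mem_setE in_itv/=; have [/andP[s0 _]|_] := boolP (0 <= s <= q); last by rewrite !mul0r.
  rewrite mul1r; apply: mulr_ge0; last exact: w0.
  by rewrite divr_ge0 ?(ltW (sqrD1_gt0 _))// mulr_ge0 ?sqr_ge0// mulr_ge0.
have ft s : itg (fun t => f t s).
  have := itgZ (\1_`[0, q] s / s) (mean_rr_itg l0 a0 n s); congr itg.
  by apply/funext => t; rewrite fE.
have fst t : itg (f t).
  apply: itg_le (itgZ (2 * q * t ^+ 2 * w t) iq).
    have -> : f t = fun s => \1_`[0, q] s * (2 * s * t ^+ 2 / (1 + (s * t) ^+ 2) * w t).
      by apply/funext => s; rewrite /f; ring.
    apply: measurable_funM; first exact: measurable_indic.
    by apply: continuous_measurable_fun; contd; exact: sqrD1_neq0.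
  move=> s; rewrite (ger0_norm (f0 t s)) /f indicE mem_setE in_itv/=.
  have [/andP[s0 sq]|_] := boolP (0 <= s <= q); last by rewrite !mul0r mulr0.
  rewrite mul1r mulr1 ler_wpM2r// ler_pdivrMr ?sqrD1_gt0//.
  apply: le_trans (_ : 2 * q * t ^+ 2 <= _).
    by rewrite ler_wpM2r ?sqr_ge0// ler_wpM2l.
  apply: ler_peMr; last by rewrite lerDl sqr_ge0.
    by apply: mulr_ge0; [rewrite mulr_ge0// ltW|exact: sqr_ge0].
have [||i1 i2 e] := @fubini _ f _ fst ft.
- apply: measurable_funM; last exact: measurable_fst_comp.
  apply: measurable_funM.
    by apply: measurableT_comp => //; exact: measurable_indic.
  have m2 : measurable_fun setT (fun z : R * R => z.2 * z.1).
    by apply: measurable_funM; [exact: measurable_snd_comp continuous_id|exact: measurable_fst_comp continuous_id].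
  have -> : (fun z : R * R => 2 * z.2 * z.1 ^+ 2 / (1 + (z.2 * z.1) ^+ 2)) =
     (fun z : R * R => (2 * z.2) * (z.1 ^+ 2) * cauchy (z.2 * z.1)) by [].
  apply: measurable_funM; last by apply: (measurable_comp2 _ m2); exact: cauchy_continuous.
  apply: measurable_funM.
    by apply: (@measurable_snd_comp _ (fun s => 2 * s)); contd.
  by apply: (@measurable_fst_comp _ (fun s => s ^+ 2)); contd.
- have -> : (fun t => RInt (fun s => `|f t s|)) = fun t => ell (q * t) * w t.
    apply/funext => t; rewrite -fs; congr RInt; apply/funext => s.
    by rewrite ger0_norm.
  exact: mean_ell_itg.
have e2 : (fun s => RInt (fun t => f t s)) = fun s => \1_`[0, q] s * (mean n (fun t => rr (s * t)) / s).
  apply/funext => s; rewrite /mean mulrA mulrAC -intZ; last exact: mean_rr_itg.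
  by congr RInt; apply/funext => t; rewrite fE.
rewrite -e2; split=> //; rewrite -e /mean; congr RInt.
by apply/funext => t; rewrite fs.
Qed.

Lemma mean_ell_cvg q : 0 <= q -> mean n (fun t => ell (q * t)) @[n --> \oo] --> 2 * ln (1 + q).
Proof.
rewrite le_eqVlt => /predU1P[<-|q0].
  rewrite addr0 ln1 mulr0; apply: cvg_near_cst; apply: nearW => n.
  by rewrite -[RHS]int0; congr RInt; apply/funext => t; rewrite mul0r /ell expr0n/= addr0 ln1 mul0r.
have [C C0 hC] := mean_rr_le l0 a0.
have mq : measurable (`[0, q]%classic : set R) by exact: measurable_itv.
have iq : itg (fun s => C * \1_`[0, q] s).
  apply: itgZ; apply: itg_le (itgZ (1 + q ^+ 2) cauchy_itg); first exact: measurable_indic.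
  move=> s; rewrite indicE mem_setE in_itv/=.
  have [/andP[s0 sq]|_] := boolP (0 <= s <= q); last first.
    by rewrite normr0 mulr_ge0 ?(ltW (sqrD1_gt0 _)) ?(ltW (cauchy_gt0 _)).
  rewrite normr1 /cauchy ler_pdivlMr ?sqrD1_gt0// mul1r lerD2l lerXn2r ?nnegrE//.
  exact: le_trans sq.
have mean_ge0 n s : 0 <= mean n (fun t => rr (s * t)).
  by apply: int_ge0 => t; apply: mulr_ge0; [exact: rr_ge0|exact: sqr_onp_W_ge0].
(* The factor [(s != 0)] is there because the sequence is 0 at [s = 0] by the convention on
   division, whereas [2 / (1 + s)] is not; the point is removed afterwards as a null set. *)
have [|||_ h] := @int_dct _ (fun n s => \1_`[0, q] s * (mean n (fun t => rr (s * t)) / s))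
  (fun s => \1_`[0, q] s * (2 / (1 + s) * (s != 0)%:R)) _ _ iq.
- by move=> n; apply: itg_measurable; exact: (proj1 (mean_ell_rr n q0)).
- move=> n s; rewrite indicE mem_setE in_itv/=.
  have [/andP[s0 sq]|_] := boolP (0 <= s <= q); last by rewrite mul0r normr0 mulr0.
  rewrite mul1r mulr1; move: s0; rewrite le_eqVlt => /predU1P[<-|s0]; first by rewrite invr0 mulr0 normr0.
  by rewrite ger0_norm ?divr_ge0 ?(ltW s0)// ler_pdivrMr// hC.
- move=> s; rewrite indicE mem_setE in_itv/=.
  have [/andP[s0 sq]|_] := boolP (0 <= s <= q); last first.
    by rewrite mul0r; under eq_fun do rewrite mul0r; exact: cvg_cst.
  apply: cvgMr; move: s0; rewrite le_eqVlt => /predU1P[<-|s0].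
    by rewrite eqxx mulr0 invr0; under eq_fun do rewrite mulr0; exact: cvg_cst.
  rewrite gt_eqF// mulr1; have -> : 2 / (1 + s) = 2 * s / (1 + s) / s.
    by field; rewrite !gt_eqF// addr_gt0.
  by apply: cvgMl; exact: mean_rr_cvg.
have -> : 2 * ln (1 + q) = RInt (fun s => \1_`[0, q] s * (2 / (1 + s) * (s != 0)%:R)).
  have -> : RInt (fun s => \1_`[0, q] s * (2 / (1 + s) * (s != 0)%:R)) = RInt (fun s => \1_`[0, q] s * (2 / (1 + s))).
    have cg s : 0 <= s -> {for s, continuous (fun s => 2 / (1 + s))}.
      by move=> s0; eapply is_derive_continuous; der; rewrite gt_eqF// ltr_wpDr.
    have ig : mu.-integrable `[0, q] (EFin \o (fun s => 2 / (1 + s))).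
      apply: continuous_compact_integrable; first exact: segment_compact.
      by apply: continuous_in_subspaceT => s; rewrite inE/= in_itv/= => /andP[s0 _]; exact: cg.
    have ig1 : mu.-integrable `]0, q] (EFin \o (fun s => 2 / (1 + s))).
      by apply: integrableS ig => //; exact: subset_itv_oc_cc.
    have E1 : {in (`]0, q]%classic : set R), (fun s => 2 / (1 + s) * (s != 0)%:R) =1 (fun s => 2 / (1 + s))}.
      by move=> s; rewrite inE/= in_itv/= => /andP[s0 _]; rewrite gt_eqF// mulr1.
    rewrite -!I_mkcond -!Rintegral_itv_obnd_cbnd//; first exact: eq_Rintegral.
    by apply: eq_integrable ig1 => // s sD /=; rewrite E1.
  have -> : 2 * ln (1 + q) = 2 * ln (1 + q) - 2 * ln (1 + 0) by rewrite addr0 ln1 mulr0 subr0.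
  apply/esym; notypeclasses refine (@int_derive_segment _ (fun s => 2 * ln (1 + s)) _ _ _ q0 _ _).
  - move=> s /andP[s0 _]; derc; first by rewrite ltr_wpDr.
    by field; rewrite gt_eqF// ltr_wpDr.
  - by move=> s /andP[s0 _]; eapply is_derive_continuous; der; rewrite gt_eqF// ltr_wpDr.
apply: cvg_trans h; apply: near_eq_cvg; apply: nearW => n.
by rewrite (proj2 (mean_ell_rr n q0)).
Qed.

End LogarithmicMoments.

(** * The Gamma factor: limit and sum over [k] *)

Section GammaFactor.
Context {R : realType}.
Implicit Types (f g F : R -> R) (x y b c d h s t u r z : R) (p : {poly R}).

Local Notation mu := (@lebesgue_measure R).

Variables (l a : R).
Hypotheses (l0 : 0 < l) (a0 : 0 <= a).

Local Notation W := (W l a).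
Local Notation onp := (onp l a).
Local Notation mean := (mean l a).
Local Notation qk := (qk l a).
Local Notation RS := (RS l a).

(* Abel summation: [ell (qk k t) - rr (qk k t)] is [psi k t] up to a telescoping term, and
   only the [psi k] have summable means. The telescoping term vanishes pointwise but not in
   the mean: this is the origin of the constant [2 a]. *)
Definition psi (k : nat) t : R :=
  (l + k.+1%:R) * (ell (qk k * t) - ell (qk k.+1 * t)) - rr (qk k * t).

(** With [b = l + k], [(b + 1) (2 b + 1) / (2 b^2) = 1 + (3 + 1 / b) / (2 b)], and [b >= l]. *)
Let B1 : R := (3 + l^-1) / 2.

Let B1_ge0 : 0 <= B1. Proof. by rewrite divr_ge0// addr_ge0// invr_ge0 ltW. Qed.

Let b_gt0 k : 0 < l + k%:R. Proof. by rewrite ltr_wpDr. Qed.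

(** [1 - 1 / u <= ln u <= u - 1] at the ratio of two consecutive Weierstrass factors: multiplied by
    [l + k + 1], both bounds are [rr (qk k * t)] up to a relative error [B1 / (l + k)]. This extra
    power and [<r_q> <= C q] make the means of order [(l + k)^(-2)], hence summable. *)
Lemma psi_norm_le k t : `|psi k t| <= B1 / (l + k%:R) * rr (qk k * t).
Proof.
have lb : l <= l + k%:R by rewrite lerDl.
rewrite /psi /ell /rr /qk -[k.+1%:R]natr1 addrA; move: (l + k%:R) (b_gt0 k) lb => b b0 lb.
have b10 : 0 < b + 1 by rewrite addr_gt0.
have v0 : 0 <= (a * t) ^+ 2 by exact: sqr_ge0.
have -> : (a / b * t) ^+ 2 = (a * t) ^+ 2 / b ^+ 2 by field; rewrite gt_eqF.
have -> : (a / (b + 1) * t) ^+ 2 = (a * t) ^+ 2 / (b + 1) ^+ 2 by field; rewrite gt_eqF.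
move: ((a * t) ^+ 2) v0 => v v0.
have bb0 : 0 < b ^+ 2 by rewrite exprn_gt0.
have bb1 : 0 < (b + 1) ^+ 2 by rewrite exprn_gt0.
have X0 : 0 < 1 + v / b ^+ 2 by rewrite ltr_pwDl// divr_ge0// ltW.
have Y0 : 0 < 1 + v / (b + 1) ^+ 2 by rewrite ltr_pwDl// divr_ge0// ltW.
have vb : 0 < b ^+ 2 + v by rewrite ltr_wpDr.
have vb1 : 0 < (b + 1) ^+ 2 + v by rewrite ltr_wpDr.
have lnle u : 0 < u -> ln u <= u - 1.
  by move=> u0; rewrite -{1}(subrK 1 u) addrC; apply: le_ln1Dx; rewrite ltrBrDr addNr.
rewrite -ln_div ?posrE//.
have U := lnle _ (divr_gt0 X0 Y0).
have L : 1 - (1 + v / (b + 1) ^+ 2) / (1 + v / b ^+ 2) <= ln ((1 + v / b ^+ 2) / (1 + v / (b + 1) ^+ 2)).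
  have := lnle _ (divr_gt0 Y0 X0); rewrite -invf_div lnV ?posrE ?divr_gt0//.
  move: (ln ((1 + v / b ^+ 2) / (1 + v / (b + 1) ^+ 2))) ((1 + v / b ^+ 2) / (1 + v / (b + 1) ^+ 2))^-1.
  by move=> e1 e2; lra.
have -> : 2 * (v / b ^+ 2) / (1 + v / b ^+ 2) = 2 * v / (b ^+ 2 + v).
  by field; rewrite !gt_eqF//= -?expr2 ?gt_eqF.
have Ue : (1 + v / b ^+ 2) / (1 + v / (b + 1) ^+ 2) - 1 = v * (2 * b + 1) / (b ^+ 2 * ((b + 1) ^+ 2 + v)).
  by field; rewrite !gt_eqF//= -?expr2 ?gt_eqF.
have Le : 1 - (1 + v / (b + 1) ^+ 2) / (1 + v / b ^+ 2) = v * (2 * b + 1) / ((b + 1) ^+ 2 * (b ^+ 2 + v)).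
  by field; rewrite !gt_eqF//= -?expr2 ?gt_eqF.
rewrite Ue in U; rewrite Le in L.
set r := 2 * v / (b ^+ 2 + v).
have r0 : 0 <= r by rewrite divr_ge0 ?mulr_ge0// ltW.
have Bb : 3 / 2 + b^-1 / 2 <= B1.
  have : b^-1 <= l^-1 by rewrite lef_pV2 ?posrE.
  by rewrite /B1; lra.
have hU : (b + 1) * (v * (2 * b + 1) / (b ^+ 2 * ((b + 1) ^+ 2 + v))) <= (1 + B1 / b) * r.
  apply: le_trans (_ : (b + 1) * (v * (2 * b + 1) / (b ^+ 2 * (b ^+ 2 + v))) <= _).
    rewrite ler_wpM2l ?(ltW b10)// ler_wpM2l ?mulr_ge0 ?addr_ge0 ?mulr_ge0 ?(ltW b0)//.
    rewrite lef_pV2 ?posrE ?mulr_gt0// ler_pM2l// lerD2r lerXn2r ?nnegrE ?(ltW b0) ?(ltW b10)//.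
    by rewrite lerDl.
  have -> : (b + 1) * (v * (2 * b + 1) / (b ^+ 2 * (b ^+ 2 + v))) = (1 + (3 / 2 + b^-1 / 2) / b) * r.
    by rewrite /r; field; rewrite !gt_eqF.
  by rewrite ler_wpM2r// lerD2l ler_wpM2r// invr_ge0 ltW.
have hL : (1 - B1 / b) * r <= (b + 1) * (v * (2 * b + 1) / ((b + 1) ^+ 2 * (b ^+ 2 + v))).
  have -> : (b + 1) * (v * (2 * b + 1) / ((b + 1) ^+ 2 * (b ^+ 2 + v))) = (1 - 2^-1 / (b + 1)) * r.
    by rewrite /r; field; rewrite !gt_eqF.
  rewrite ler_wpM2r// lerD2l lerN2; apply: ler_pM; rewrite ?invr_ge0 ?(ltW b10)//.
    by have : 0 < b^-1 by [rewrite invr_gt0]; move: Bb; lra.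
  by rewrite lef_pV2 ?posrE// lerDl.
have := ler_wpM2l (ltW b10) U; have := ler_wpM2l (ltW b10) L.
move: (ln _) hU hL => e hU hL h1 h2; rewrite ler_norml; apply/andP; split.
  move: (le_trans hL h1); rewrite mulrBl mul1r; lra.
move: (le_trans h2 hU); rewrite mulrDl mul1r; lra.
Qed.

Lemma sum_psi (N : nat) t : \sum_(k < N) psi k t =
  \sum_(k < N) ell (qk k * t) - \sum_(k < N) rr (qk k * t)
  + l * ell (qk 0 * t) - (l + N%:R) * ell (qk N * t).
Proof.
elim: N => [|N IH]; first by rewrite !big_ord0 addr0 subrr add0r subrr.
rewrite !big_ord_recr/= IH /psi; move: (\sum_(_ < _) _) (\sum_(_ < _) _) => A B.
by rewrite -natr1; ring.
Qed.

Definition EL t : R := 2 * ln (gint l) - ln (gnorm2 l (a * t) 0).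

Lemma EL_cvg t : \sum_(k < n) ell (qk k * t) @[n --> \oo] --> EL t.
Proof.
have := @gnorm2_ln_series _ l (a * t) l0; apply: cvg_trans; apply: near_eq_cvg; apply: nearW => n.
by apply: eq_bigr => k _; rewrite /ell /qk mulrAC.
Qed.

Definition Psi t : R := EL t - RS t + l * ell (qk 0 * t).

Lemma cvg_invb : (l + n%:R)^-1 @[n --> \oo] --> (0 : R).
Proof. by have := cvg_invn l; under eq_fun do rewrite addrC. Qed.

Lemma psi_cvg t : \sum_(k < n) psi k t @[n --> \oo] --> Psi t.
Proof.
have hb : (l + n%:R) * ell (qk n * t) @[n --> \oo] --> (0 : R).
  have h : (a * t) ^+ 2 * (l + n%:R)^-1 @[n --> \oo] --> (0 : R).
    by rewrite -[X in _ --> X](mulr0 ((a * t) ^+ 2)); apply: cvgMr; exact: cvg_invb.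
  apply: squeeze_cvgr h; last exact: cvg_cst.
  apply: nearW => n; rewrite mulr_ge0 ?ell_ge0 ?(ltW (b_gt0 n))//=.
  have -> : (a * t) ^+ 2 / (l + n%:R) = (l + n%:R) * (qk n * t) ^+ 2.
    by rewrite /qk; field; rewrite gt_eqF.
  by rewrite ler_wpM2l ?ell_le ?(ltW (b_gt0 n)).
have hE := @EL_cvg t; have hR := @RS_cvg R l a l0 t.
have h : \sum_(k < n) ell (qk k * t) - \sum_(k < n) rr (qk k * t) + l * ell (qk 0 * t)
    - (l + n%:R) * ell (qk n * t) @[n --> \oo] --> EL t - RS t + l * ell (qk 0 * t) - 0.
  apply: cvgB; last exact: hb.
  apply: cvgD; last exact: cvg_cst.
  by apply: cvgB; [exact: hE|exact: hR].
rewrite subr0 in h; apply: cvg_trans h; apply: near_eq_cvg; apply: nearW => n.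
by rewrite sum_psi.
Qed.

Lemma psi_continuous k : continuous (psi k).
Proof.
move=> t; apply: (@continuousB R R R (fun t => (l + k.+1%:R) * (ell (qk k * t) - ell (qk k.+1 * t))) (fun t => rr (qk k * t))).
  apply: (@continuousM R R (fun=> l + k.+1%:R) (fun t => ell (qk k * t) - ell (qk k.+1 * t))); first exact: cst_continuous.
  by apply: (@continuousB R R R (fun t => ell (qk k * t)) (fun t => ell (qk k.+1 * t))); exact: ell_scale_continuous.
exact: rr_scale_continuous.
Qed.

Let psi_bound k t : `|psi k t| <= B1 / (l + k%:R) * 2.
Proof.
apply: le_trans (psi_norm_le k t) _; rewrite ler_wpM2l ?rr_le2//.
by rewrite divr_ge0 ?(ltW (b_gt0 k)).
Qed.

Lemma psi_itg n k : itg (fun t => psi k t * ((onp n).[xt t] ^+ 2 * W t)).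
Proof. exact: (mean_itg l0 a0 n (@psi_continuous k) (psi_bound k)). Qed.

Lemma sqrD1_W_itg n : itg (fun t => (1 + (a * t) ^+ 2) * ((onp n).[xt t] ^+ 2 * W t)).
Proof.
apply: itg_le (itgZ (coef_norm (onp n) ^+ 2 * (wconst l a * gint l ^+ 2 * (4 + a ^+ 2))) cauchy_itg).
  apply: continuous_measurable_fun => t.
  apply: (@continuousM R R (fun t => 1 + (a * t) ^+ 2) (fun t => (onp n).[xt t] ^+ 2 * W t)).
    by eapply is_derive_continuous; der.
  exact: sqr_onp_W_continuous.
move=> t; rewrite normrM (gtr0_norm (sqrD1_gt0 _)) (ger0_norm (sqr_onp_W_ge0 l0 a0 n t)).
rewrite mulrCA -[leRHS]mulrA; apply: ler_pM.
- exact: sqr_ge0.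
- by apply: mulr_ge0; [exact/ltW/sqrD1_gt0|exact/ltW/W_gt0].
- by rewrite -real_normK ?num_real// lerXn2r ?nnegrE ?coef_norm_ge0// horner_xt_le.
have K0 : 0 <= wconst l a * gint l ^+ 2.
  by apply: mulr_ge0; [exact/ltW/wconst_gt0|exact: sqr_ge0].
have c0 := ltW (cauchy_gt0 t).
have w1 : W t <= wconst l a * gint l ^+ 2 * expR (- (2 * a * t * atan t)) * cauchy t.
  apply: le_trans (W_le l0 a0 t) _; rewrite ler_wpM2r// ler_wpM2r ?expR_ge0//.
  by rewrite (ler_piMr K0)// powR_sqrD1_le1// ltW.
apply: le_trans (ler_wpM2l (ltW (sqrD1_gt0 _)) w1) _.
have := ler_wpM2l K0 (sqr_expR_atan_le a0 t).
move: (wconst l a * _) (expR _) (1 + _) => A C D h.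
have -> : D * (A * C * cauchy t) = A * (D * C) * cauchy t by ring.
by rewrite ler_wpM2r.
Qed.

Let S2 : R := l ^- 2 + l^-1.

Let rr_le_norm y : rr y <= `|y|.
Proof.
rewrite /rr ler_pdivrMr ?sqrD1_gt0// -[y ^+ 2]real_normK ?num_real//.
move: `|y| (normr_ge0 y) => x x0; have := mulr_ge0 x0 (sqr_ge0 (x - 1)); lra.
Qed.

Let sum_psi_le (N : nat) t : `|\sum_(k < N) psi k t| <= B1 * S2 * (1 + (a * t) ^+ 2).
Proof.
apply: le_trans (ler_norm_sum _ _ _) _.
apply: le_trans (_ : \sum_(k < N) B1 * (1 + (a * t) ^+ 2) * (l + k%:R) ^- 2 <= _).
  apply: ler_sum => k _; apply: le_trans (psi_norm_le k t) _.
  have b0 := b_gt0 k; have bk : l + k%:R != 0 by rewrite gt_eqF.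
  have h1 : rr (qk k * t) <= (1 + (a * t) ^+ 2) / (l + k%:R).
    apply: le_trans (rr_le_norm _) _.
    rewrite /qk mulrAC normrM normfV (gtr0_norm b0) ler_wpM2r ?invr_ge0 ?(ltW b0)//.
    rewrite -[(a * t) ^+ 2]real_normK ?num_real//; move: `|a * t| => x.
    by have := sqr_ge0 (x - 1); have := sqr_ge0 x; lra.
  have -> : B1 * (1 + (a * t) ^+ 2) * (l + k%:R) ^- 2 = B1 / (l + k%:R) * ((1 + (a * t) ^+ 2) / (l + k%:R)).
    by field.
  by rewrite ler_wpM2l// divr_ge0// ltW.
have k0 : 0 <= B1 * (1 + (a * t) ^+ 2) by apply: mulr_ge0 => //; exact/ltW/sqrD1_gt0.
rewrite -mulr_sumr [leRHS]mulrAC; apply: (ler_wpM2l k0).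
exact: sum_inv_sqr_le.
Qed.

(** For fixed [n] a majorant [1 + (a t)^2] of the partial sums suffices, with no uniformity in [n];
    that is needed only for the tails. *)
Lemma Psi_mean n : itg (fun t => Psi t * ((onp n).[xt t] ^+ 2 * W t)) /\
  \sum_(k < N) mean n (psi k) @[N --> \oo] --> mean n Psi.
Proof.
pose w t := (onp n).[xt t] ^+ 2 * W t.
have w0 t : 0 <= w t by exact: sqr_onp_W_ge0.
have sE N t : (\sum_(k < N) psi k t) * w t = \sum_(k < N) psi k t * w t by rewrite mulr_suml.
have isum N : itg (fun t => \sum_(k < N) psi k t * w t).
  by apply: itg_sum => k; exact: psi_itg.
have [|||i1 l1] := @int_dct _ (fun N t => (\sum_(k < N) psi k t) * w t) (fun t => Psi t * w t) _ _ (itgZ (B1 * S2) (sqrD1_W_itg n)).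
- move=> N; apply: itg_measurable; have := isum N; congr itg.
  by apply/funext => t; rewrite sE.
- move=> N t; rewrite normrM (ger0_norm (w0 t)).
  by have := ler_wpM2r (w0 t) (sum_psi_le N t); rewrite -[leRHS]mulrA.
- move=> t; have h := @psi_cvg t; apply: cvgMl; exact: h.
split; first exact: i1.
apply: cvg_trans l1; apply: near_eq_cvg; apply: nearW => N.
rewrite /mean -int_sum; last by move=> k; exact: psi_itg.
by congr RInt; apply/funext => t; rewrite sE.
Qed.

Lemma tail_inv_sqr_le (M N : nat) : \sum_(k < N) (l + (M + k)%N%:R) ^- 2 <= (1 + l^-1) / (l + M%:R).
Proof.
suff h : \sum_(k < N) (l + (M + k)%N%:R) ^- 2 <= (1 + l^-1) * ((l + M%:R)^-1 - (l + (M + N)%N%:R)^-1).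
  apply: le_trans h _; rewrite ler_wpM2l ?addr_ge0 ?invr_ge0 ?(ltW l0)//.
  by rewrite lerBlDr lerDl invr_ge0 ltW// b_gt0.
elim: N => [|N IH]; first by rewrite big_ord0 addn0 subrr mulr0.
rewrite big_ord_recr/=; move: IH; set S := \sum_(_ < _) _ => IH.
suff : (l + (M + N)%N%:R) ^- 2 <= (1 + l^-1) * ((l + (M + N)%N%:R)^-1 - (l + (M + N.+1)%N%:R)^-1).
  by rewrite !mulrBr in IH *; lra.
rewrite addnS -natr1 addrA.
have lb : l <= l + (M + N)%N%:R by rewrite lerDl.
move: (l + (M + N)%N%:R) (b_gt0 (M + N)%N) lb => b b0 lb.
have b1 : 0 < b + 1 by rewrite addr_gt0.
have -> : b^-1 - (b + 1)^-1 = b ^- 2 * (b / (b + 1)) by field; rewrite !gt_eqF.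
rewrite mulrCA ler_peMr ?invr_ge0 ?sqr_ge0// mulrA ler_pdivlMr// mul1r mulrDl mul1r lerD2l.
by rewrite mulrC ler_pdivlMr// mul1r.
Qed.

Definition psi_lim (k : nat) : R :=
  (l + k.+1%:R) * (2 * ln (1 + qk k) - 2 * ln (1 + qk k.+1)) - 2 * qk k / (1 + qk k).

Lemma mean_rr_cvg0 s : 0 <= s -> mean n (fun t => rr (s * t)) @[n --> \oo] --> 2 * s / (1 + s).
Proof.
rewrite le_eqVlt => /predU1P[<-|s0]; last exact: mean_rr_cvg.
rewrite mulr0 mul0r; apply: cvg_near_cst; apply: nearW => n.
by rewrite -[RHS]int0; congr RInt; apply/funext => t; rewrite /rr mul0r expr0n/= mulr0 !mul0r.
Qed.

Let q_ge0 k : 0 <= qk k. Proof. exact: qk_ge0. Qed.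

Lemma mean_psi_cvg k : mean n (psi k) @[n --> \oo] --> psi_lim k.
Proof.
have e n : mean n (psi k) = (l + k.+1%:R) * (mean n (fun t => ell (qk k * t)) - mean n (fun t => ell (qk k.+1 * t)))
    - mean n (fun t => rr (qk k * t)).
  have i1 := mean_ell_itg l0 a0 n (qk k); have i2 := mean_ell_itg l0 a0 n (qk k.+1).
  have i3 := mean_rr_itg l0 a0 n (qk k).
  rewrite /mean -intB// -intZ; last exact: itgB.
  rewrite -intB//; last exact/itgZ/itgB.
  by congr RInt; apply/funext => t; rewrite /psi; ring.
have h1 := mean_ell_cvg l0 a0 (q_ge0 k); have h2 := mean_ell_cvg l0 a0 (q_ge0 k.+1).
have h3 := mean_rr_cvg0 (q_ge0 k).
have h : (l + k.+1%:R) * (mean n (fun t => ell (qk k * t)) - mean n (fun t => ell (qk k.+1 * t)))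
    - mean n (fun t => rr (qk k * t)) @[n --> \oo] --> psi_lim k.
  apply: cvgB; last exact: h3.
  by apply: cvgMr; apply: cvgB; [exact: h1|exact: h2].
by apply: cvg_trans h; apply: near_eq_cvg; apply: nearW => n; rewrite e.
Qed.

(** The means of [psi k] are [O((l + k)^(-2))] uniformly in [n], so the tails are uniformly small.
    The sum is cut at [n] and not evaluated at infinity, in order to match the harmonic sum of
    [by_parts_mean n] term by term. *)
Lemma mean_Psi_cvg : mean n Psi - \sum_(k < n) psi_lim k @[n --> \oo] --> (0 : R).
Proof.
have [C C0 hC] := mean_rr_le l0 a0.
have hC0 n s : 0 <= s -> mean n (fun t => rr (s * t)) <= C * s.
  rewrite le_eqVlt => /predU1P[<-|]; last exact: hC.
  rewrite mulr0 le_eqVlt; apply/orP; left; apply/eqP.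
  by rewrite -[RHS]int0; congr RInt; apply/funext => t; rewrite /rr mul0r expr0n/= mulr0 !mul0r.
have psi_le n k : `|mean n (psi k)| <= B1 * C * a * (l + k%:R) ^- 2.
  have i3 := mean_rr_itg l0 a0 n (qk k).
  apply: le_trans (_ : B1 / (l + k%:R) * mean n (fun t => rr (qk k * t)) <= _).
    rewrite -intZ//; apply: int_norm_le; [exact: psi_itg|exact: itgZ|] => t.
    rewrite normrM (ger0_norm (sqr_onp_W_ge0 l0 a0 n t)) [leRHS]mulrA ler_wpM2r ?psi_norm_le//.
    exact: sqr_onp_W_ge0.
  have b0 := b_gt0 k.
  have k0 : 0 <= B1 / (l + k%:R) by rewrite divr_ge0// ltW.
  apply: le_trans (ler_wpM2l k0 (hC0 n _ (q_ge0 k))) _.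
  by rewrite le_eqVlt; apply/orP; left; apply/eqP; rewrite /qk; field; rewrite gt_eqF.
apply: (@cvg_uniform_approx_sub _ _ (fun M n => \sum_(k < M) mean n (psi k))
  (fun M => B1 * C * a * ((1 + l^-1) / (l + M%:R)))).
- move=> M n; have [_ h] := Psi_mean n.
  have h2 : `|\sum_(k < N + M) mean n (psi k) - \sum_(k < M) mean n (psi k)| @[N --> \oo] -->
      `|mean n Psi - \sum_(k < M) mean n (psi k)|.
    apply: cvg_norm; apply: cvgB; last exact: cvg_cst.
    by rewrite (cvg_shiftn M (fun N => \sum_(k < N) mean n (psi k))); exact: h.
  apply: (ler_cvg_to h2 (cvg_cst _)); apply: nearW => N.
  rewrite addnC big_split_ord/= addrAC subrr add0r.
  apply: le_trans (ler_norm_sum _ _ _) _.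
  apply: le_trans (_ : \sum_(k < N) B1 * C * a * (l + (M + k)%N%:R) ^- 2 <= _).
    by apply: ler_sum => k _; exact: psi_le.
  have k0 : 0 <= B1 * C * a by rewrite mulr_ge0// mulr_ge0.
  rewrite -mulr_sumr; apply: (ler_wpM2l k0); exact: tail_inv_sqr_le.
- rewrite -[X in _ --> X](mulr0 (B1 * C * a)); apply: cvgMr.
  rewrite -[X in _ --> X](mulr0 (1 + l^-1)); apply: cvgMr; exact: cvg_invb.
- move=> M; elim: M => [|M IH].
    rewrite big_ord0 (_ : (fun _ => _) = fun=> 0); first exact: cvg_cst.
    by apply/funext => n; rewrite big_ord0.
  rewrite big_ord_recr/= (_ : (fun n => _) = fun n => \sum_(k < M) mean n (psi k) + mean n (psi M)); last first.
    by apply/funext => n; rewrite big_ord_recr.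
  by apply: cvgD; [exact: IH|exact: mean_psi_cvg].
Qed.

(** The summation by parts behind [psi] is undone, and [qk k / (1 + qk k) = a / (k + l + a)]
    produces the harmonic sum. The last term has a nonzero limit, in contrast to the pointwise
    [(l + N) ell (qk N * t)]. *)
Lemma sum_psi_lim (N : nat) : \sum_(k < N) psi_lim k =
  2 * \sum_(k < N) ln (1 + qk k) - 2 * a * \sum_(k < N) (k%:R + (l + a))^-1
  + 2 * l * ln (1 + qk 0) - 2 * ((l + N%:R) * ln (1 + qk N)).
Proof.
elim: N => [|N IH]; first by rewrite !big_ord0 addr0; ring.
rewrite !big_ord_recr/= IH /psi_lim.
have -> : 2 * qk N / (1 + qk N) = 2 * a * (N%:R + (l + a))^-1.
  have b0 := b_gt0 N; have n0 : 0 <= N%:R :> R by [].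
  rewrite /qk; field; move: (N%:R) b0 n0 => x b0 x0.
  by rewrite !gt_eqF//; move: l0 a0; lra.
move: (\sum_(_ < _) _) (\sum_(_ < _) _) => A B.
by rewrite -natr1; ring.
Qed.

End GammaFactor.

(** * Asymptotics *)

Section Asymptotics.
Context {R : realType}.
Implicit Types (f g F : R -> R) (x y b c d h s t u r z : R) (p : {poly R}).

Local Notation mu := (@lebesgue_measure R).

Variables (l a : R).
Hypotheses (l0 : 0 < l) (a0 : 0 <= a).

Local Notation W := (W l a).
Local Notation Lp := (Lp l a).
Local Notation alpha := (alpha l a).
Local Notation onp := (onp l a).
Local Notation mean := (mean l a).
Local Notation qk := (qk l a).
Local Notation RS := (RS l a).
Local Notation Psi := (Psi l a).
Local Notation EL := (EL l a).

Let c : R := l + a.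

Let c_gt0 : 0 < c. Proof. by rewrite /c ltr_wpDr. Qed.

(** Minus the residue at [k = - c] of [4 alpha k.+1] as a rational function of [k]. *)
Let B : R := c ^+ 2 - c - 2 * a * c + 2 * a.

Lemma alpha_partial_fractions k : 4 * alpha k.+1 =
  1 - 2 * a / (k%:R + 1 + c) - B * ((k%:R + c)^-1 - (k%:R + 1 + c)^-1).
Proof.
rewrite /alpha -[k.+1%:R]natr1 /B -/c; have e : l = c - a by rewrite /c addrK.
have x0 : 0 <= k%:R :> R by []; rewrite e; move: (k%:R : R) x0 c c_gt0 => x x0 d d0.
have n1 : x + 1 + d != 0 by rewrite gt_eqF//; lra.
have n2 : x + d != 0 by rewrite gt_eqF//; lra.
have n3 : x + 1 + d - 1 = x + d by ring.
by rewrite n3; field; rewrite n1 n2.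
Qed.

Lemma sum_alpha (N : nat) : 4 * \sum_(k < N) alpha k.+1 =
  N%:R - 2 * a * (\sum_(k < N.+1) (k%:R + c)^-1 - c^-1) - B * (c^-1 - (N%:R + c)^-1).
Proof.
elim: N => [|N IH].
  by rewrite big_ord0 big_ord1 /= ?add0r; ring.
rewrite big_ord_recr/= mulrDr IH alpha_partial_fractions [in RHS]big_ord_recr/=.
move: (\sum_(_ < _) _) => S; rewrite -[N.+1%:R]natr1; ring.
Qed.

Definition by_parts_mean n : R := RInt (fun t => (2 * a * t * atan t + RS t) * ((onp n).[xt t] ^+ 2 * W t)).

Lemma by_parts_itg n : itg (fun t => (2 * a * t * atan t + RS t) * ((onp n).[xt t] ^+ 2 * W t)).
Proof.
have [i _] := pollaczek_by_parts l0 a0 (onp n * onp n).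
by move: i; congr itg; apply/funext => t; rewrite hornerM; ring.
Qed.

(** The value given by integration by parts, with [x = n], [d = l + a], [e = a] and [S] the harmonic
    sum of [n + 2] terms, isolated over plain variables for [field]. All contributions of the
    residue [B] cancel. *)
Let rational_identity (x d e S : R) : d != 0 -> x + 1 + d != 0 -> x + 1 + 1 + d != 0 ->
    x + 1 + 1 + 1 + d != 0 ->
  1 + 2 * (x + 1 + 1) -
  2 *
  ((x + 1 + 1) *
   (4^-1 *
    (1 - 2 * e / (x + 1 + 1 + 1 + d) -
     (d ^+ 2 - d - 2 * e * d + 2 * e) *
     ((x + 1 + 1 + d)^-1 - (x + 1 + 1 + 1 + d)^-1)) +
    4^-1 *
    (1 - 2 * e / (x + 1 + 1 + d) -
     (d ^+ 2 - d - 2 * e * d + 2 * e) * ((x + 1 + d)^-1 - (x + 1 + 1 + d)^-1))) +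
   2 *
   (4^-1 *
    (x + 1 - 2 * e * (S - d^-1) -
     (d ^+ 2 - d - 2 * e * d + 2 * e) * (d^-1 - (x + 1 + d)^-1)))) -
  (2 * d + 2) *
  (4^-1 *
   (1 - 2 * e / (x + 1 + 1 + 1 + d) -
    (d ^+ 2 - d - 2 * e * d + 2 * e) *
    ((x + 1 + 1 + d)^-1 - (x + 1 + 1 + 1 + d)^-1)) +
   4^-1 *
   (1 - 2 * e / (x + 1 + 1 + d) -
    (d ^+ 2 - d - 2 * e * d + 2 * e) * ((x + 1 + d)^-1 - (x + 1 + 1 + d)^-1))) =
  2 * e * S + e / (x + 1 + 1 + d).
Proof. by move=> n0 n1 n2 n3; field; rewrite n0 n1 n2 n3. Qed.

(** Integration by parts with [q = p_N^2], [N = n + 2]; the index is at least 2 because the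
    coefficient two places below the top enters. *)
Lemma by_parts_meanE n : by_parts_mean n.+2 =
  2 * a * (\sum_(k < n.+2) (k%:R + c)^-1) + a / (n.+2%:R + c).
Proof.
have [_ e] := pollaczek_by_parts l0 a0 (onp n.+2 * onp n.+2).
have -> : by_parts_mean n.+2 = RInt (fun t => (2 * a * t * atan t + RS t) * (onp n.+2 * onp n.+2).[xt t] * W t).
  by congr RInt; apply/funext => t; rewrite hornerM; ring.
rewrite {}e derivM.
have h0 := Lp_onp l0 a0 n.+2 n.+2; have h1 := Lp_X2_onp l0 a0 n.+1.
have h2 := Lp_X_deriv_onp l0 a0 n.+2; have h3 := Lp_X3_deriv_onp l0 a0 n.
rewrite eqxx mulr1n expr2 in h0 h1.
have gen (P D : {poly R}) k : Lp (P * P + 'X * (1 - 'X^2) * (D * P + P * D) - k *: ('X^2 * (P * P))) =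
    Lp (P * P) + 2 * Lp ('X * P * D) - 2 * Lp ('X^3 * P * D) - k * Lp ('X^2 * (P * P)).
  have -> : P * P + 'X * (1 - 'X^2) * (D * P + P * D) - k *: ('X^2 * (P * P)) =
     P * P + 2 *: ('X * P * D) - 2 *: ('X^3 * P * D) - k *: ('X^2 * (P * P)).
    by rewrite !scaler_nat; ring.
  by rewrite !LpB// LpD// !LpZ.
rewrite gen h0 -expr2 h1 h2 h3 {gen h0 h1 h2 h3}.
have e4 : \sum_(j < n.+1) alpha j.+1 = 4^-1 * (4 * \sum_(j < n.+1) alpha j.+1).
  by rewrite mulrA mulVf ?mul1r.
have e5 k : alpha k.+1 = 4^-1 * (4 * alpha k.+1) by rewrite mulrA mulVf ?mul1r.
rewrite e4 sum_alpha (e5 n.+2) (e5 n.+1) !alpha_partial_fractions.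
move: (\sum_(_ < _) _) => S; rewrite /B -/c -[n.+2%:R]natr1 -[n.+1%:R]natr1.
have x0 : 0 <= n%:R :> R by [].
by apply: rational_identity; rewrite gt_eqF//; have := c_gt0; lra.
Qed.

Lemma by_parts_mean_cvg :
  by_parts_mean n - 2 * a * (\sum_(k < n) (k%:R + c)^-1) @[n --> \oo] --> (0 : R).
Proof.
have h : a * (n%:R + c)^-1 @[n --> \oo] --> (0 : R).
  by rewrite -[X in _ --> X](mulr0 a); apply: cvgMr; exact: cvg_invn.
apply: cvg_trans h; apply: near_eq_cvg; exists 2%N => // -[|[|n]] //= _.
by rewrite by_parts_meanE; ring.
Qed.

Let c0 : R := ln (wconst l a) + 2 * ln (gint l).

Let psi_sumE t : Psi t = 2 * ln (gint l) - ln (gnorm2 l (a * t) 0) - RS t + l * ell (qk 0 * t).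
Proof. by []. Qed.

(** [RS] is added and subtracted: it completes [2 a t atan t] to the function of exact mean, and its
    negative sits in [Psi] together with the logarithm of the product. The exponent [- l] of
    [1 + t^2] and the square root from the Jacobian [xt'] give [- (l - 1/2)]; the last term undoes
    the boundary term of [Psi]. *)
Lemma ln_weight t : ln (W t / xt' t) = c0 - (l - 2^-1) * ell (1 * t)
  - (2 * a * t * atan t + RS t) - Psi t + l * ell (qk 0 * t).
Proof.
have g0 := gnorm2_gt0 (a * t) l0; have C0 := wconst_gt0 l0 a0.
have c1 := cauchy_gt0 t; have d0 := sqrD1_gt0 t; have r0 := sqrt_sqrD1_gt0 t.
have -> : W t / xt' t = wconst l a * gnorm2 l (a * t) 0 * (1 + t ^+ 2) `^ (- l) *
    expR (- (2 * a * t * atan t)) * (1 + t ^+ 2) `^ 2^-1.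
  rewrite W_expl// /xt' powR12_sqrt ?(ltW d0)//; move: (cauchy t) c1 (Num.sqrt _) r0 (wconst l a) (gnorm2 _ _ _) (_ `^ _) (expR _).
  by move=> A A0 D D0 E F G H; field; rewrite !gt_eqF.
rewrite psi_sumE /c0 /ell mul1r; move: (wconst l a) C0 (gnorm2 l (a * t) 0) g0 => C C0 G g0.
rewrite !lnM ?posrE ?mulr_gt0 ?powR_gt0 ?expR_gt0// !ln_powR expRK.
by move: (ln _) (ln _) (ln _) (ln _) (ln _) (RS t) (atan t) => u1 u2 u3 u4 u5 u6 u7; ring.
Qed.

Lemma log_integral_mean n : log_integral (pollaczek_weight l a) onp n =
  c0 - (l - 2^-1) * mean n (fun t => ell (1 * t)) - by_parts_mean n - mean n Psi
  + l * mean n (fun t => ell (qk 0 * t)).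
Proof.
pose w t := (onp n).[xt t] ^+ 2 * W t.
have xn t : xt' t != 0 by rewrite gt_eqF// xt'_gt0.
have wx0 t : 0 < W t / xt' t by rewrite divr_gt0 ?W_gt0// xt'_gt0.
have cV : continuous (fun t => W t / xt' t).
  move=> t; apply: (@continuousM R R W (fun t => (xt' t)^-1)); first exact: W_continuous.
  by apply: (@continuousV R R); [exact: xn|exact: xt'_continuous].
have cP : continuous (fun t => (onp n).[xt t] ^+ 2).
  rewrite (_ : (fun t => _) = fun t => (onp n ^+ 2).[xt t]); first exact: horner_xt_continuous.
  by apply/funext => t; rewrite horner_exp.
rewrite /log_integral (@int_xt _ _ (fun t => ln (W t / xt' t) * (onp n).[xt t] ^+ 2 * (W t / xt' t))); last 2 first.
- move=> t; apply: (@continuousM R R (fun t => ln (W t / xt' t) * (onp n).[xt t] ^+ 2) (fun t => W t / xt' t)); last exact: cV.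
  apply: (@continuousM R R (fun t => ln (W t / xt' t)) (fun t => (onp n).[xt t] ^+ 2)); last exact: cP.
  apply: (@continuous_comp _ _ _ (fun t => W t / xt' t) (@ln R)); first exact: cV.
  exact: continuous_ln.
- by move=> t; rewrite pollaczek_weight_xt.
have i1 : itg (fun t => ell (1 * t) * w t) by exact: mean_ell_itg.
have i2 : itg (fun t => (2 * a * t * atan t + RS t) * w t) by exact: by_parts_itg.
have i3 : itg (fun t => Psi t * w t) by exact: (proj1 (Psi_mean l0 a0 n)).
have i4 : itg (fun t => ell (qk 0 * t) * w t) by exact: mean_ell_itg.
have i0 : itg w by exact: sqr_onp_W_itg.
have -> : c0 = RInt (fun t => c0 * w t) by rewrite intZ// sqr_onp_W_int// mulr1.
rewrite /mean /by_parts_mean -/w.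
rewrite -(intZ (l - 2^-1) i1) -(intZ l i4).
have j0 := itgZ c0 i0; have j1 := itgZ (l - 2^-1) i1; have j4 := itgZ l i4.
have k1 := itgB j0 j1; have k2 := itgB k1 i2; have k3 := itgB k2 i3.
rewrite -(intB j0 j1) -(intB k1 i2) -(intB k2 i3) -(intD k3 j4).
congr RInt; apply/funext => t; rewrite ln_weight /w.
by move: (ell _) (ell _) (RS t) (Psi t) (W t) (xn t) => A D E F G H; field.
Qed.

(** Squeeze by [1 - 1 / (1 + q) <= ln (1 + q) <= q] at [q = qk n]. Twice this limit is the constant
    [2 a] of the theorem. *)
Lemma lnb_cvg : (l + n%:R) * ln (1 + qk n) @[n --> \oo] --> a.
Proof.
have h : a * ((n%:R + l) / (n%:R + c)) @[n --> \oo] --> a.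
  by rewrite -[X in _ --> X]mulr1; apply: cvgMr; exact: cvg_ratio.
apply: (squeeze_cvgr _ h (cvg_cst a)); apply: nearW => n.
have b0 : 0 < l + n%:R by exact: lk_gt0.
have q0 : 0 <= qk n by exact: qk_ge0.
have q1 : 0 < 1 + qk n by rewrite ltr_pwDl.
have e : a = (l + n%:R) * qk n by rewrite /qk mulrC divfK// gt_eqF.
have bc : 0 < n%:R + c by rewrite ltr_wpDl.
apply/andP; split; last first.
  by rewrite [leRHS]e ler_wpM2l ?(ltW b0)// le_ln1Dx// (lt_le_trans _ q0).
have -> : a * ((n%:R + l) / (n%:R + c)) = (l + n%:R) * (1 - (1 + qk n)^-1).
  have d : l + n%:R + a = n%:R + c by rewrite /c; ring.
  rewrite /qk -d; have := lt0r_neq0 bc; rewrite -d; move: (lt0r_neq0 b0).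
  have -> : n%:R + l = l + n%:R by rewrite addrC.
  move: (l + n%:R) => b bn bn1; field; rewrite bn /=.
  by rewrite bn1.
rewrite ler_wpM2l ?(ltW b0)//.
have : ln (1 + ((1 + qk n)^-1 - 1)) <= (1 + qk n)^-1 - 1.
  by apply: le_ln1Dx; rewrite ltrBrDr addNr invr_gt0.
by rewrite addrC subrK lnV ?posrE//; move: (ln _) (_^-1) => A D; lra.
Qed.

(** Since [1 + qk k = (l + a + k) / (l + k)], the product over [k < n] is a quotient of Gamma
    values, and [Gamma(l + n + a)] is asymptotic to [Gamma(l + n) n^a]. *)
Lemma sum_ln_qk_cvg : \sum_(k < n) ln (1 + qk k) - a * ln n%:R @[n --> \oo] --> ln (gint l) - ln (gint c).
Proof.
have gl := gint_gt0 l0; have gc := gint_gt0 c_gt0.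
have h1 := gint_ratio_cvg l0 a0.
have h2 : ln (gint (l + n%:R + a) / (gint (l + n%:R) * expR (a * ln n%:R))) @[n --> \oo] --> (0 : R).
  rewrite -[X in _ --> X](@ln1 R).
  by apply: (@cvg_comp _ _ _ _ (@ln R) _ _ _ h1); apply: continuous_ln; exact: ltr01.
have h3 : (ln (gint l) - ln (gint c)) + ln (gint (l + n%:R + a) / (gint (l + n%:R) * expR (a * ln n%:R)))
    @[n --> \oo] --> (ln (gint l) - ln (gint c)) + 0.
  by apply: cvgD; [exact: cvg_cst|exact: h2].
rewrite addr0 in h3; apply: cvg_trans h3; apply: near_eq_cvg; apply: nearW => n.
have -> : l + n%:R + a = c + n%:R by rewrite /c; ring.
have p1 : 0 < \prod_(k < n) (c + k%:R) by apply: prodr_gt0 => k _; rewrite ltr_wpDr.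
have p2 : 0 < \prod_(k < n) (l + k%:R) by apply: prodr_gt0 => k _; rewrite ltr_wpDr.
rewrite !gint_prod// ln_div ?posrE ?mulr_gt0 ?expR_gt0//.
rewrite !lnM ?posrE ?mulr_gt0 ?expR_gt0// expRK.
have -> : \sum_(k < n) ln (1 + qk k) = ln (\prod_(k < n) (c + k%:R)) - ln (\prod_(k < n) (l + k%:R)).
  elim: n {p1 p2} => [|n IH]; first by rewrite !big_ord0 subrr.
  have b0 : 0 < l + n%:R by exact: lk_gt0.
  have b1 : 0 < c + n%:R by rewrite ltr_wpDr.
  have p1 : 0 < \prod_(k < n) (c + k%:R) by apply: prodr_gt0 => k _; rewrite ltr_wpDr.
  have p2 : 0 < \prod_(k < n) (l + k%:R) by apply: prodr_gt0 => k _; rewrite ltr_wpDr.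
  rewrite !big_ord_recr/= IH !lnM ?posrE//.
  have -> : 1 + qk n = (c + n%:R) / (l + n%:R) by rewrite /qk /c; field; rewrite gt_eqF.
  by rewrite ln_div ?posrE//; ring.
by ring.
Qed.

Lemma log_integral_onp_cvg :
  log_integral (pollaczek_weight l a) onp n + 2 * a * ln n%:R @[n --> \oo] -->
  ln (wconst l a) + 2 * ln (gint c) - (2 * l - 1) * ln 2 + 2 * a.
Proof.
have q0 : 0 <= qk 0 by exact: qk_ge0.
have h1 := mean_ell_cvg l0 a0 (ler01 : 0 <= 1 :> R).
have h2 := mean_ell_cvg l0 a0 q0.
have h3 := by_parts_mean_cvg; have h4 := mean_Psi_cvg l0 a0.
have h5 := lnb_cvg; have h6 := sum_ln_qk_cvg.
pose L1 := mean^~ (fun t => ell (1 * t)); pose L2 := mean^~ (fun t => ell (qk 0 * t)).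
have h : c0 - (l - 2^-1) * L1 n - (by_parts_mean n - 2 * a * (\sum_(k < n) (k%:R + c)^-1))
   - (mean n Psi - \sum_(k < n) psi_lim l a k) + l * L2 n
   - 2 * (\sum_(k < n) ln (1 + qk k) - a * ln n%:R) - 2 * l * ln (1 + qk 0)
   + 2 * ((l + n%:R) * ln (1 + qk n)) @[n --> \oo] -->
   c0 - (l - 2^-1) * (2 * ln (1 + 1)) - 0 - 0 + l * (2 * ln (1 + qk 0))
   - 2 * (ln (gint l) - ln (gint c)) - 2 * l * ln (1 + qk 0) + 2 * a.
  apply: cvgD; last by apply: cvgMr; exact: h5.
  apply: cvgB; last exact: cvg_cst.
  apply: cvgB; last by apply: cvgMr; exact: h6.
  apply: cvgD; last by apply: cvgMr; exact: h2.
  apply: cvgB; last exact: h4.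
  apply: cvgB; last exact: h3.
  by apply: cvgB; [exact: cvg_cst|apply: cvgMr; exact: h1].
rewrite -[X in _ --> X](_ : c0 - (l - 2^-1) * (2 * ln (1 + 1)) - 0 - 0 + l * (2 * ln (1 + qk 0))
   - 2 * (ln (gint l) - ln (gint c)) - 2 * l * ln (1 + qk 0) + 2 * a = _); last first.
  rewrite /c0 (_ : 1 + 1 = 2); last by [].
  by move: (ln _) (ln _) (ln _) (ln _) (ln _) => A D E F G; field.
apply: cvg_trans h; apply: near_eq_cvg; apply: nearW => n.
rewrite log_integral_mean (sum_psi_lim l0 a0) -/c /L1 /L2.
move: (mean _ _) (mean _ _) (mean _ _) (by_parts_mean n) (\sum_(_ < _) _) (\sum_(_ < _) _) (ln _) (ln _) (ln _).
by move=> A D E F G H I J K; ring.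
Qed.

(** The factor [l + a] of [wconst] turns one [Gamma(l + a)] into [Gamma(l + a + 1)]. The powers of 2
    disappear: [2^(2 l)] over the 2 of [2 pi] is what [(2 l - 1) ln 2], from the mean of
    [ln (1 + t^2)], subtracts. *)
Lemma pollaczek_constant : ln (wconst l a) + 2 * ln (gint c) - (2 * l - 1) * ln 2 =
  ln (Gamma (l + a) * Gamma (l + a + 1) / (pi * Gamma (2 * l))).
Proof.
have gc := gint_gt0 c_gt0; have l20 : 0 < 2 * l by rewrite mulr_gt0.
have g2 := gint_gt0 l20; have p0 := @pi_gt0 R.
have c1 : 0 < l + a + 1 by rewrite addr_gt0.
rewrite !Gamma_gint// -/c gintS// /wconst -/c.
have t0 : 0 < 2 `^ (2 * l) :> R by rewrite powR_gt0.
have gcS : 0 < gint c * (c * gint c) by rewrite !mulr_gt0.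
rewrite [in RHS]ln_div ?posrE ?mulr_gt0// ln_div ?posrE ?mulr_gt0//.
rewrite !lnM ?posrE ?mulr_gt0// ln_powR.
by move: (ln _) (ln _) (ln _) (ln _) (ln _) => A D E F G; ring.
Qed.

End Asymptotics.

Theorem theorem1p3 (R : realType) (lambda a : R) (p : nat -> {poly R})
    (lambda_gt0 : 0 < lambda) (a_ge0 : 0 <= a)
    (hp : orthonormal_polynomials (pollaczek_weight lambda a) p) :
  (fun n : nat =>
     log_integral (pollaczek_weight lambda a) p n
     - (- 2 * a * ln n%:R + 2 * a
        + ln (Gamma (lambda + a) * Gamma (lambda + a + 1)
              / (pi * Gamma (2 * lambda))))) @ \oo --> (0 : R).
Proof.
have h := log_integral_onp_cvg lambda_gt0 a_ge0.
have hK : log_integral (pollaczek_weight lambda a) (onp lambda a) n + 2 * a * ln n%:R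
    - (ln (wconst lambda a) + 2 * ln (gint (lambda + a)) - (2 * lambda - 1) * ln 2 + 2 * a)
    @[n --> \oo] --> (0 : R).
  by rewrite -(subrr (ln (wconst lambda a) + 2 * ln (gint (lambda + a)) - (2 * lambda - 1) * ln 2 + 2 * a));
    apply: cvgB; [exact: h|exact: cvg_cst].
apply: cvg_trans hK; apply: near_eq_cvg; apply: nearW => n.
rewrite pollaczek_constant//.
have -> : log_integral (pollaczek_weight lambda a) (onp lambda a) n =
    log_integral (pollaczek_weight lambda a) p n.
  by rewrite /log_integral (orthonormal_unique lambda_gt0 a_ge0 hp).
ring.
Qed.
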